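(* Let $k$ be a positive integer, let $G$ be a $50k$-connected graph and let $S \subseteq V(G)$ with $|S| \ge k$. At least one of the following holds: (i) $G$ contains $k$ pairwise vertex-disjoint odd $S$-cycles; (ii) there is a set $X \subseteq V(G)$ with $|X| \le \min_{S' \subseteq S,\ |S'| = k} \bigl(2k-2+\tau(G[S'])\bigr)$ such that $G - X$ is bipartite. In particular, since $\tau(G[S']) \le k-1$ for $|S'|=k$, in case (ii) $|X| \le 3k-3$.
   Context: All graphs are finite and simple. An $S$-cycle is a cycle containing at least one vertex of $S$. For a graph $H$, $\tau(H)$ denotes the vertex cover number of $H$, i.e. the minimum size of a set of vertices meeting every edge of $H$. $G[S']$ is the subgraph of $G$ induced by $S'$. *)

(* Defs.v *)
From mathcomp Require Import all_boot.
Set Implicit Arguments. Unset Strict Implicit. Unset Printing Implicit Defensive.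

Definition simple_graph (T : finType) (e : rel T) : Prop :=
  symmetric e /\ irreflexive e.

Definition del_rel (T : finType) (e : rel T) (X : {set T}) : rel T :=
  [rel x y | [&& e x y, x \notin X & y \notin X]].

Definition connected_minus (T : finType) (e : rel T) (X : {set T}) : Prop :=
  forall u v, u \notin X -> v \notin X -> connect (del_rel e X) u v.

Definition k_connected (T : finType) (e : rel T) (m : nat) : Prop :=
  m < #|T| /\ forall X : {set T}, #|X| < m -> connected_minus e X.

Definition is_cycle (T : finType) (e : rel T) (c : seq T) : bool :=
  [&& uniq c, 3 <= size c & cycle e c].

Definition odd_S_cycle (T : finType) (e : rel T) (S : {set T}) (c : seq T) : bool :=
  [&& is_cycle e c, odd (size c) & has (mem S) c].

Definition bipartite_minus (T : finType) (e : rel T) (X : {set T}) : Prop :=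
  exists col : T -> bool,
    forall x y, x \notin X -> y \notin X -> e x y -> col x != col y.

Definition vcover (T : finType) (e : rel T) (A C : {set T}) : bool :=
  (C \subset A) &&
  [forall x in A, forall y in A, e x y ==> (x \in C) || (y \in C)].

(* tau(G[A]): minimum size of a vertex cover of G[A] (A itself is one). *)
Definition tau_ind (T : finType) (e : rel T) (A : {set T}) : nat :=
  #|[arg min_(C < A | vcover e A C) #|C|]|.

(* Main.v *)
(** Let S' be a k-subset of S minimising tau(G[S']).  A dense bipartite subgraph of G - S' contains
    a set K of more than 8k vertices in which any 2k disjoint pairs can be joined by disjoint
    paths respecting a 2-colouring of K (a bipartite form of the Bollobas-Thomason and
    Thomas-Wollan linkage theorem).  A matching argument in a graph obtained by doubling the
    vertices outside K (Tutte-Berge) yields either 3k disjoint K-paths that violate the parity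
    of the colouring, or at most 6k - 2 vertices whose deletion from G - S' leaves a bipartite
    graph.

    In the first case each vertex of S' is connected to K by two disjoint paths, chosen so that k
    of the parity-breaking paths stay untouched, and the pieces are closed up inside K to k
    disjoint odd S-cycles.  In the second case G - Z is bipartite for some Z containing S' with
    at most 7k - 2 vertices; colour Z so that every vertex has many neighbours of the other
    colour.  The monochromatic edges that do not lie inside S' either have a vertex cover of size
    2k - 2, which together with a minimum vertex cover of G[S'] is the required X, or contain a
    matching of size k, which again serves to break the parity of k disjoint S-cycles. *)

Require Import Defs.
From mathcomp Require Import all_boot zify.
From mathcomp.classical Require Import boolp.
Set Implicit Arguments. Unset Strict Implicit. Unset Printing Implicit Defensive.

(** Every cycle is built from at most two pieces outside [K], a path through [S] and a breaking
    path, and all [4k] ends are linked at once inside [K]. Links in [K] respect the 2-colouring, so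
    the parity of a cycle depends only on its outer pieces, and exactly one breaking piece makes it
    odd. Of [3k] breaking paths, each of the [2k] paths connecting [S'] to [K] spoils at most one
    after a suitable rerouting, which leaves [k].

    Linking [2k] pairs means [t = 2k] and [lam = 6t = 12k], which takes average degree a little
    above [24k]. Removing [S'] leaves degrees of at least [49k], and a maximum cut keeps half of
    them: this is where [50] comes from.

    The linkage theorem cannot be proved by induction on connectivity, which is lost on one side of
    a separation and under contraction. Density outside [X], with a condition on separations of
    order below [#|X|], either survives these operations or exposes a well-linked part of the
    graph. *)

Lemma exists_min (A : Type) (P : A -> Prop) (f : A -> nat) :
  (exists a, P a) -> exists a, P a /\ forall b, P b -> f a <= f b.
Proof.
move=> [a0 Pa0]; have [n] := ubnP (f a0).
elim: n a0 Pa0 => // n IHn a Pa le_n.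
have [min_a | /existsNP [b /not_implyP [Pb /negP]]] := pselect (forall b, P b -> f a <= f b).
  by exists a.
by rewrite -ltnNge => lt_b; apply: (IHn b) => //; lia.
Qed.

Lemma exists_max (A : Type) (P : A -> Prop) (f : A -> nat) (n : nat) :
  (exists a, P a) -> (forall a, P a -> f a <= n) ->
  exists a, P a /\ forall b, P b -> f b <= f a.
Proof.
move=> exP le_n; have [a [Pa min_a]] := exists_min (fun a => n - f a) exP.
by exists a; split=> // b Pb; have := min_a b Pb; have := le_n a Pa; have := le_n b Pb; lia.
Qed.

(** * Connected sets and Menger's theorem *)

Section Joined.
Variable T : finType.
Implicit Types (e : rel T) (A B C D V X Y Q : {set T}).

Definition induced e D : rel T := [rel x y | [&& e x y, x \in D & y \in D]].

(* Paths are mostly handled through the sets containing them: only their disjointness matters. *)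
Definition joined e D x y := [&& x \in D, y \in D & connect (induced e D) x y].

Lemma joined_refl e D x : x \in D -> joined e D x x.
Proof. by move=> xD; rewrite /joined xD connect0. Qed.

Lemma joined_trans e D x y z : joined e D x y -> joined e D y z -> joined e D x z.
Proof.
move=> /and3P [xD _ cxy] /and3P [_ zD cyz]; rewrite /joined xD zD.
exact: connect_trans cxy cyz.
Qed.

Lemma joined_sym e D x y : symmetric e -> joined e D x y -> joined e D y x.
Proof.
move=> sym_e /and3P [xD yD cxy]; rewrite /joined xD yD /=.
rewrite (sym_connect_sym _) // => u v; rewrite /induced /= sym_e.
by case: (u \in D); case: (v \in D); rewrite ?andbF ?andbT.
Qed.

Lemma joined_edge e D x y : x \in D -> y \in D -> e x y -> joined e D x y.
Proof. by move=> xD yD exy; rewrite /joined xD yD connect1 //= /induced /= exy xD. Qed.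

Lemma joined_homo e e' D D' x y :
  (forall u v, u \in D -> v \in D -> e u v -> joined e' D' u v) -> D \subset D' ->
  joined e D x y -> joined e' D' x y.
Proof.
move=> homo /subsetP sDD /and3P [xD _ /connectP [p pth ->]].
elim: p x xD pth => [|z p IHp] x xD /=; first by move=> _; apply/joined_refl/sDD.
case/andP=> /and3P [exz _ zD] pth.
exact: joined_trans (homo _ _ xD zD exz) (IHp _ zD pth).
Qed.

Lemma joinedS e D D' x y : D \subset D' -> joined e D x y -> joined e D' x y.
Proof.
move=> sDD; apply: joined_homo => // u v uD vD; apply: joined_edge.
  exact: (subsetP sDD).
exact: (subsetP sDD).
Qed.

Lemma path_joined e D x p :
  path e x p -> {subset x :: p <= D} -> joined e D x (last x p).
Proof.
elim: p x => [|z p IHp] x /=; first by move=> _ sD; apply/joined_refl/sD/mem_head.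
case/andP=> exz pth sD.
have zpD : {subset z :: p <= D} by move=> u up; apply: sD; rewrite inE up orbT.
apply: joined_trans (IHp _ pth zpD).
by apply: joined_edge => //; [apply: sD; exact: mem_head | apply/zpD/mem_head].
Qed.

Lemma joined_path e D x y : joined e D x y ->
  exists p, [/\ path e x p, last x p = y, uniq (x :: p) & {subset x :: p <= D}].
Proof.
case/and3P=> xD _ /connectP [p0 pth0 ->]; case: (shortenP pth0) => p pth uq _ {p0 pth0}.
exists p; split=> //; first by apply: sub_path pth => u v /and3P [].
elim: p x xD pth {uq} => [|z q IHq] u uD /=; first by move=> _ v; rewrite inE => /eqP ->.
case/andP=> /and3P [_ _ zD] pq v; rewrite inE => /predU1P [-> // |].
exact: IHq.
Qed.

Lemma joined_closed e D (R : {set T}) x y :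
  (forall u v, u \in R -> v \in D -> e u v -> v \in R) -> x \in R ->
  joined e D x y -> joined e R x y.
Proof.
move=> cl xR /and3P [_ _ /connectP [p pth ->]].
elim: p x xR pth => [|z p IHp] x xR /=; first by move=> _; apply: joined_refl.
case/andP=> /and3P [exz _ zD] pth; have zR := cl _ _ xR zD exz.
exact: joined_trans (joined_edge xR zR exz) (IHp _ zR pth).
Qed.

(** Truncation at the first visit to [Q]; [linked_extend] needs connectors that touch the target set
    only once. *)
Lemma joined_first e D Q y z : joined e D y z -> z \in Q ->
  exists D' w, [/\ D' \subset D, joined e D' y w, w \in Q & D' :&: Q = [set w]].
Proof.
move=> /joined_path [p [pth lst _ sD]] zQ.
have hasQ : has (mem Q) (y :: p) by apply/hasP; exists z; rewrite // -lst mem_last.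
have [q [pq sq lq avq]] : exists q, [/\ path e y q, {subset y :: q <= D},
   last y q \in Q & {in y :: q, forall v, v \in Q -> v = last y q}].
  elim: p y pth sD {lst} hasQ => [|u p IHp] y pth sD /=.
    rewrite orbF => yQ; exists [::]; split=> // v; by rewrite inE => /eqP ->.
  case: (boolP (y \in Q)) => [yQ _ | nyQ /=].
    exists [::]; split=> // v; first by rewrite inE => /eqP ->; apply: sD; exact: mem_head.
    by rewrite inE => /eqP ->.
  move: pth => /= /andP [eyu pth] hsQ.
  have [|q [pq sq lq avq]] := IHp u pth _ hsQ.
    by move=> v vp; apply: sD; rewrite inE vp orbT.
  exists (u :: q); split=> //=; first by rewrite eyu.
    by move=> v; rewrite inE => /predU1P [-> | /sq //]; apply: sD; exact: mem_head.
  by move=> v; rewrite inE => /predU1P [-> | /avq //]; rewrite (negbTE nyQ).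
exists [set v in y :: q], (last y q); split=> //.
- by apply/subsetP => v; rewrite inE => /sq.
- by apply: path_joined => // v vq; rewrite inE.
- apply/setP => v; rewrite !inE; apply/andP/eqP => [[vq vQ] | ->]; first by apply: avq; rewrite ?inE.
  by rewrite lq -in_cons mem_last.
Qed.

Definition separation V e A B :=
  A :|: B = V /\ forall x y, x \in A :\: B -> y \in B :\: A -> ~~ e x y.

(** Ordered pairs, each edge counted twice; only a measure for the induction in [menger]. *)
Definition edges V e := [set z : T * T | [&& e z.1 z.2, z.1 \in V & z.2 \in V]].

Definition disjoint_joined V e Y Q (n : nat) :=
  exists (a b : 'I_n -> T) (D : 'I_n -> {set T}),
    (forall i, [/\ a i \in Y, b i \in Q, D i \subset V & joined e (D i) (a i) (b i)]) /\
    (forall i j, i != j -> [disjoint D i & D j]).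

Lemma inj_ord_onto n (b : 'I_n -> T) Y :
  injective b -> (forall i, b i \in Y) -> #|Y| = n -> forall y, y \in Y -> exists i, b i = y.
Proof.
move=> inj_b bY cardY y yY.
have /subset_leqif_cards [_ eqY] : b @: 'I_n \subset Y.
  by apply/subsetP => _ /imsetP [i _ ->].
have : b @: 'I_n == Y by rewrite -eqY card_imset // card_ord cardY.
by move/eqP=> defY; move: yY; rewrite -defY => /imsetP [i _ ->]; exists i.
Qed.

Lemma disjoint_joined_inj V e Y Q n (a b : 'I_n -> T) (D : 'I_n -> {set T}) :
  (forall i, [/\ a i \in Y, b i \in Q, D i \subset V & joined e (D i) (a i) (b i)]) ->
  (forall i j, i != j -> [disjoint D i & D j]) -> injective a /\ injective b.
Proof.
move=> DP dis; split=> i j eq_ij; apply/eqP/negPn/negP => /dis /disjoint_setI0 /setP.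
  move/(_ (a i)); rewrite !inE {2}eq_ij.
  by have [_ _ _ /and3P [-> _ _]] := DP i; have [_ _ _ /and3P [-> _ _]] := DP j.
move/(_ (b i)); rewrite !inE {2}eq_ij.
by have [_ _ _ /and3P [_ -> _]] := DP i; have [_ _ _ /and3P [_ -> _]] := DP j.
Qed.

(* [A] and [B] come from a separation of the graph without the edge [x y]; the linkages on the two
   sides are glued along [A :&: B] and along that edge. *)
Lemma menger_split e V Y Q n A B x y :
  A :|: B = V -> x \in A :\: B -> y \in B :\: A -> e x y -> #|A :&: B| < n ->
  disjoint_joined A e Y (x |: A :&: B) n -> disjoint_joined B e (y |: A :&: B) Q n ->
  disjoint_joined V e Y Q n.
Proof.
move=> defV; rewrite !inE => /andP [nxB xA] /andP [nyA yB] exy ltn.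
move=> [a1 [b1 [D1 [DP1 dis1]]]] [a2 [b2 [D2 [DP2 dis2]]]].
have [_ inj1] := disjoint_joined_inj DP1 dis1; have [inj2 _] := disjoint_joined_inj DP2 dis2.
(* [#|A :&: B| < n] while [n] distinct ends must fit in, so [x |: A :&: B] and [y |: A :&: B] have
   exactly [n] elements and each element is an end. *)
have cardU (z : T) : z \notin A :&: B -> n <= #|z |: A :&: B| -> #|z |: A :&: B| = n.
  by move=> nz; rewrite cardsU1 nz /=; lia.
have card_n (z : T) (b : 'I_n -> T) (Z : {set T}) : injective b -> (forall i, b i \in Z) -> n <= #|Z|.
  move=> inj_b bZ; rewrite -[n in n <= _]card_ord -(card_imset _ inj_b).
  by apply/subset_leq_card/subsetP => _ /imsetP [i _ ->].
have b1P i : b1 i \in x |: A :&: B by have [] := DP1 i.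
have a2P i : a2 i \in y |: A :&: B by have [] := DP2 i.
have nxI : x \notin A :&: B by rewrite inE negb_and nxB orbT.
have nyI : y \notin A :&: B by rewrite inE negb_and nyA.
have onto1 := inj_ord_onto inj1 b1P (cardU x nxI (card_n x _ _ inj1 b1P)).
have onto2 := inj_ord_onto inj2 a2P (cardU y nyI (card_n y _ _ inj2 a2P)).
have /choice [j jP] i : exists j, a2 j = if b1 i == x then y else b1 i.
  apply: onto2; case: eqP => [_ | nx]; first by rewrite !inE eqxx.
  by have := b1P i; rewrite !inE => /orP [/eqP // | ->]; rewrite orbT.
have inj_j i i' : j i = j i' -> i = i'.
  move=> eq_j; apply: inj1; have := jP i; rewrite eq_j jP.
  have := b1P i; have := b1P i'; rewrite !inE.
  case: (eqVneq (b1 i') x) => [-> _ | _ /= /andP [bA' _]];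
    case: (eqVneq (b1 i) x) => [-> _ | _ /= /andP [bA _]] // eqb.
    by rewrite eqb bA in nyA.
  by rewrite -eqb bA' in nyA.
exists a1, (b2 \o j), (fun i => D1 i :|: D2 (j i)); split=> [i | i i' ii'].
  have [aY bS sD1 jD1] := DP1 i; have [aS bQ sD2 jD2] := DP2 (j i); split=> //.
    by rewrite -defV setUSS.
  apply: joined_trans (joinedS (subsetUl _ _) jD1) _.
  apply: joined_trans (joinedS (subsetUr _ _) jD2).
  have /and3P [_ bD1 _] := jD1; have /and3P [aD2 _ _] := jD2.
  rewrite jP in aD2 *; case: eqP aD2 => [bx aD2 | _ aD2].
    by rewrite bx; apply: joined_edge => //; rewrite !inE -?bx ?bD1 ?aD2 ?orbT.
  by apply: joined_refl; rewrite inE bD1.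
(* A common vertex would lie in [A :&: B], hence be an end of the same route [i3] on both sides;
   disjointness on each side then identifies all the indices. *)
have cross i1 i2 : i1 != i2 -> [disjoint D1 i1 & D2 (j i2)].
  move=> i12; rewrite disjoint_subset; apply/subsetP => v vD1; rewrite inE; apply/negP => vD2.
  have [_ _ /subsetP /(_ _ vD1) vA _] := DP1 i1; have [_ _ /subsetP /(_ _ vD2) vB _] := DP2 (j i2).
  have vx : v != x by apply: contraNneq nxB => <-.
  have vy : v != y by apply: contraNneq nyA => <-.
  have [i3 def_v] : exists i, b1 i = v by apply: onto1; rewrite !inE vA vB orbT.
  have D1v : v \in D1 i3 by have [_ _ _ /and3P [_]] := DP1 i3; rewrite def_v.
  have D2v : v \in D2 (j i3).
    by have [_ _ _ /and3P []] := DP2 (j i3); rewrite jP def_v (negbTE vx).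
  have e13 : i1 = i3.
    apply/eqP/negPn/negP => /dis1 /disjoint_setI0 /setP /(_ v).
    by rewrite !inE vD1 D1v.
  have e23 : j i2 = j i3.
    apply/eqP/negPn/negP => /dis2 /disjoint_setI0 /setP /(_ v).
    by rewrite !inE vD2 D2v.
  by rewrite e13 (inj_j _ _ e23) eqxx in i12.
rewrite -setI_eq0 setIUl !setIUr !setU_eq0 !setI_eq0 dis1 // cross //=.
rewrite [X in X && _]disjoint_sym cross 1?eq_sym //=.
by rewrite dis2 //; apply: contraNneq ii' => /inj_j ->.
Qed.

(** Induction on the edges. If deleting an edge creates a separation of order below [n], that edge
    crosses it. Adding one end of the edge to the separator gives a smaller instance on either side
    in which the condition still holds, and [menger_split] glues the two linkages. *)
Theorem menger e V Y Q n : symmetric e -> Y \subset V -> Q \subset V ->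
  (forall A B, separation V e A B -> Y \subset A -> Q \subset B -> n <= #|A :&: B|) ->
  disjoint_joined V e Y Q n.
Proof.
move=> sym_e; have [m] := ubnP #|edges V e|.
elim: m e sym_e V Y Q => // m IHm e sym_e V Y Q le_m sYV sQV sepn.
have [[x y] /= xyP | noedge] := pickP [pred z : T * T |
    [&& e z.1 z.2, z.1 \in V, z.2 \in V & z.1 != z.2]]; last first.
  (* Without edges between distinct vertices, the separation [(Y, V :\: (Y :\: Q))] has order
     [#|Y :&: Q|], and trivial paths suffice. *)
  have le_n : n <= #|Y :&: Q|.
    have <- : Y :&: (V :\: (Y :\: Q)) = Y :&: Q.
      apply/setP => v; rewrite !inE; case: (boolP (v \in Y)) => //= vY.
      by rewrite andbT negbK (subsetP sYV) // andbT.
    apply: sepn => //; last first.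
      by apply/subsetP => v vQ; rewrite !inE vQ (subsetP sQV).
    split.
      apply/setP => v; rewrite !inE; case: (boolP (v \in Y)) => /= vY; last by rewrite andbF.
      by rewrite (subsetP sYV).
    move=> u v; rewrite !inE => /andP [nu uY] /andP [nvY /andP [_ vV]].
    have := noedge (u, v); rewrite /= vV (subsetP sYV) //=.
    by case: eqP => [uv | _]; [rewrite -uv uY in nvY | rewrite andbT => ->].
  exists (fun i => enum_val (widen_ord le_n i)), (fun i => enum_val (widen_ord le_n i)).
  exists (fun i => [set enum_val (widen_ord le_n i)]); split=> [i | i j ij].
    have := enum_valP (widen_ord le_n i); rewrite inE => /andP [iY iQ]; split=> //.
      by rewrite sub1set (subsetP sYV).
    by apply/joined_refl/set11.
  rewrite disjoints1 inE; apply: contraNN ij => /eqP /enum_val_inj /(congr1 val) /= ij.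
  exact/eqP/val_inj.
case/and4P: xyP => exy xV yV neq_xy.
pose e' := [rel u v | e u v && ~~ (((u == x) && (v == y)) || ((u == y) && (v == x)))].
have sym_e' : symmetric e'.
  by move=> u v; rewrite /= sym_e; congr (_ && ~~ _); rewrite orbC ![(v == _) && _]andbC.
have sub_e D u v : joined e' D u v -> joined e D u v.
  by apply: joined_homo => // u' v' u'D v'D /andP [? _]; apply: joined_edge.
have [big | /existsNP [A /existsNP [B /not_implyP [sepAB /not_implyP [sYA /not_implyP [sQB /negP ltn]]]]]]
  := pselect (forall A B, separation V e' A B -> Y \subset A -> Q \subset B -> n <= #|A :&: B|).
  have [|a [b [D [DP dis]]]] := IHm e' sym_e' V Y Q _ sYV sQV big; last first.
    by exists a, b, D; split=> // i; have [? ? ? /sub_e] := DP i.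
  rewrite -ltnS; apply: leq_trans le_m; rewrite ltnS; apply: proper_card.
  apply/properP; split; first by apply/subsetP => -[u v]; rewrite !inE /= => /and3P [/andP [-> _] -> ->].
  by exists (x, y); rewrite !inE /= ?exy ?xV // !eqxx.
rewrite -ltnNge in ltn; case: sepAB => defV sepAB.
have [u [v [uAB [vBA euv]]]] : exists u v, u \in A :\: B /\ v \in B :\: A /\ e u v.
  apply: contrapT => none; move: ltn; rewrite ltnNge => /negP; apply; apply: sepn => //.
  split=> // u v uAB vBA; apply/negP => euv; apply: none; by exists u, v.
have uniq_uv u' v' : u' \in A :\: B -> v' \in B :\: A -> e u' v' -> u' = u /\ v' = v.
  move=> uAB' vBA' euv'; have := sepAB _ _ uAB vBA; have := sepAB _ _ uAB' vBA'.
  rewrite /= euv euv' /= !negbK.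
  have neq : u <> v' by move=> uv; move: uAB vBA'; rewrite uv !inE => /andP [_ ->].
  by case/orP=> /andP [/eqP ? /eqP ?]; case/orP => /andP [/eqP ? /eqP ?]; split; congruence.
have [nuB uA] : u \notin B /\ u \in A by apply/andP; move: uAB; rewrite !inE.
have [nvA vB] : v \notin A /\ v \in B by apply/andP; move: vBA; rewrite !inE.
have sAV : A \subset V by rewrite -defV subsetUl.
have sBV : B \subset V by rewrite -defV subsetUr.
have small (C : {set T}) : C \subset V -> (u \notin C) || (v \notin C) -> #|edges C e| < m.
  move=> sCV nC; rewrite -ltnS; apply: leq_trans le_m; rewrite ltnS; apply: proper_card.
  apply/properP; split.
    by apply/subsetP => -[c d]; rewrite !inE /= => /and3P [-> /(subsetP sCV) -> /(subsetP sCV) ->].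
  exists (u, v); rewrite !inE /= euv /= ?(subsetP sAV u) ?(subsetP sBV v) //.
  by rewrite negb_and.
apply: (menger_split defV uAB vBA euv ltn).
  apply: IHm => //; first by apply: small; rewrite // nvA orbT.
    by apply/subsetP => w; rewrite !inE => /predU1P [-> // | /andP []].
  move=> A1 B1 [defA sep1] sYA1 sSB1.
  (* Adding [B] turns a separation of the [A] side into one of [V] of the same order, since [B1]
     contains the separator and [u], the only vertex with an edge across. *)
  have defI : A1 :&: (B1 :|: B) = A1 :&: B1.
    apply/setP => w; rewrite !inE; case: (boolP (w \in A1)) => //= wA1.
    case: (boolP (w \in B)) => [wB | _]; last by rewrite orbF.
    rewrite orbT; apply/esym/(subsetP sSB1); rewrite !inE wB andbT -defA inE wA1; by rewrite orbT.
  rewrite -defI; apply: sepn => //; last exact: subset_trans sQB (subsetUr _ _).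
  split=> [|w z]; first by rewrite setUA defA.
  rewrite !inE negb_or => /andP [/andP [nwB1 nwB] wA1] /andP [nzA1 zB].
  have wA : w \in A by rewrite -defA inE wA1.
  case: (boolP (z \in A)) => [zA | nzA].
    apply: sep1; rewrite !inE ?nwB1 //; rewrite nzA1.
    by move: zA; rewrite -defA inE (negbTE nzA1).
  apply/negP => ewz; have zB' : z \in B.
    by case/orP: zB => // zB1; rewrite -defA inE zB1 orbT in nzA.
  have wAB : w \in A :\: B by rewrite inE nwB.
  have zBA : z \in B :\: A by rewrite inE nzA.
  have [eqw _] := uniq_uv w z wAB zBA ewz.
  by move/negP: nwB1; apply; apply: (subsetP sSB1); rewrite eqw // !inE eqxx.
apply: IHm => //; first by apply: small; rewrite // nuB.
  by apply/subsetP => w; rewrite !inE => /predU1P [-> // | /andP []].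
move=> A1 B1 [defB sep1] sSA1 sQB1.
have defI : (A :|: A1) :&: B1 = A1 :&: B1.
  apply/setP => w; rewrite !inE; case: (boolP (w \in B1)) => [wB1 |]; rewrite ?andbF ?andbT //.
  case: (boolP (w \in A)) => [wA | _] //=.
  apply/esym/(subsetP sSA1); rewrite !inE wA -defB inE wB1; by rewrite !orbT.
rewrite -defI; apply: sepn => //; last exact: subset_trans sYA (subsetUl _ _).
split=> [|w z]; first by rewrite -setUA defB.
rewrite !inE negb_or => /andP [nwB1 wA] /andP [/andP [nzA nzA1] zB1].
have zB : z \in B by rewrite -defB inE zB1 orbT.
case: (boolP (w \in B)) => [wB | nwB].
  apply: sep1; rewrite !inE ?nzA1 //; rewrite nwB1.
  by move: wB; rewrite -defB inE (negbTE nwB1) orbF.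
apply/negP => ewz; have wA' : w \in A.
  by case/orP: wA => // wA1; rewrite -defB inE wA1 in nwB.
have wAB : w \in A :\: B by rewrite inE nwB.
have zBA : z \in B :\: A by rewrite inE nzA.
have [_ eqz] := uniq_uv w z wAB zBA ewz.
by move/negP: nzA1; apply; apply: (subsetP sSA1); rewrite eqz // !inE eqxx.
Qed.
End Joined.

(** * Unlinkable pairs force a dense set *)

Lemma first_split (T : Type) (P : pred T) (q : seq T) : has P q ->
  exists q1 c q2, [/\ q = q1 ++ c :: q2, P c & ~~ has P q1].
Proof.
elim: q => //= x q IHq; case: (boolP (P x)) => [Px _ | nPx /= /IHq].
  by exists [::], x, q.
by move=> [q1 [c [q2 [-> Pc nq1]]]]; exists (x :: q1), c, q2; rewrite /= negb_or nPx.
Qed.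

Lemma last_split (T : Type) (P : pred T) (q : seq T) : has P q ->
  exists q1 c q2, [/\ q = q1 ++ c :: q2, P c & ~~ has P q2].
Proof.
rewrite -has_rev => /first_split [q1 [c [q2 [defq Pc nq1]]]].
exists (rev q2), c, (rev q1); split; rewrite ?has_rev //.
by rewrite -[LHS]revK defq rev_cat rev_cons cat_rcons.
Qed.

Lemma card_bigcup_leq (T I : finType) (Z : I -> {set T}) :
  #|\bigcup_i Z i| <= \sum_i #|Z i|.
Proof.
elim/big_rec2: _ => [|i n A _ le_n]; first by rewrite cards0.
by apply: leq_trans (leq_card_setU _ _) _; rewrite leq_add2l.
Qed.

Lemma uniq_move (T : eqType) (q1 mid q3 : seq T) c :
  uniq (q1 ++ c :: mid ++ q3) = uniq (mid ++ q1 ++ c :: q3).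
Proof. by rewrite -!cat_rcons uniq_catCA. Qed.

Definition nbrs (T : finType) (e : rel T) (V : {set T}) u := [set v in V | e u v].

(** The last clause keeps every link off the other vertices of [X], also those that belong to no
    pair; this is what allows gluing along separators. *)
Definition linkage (T I : finType) (e : rel T) (V X : {set T}) (a b : I -> T) :=
  exists D : I -> {set T},
    (forall i, [/\ D i \subset V, joined e (D i) (a i) (b i) &
       forall x, x \in X -> x \in D i -> x = a i \/ x = b i]) /\
    (forall i j, i != j -> [disjoint D i & D j]).

(* If some pairs cannot be linked although all degrees are large, then a partial linkage that
   joins as many pairs as possible by paths that are as short as possible leaves a set of free
   vertices of large inner degree. *)
Section Unlinkable.
Variables (T I : finType) (e : rel T) (V X : {set T}) (a b : I -> T) (d : nat).
Hypotheses (sym_e : symmetric e) (irr_e : irreflexive e) (sXV : X \subset V).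
Hypotheses (aX : forall i, a i \in X) (bX : forall i, b i \in X).
Hypotheses (inj_a : injective a) (inj_b : injective b) (ab : forall i j, a i != b j).
Hypothesis degV : forall u, u \in V :\: X -> d <= #|nbrs e V u|.
Hypothesis degX : forall x, x \in X -> d < #|nbrs e V x :\: X| + #|X|.
Hypothesis big_d : 3 * #|X| + 4 <= 2 * d.
Hypothesis unlinkable : ~ linkage e V X a b.

Implicit Types (p : I -> seq T) (u v w : T).

(* The defaults of [head] and [last] are crossed so that [[::]] is not a link path: in a partial
   linkage [p i = [::]] means that the pair [i] is not linked. *)
Definition link_path i q :=
  [/\ sorted e q, uniq q, head (b i) q = a i, last (a i) q = b i &
      forall v, v \in q -> v \in V /\ (v \in X -> v = a i \/ v = b i)].

Definition free p := [set v in V :\: X | [forall i, v \notin p i]].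

(** A free vertex must be left over: the dense set is sought among the free vertices, so a rerouting
    that uses up the last one is no improvement. *)
Definition partial_linkage p :=
  [/\ forall i, p i != [::] -> link_path i (p i),
      forall i j, i != j -> [disjoint p i & p j] & free p != set0].

Definition linked_pairs p := #|[set i | p i != [::]]|.
Definition total_size p := \sum_i size (p i).
Definition update p i q := fun j => if j == i then q else p j.

Lemma link_path_ends i q : link_path i q -> a i \in q /\ b i \in q.
Proof.
case=> _ _ hd lst _; case: q hd lst => [/= hd | x q /= -> <-].
  by have := ab i i; rewrite hd eqxx.
by rewrite mem_head mem_last.
Qed.

Lemma update_eq p i q : update p i q i = q. Proof. by rewrite /update eqxx. Qed.

Lemma free_update p i q v :
  (v \in free (update p i q)) =
  [&& v \in V :\: X, v \notin q & [forall j, (j != i) ==> (v \notin p j)]].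
Proof.
rewrite inE; congr (_ && _); apply/forallP/andP => [H | [vq /forallP H] j].
  split; first by have := H i; rewrite update_eq.
  by apply/forallP => j; apply/implyP => ji; have := H j; rewrite /update (negbTE ji).
by rewrite /update; case: (eqVneq j i) => // ji; have := H j; rewrite ji.
Qed.

Lemma partial_linkage_update p i q : partial_linkage p -> link_path i q ->
  (forall v, v \in q -> [\/ v \in p i, v \in free p | v = a i \/ v = b i]) ->
  free (update p i q) != set0 -> partial_linkage (update p i q).
Proof.
move=> [pathp disp _] pathq newq fr; split=> // [j | ].
  by rewrite /update; case: (eqVneq j i) => [-> // | _ pj]; apply: pathp.
have dis j : j != i -> [disjoint q & p j].
  move=> ji; rewrite disjoint_has; apply/hasPn => v /newq vP; apply/negP => vj.
  have pj : p j != [::] by apply: contraTneq vj => ->.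
  have [_ _ _ _ /(_ v vj) [_ vX]] := pathp j pj.
  case: vP => [vi | | ].
  - by have /pred0P /(_ v) /= := disp _ _ ji; rewrite vi vj.
  - by rewrite inE => /andP [_ /forallP /(_ j)]; rewrite vj.
  - case=> eqv; rewrite eqv in vX; case: vX => // /eqP.
    + by rewrite (inj_eq inj_a) eq_sym (negbTE ji).
    + by rewrite (negbTE (ab _ _)).
    + by rewrite eq_sym (negbTE (ab _ _)).
    + by rewrite (inj_eq inj_b) eq_sym (negbTE ji).
move=> j l jl; rewrite /update; case: (eqVneq j i) => ji; case: (eqVneq l i) => li.
- by rewrite ji li eqxx in jl.
- exact: dis.
- by rewrite disjoint_sym; apply: dis.
- exact: disp.
Qed.

Lemma total_size_update p i q : total_size (update p i q) + size (p i) = total_size p + size q.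
Proof.
rewrite /total_size (bigD1 i) //= [in RHS](bigD1 i) //= update_eq.
have -> : \sum_(j | j != i) size (update p i q j) = \sum_(j | j != i) size (p j).
  by apply: eq_bigr => j ji; rewrite /update (negbTE ji).
lia.
Qed.

Lemma linked_pairs_update p i q : q != [::] ->
  linked_pairs (update p i q) = linked_pairs p + (p i == [::]).
Proof.
move=> q0; rewrite /linked_pairs (cardsD1 i) [in RHS](cardsD1 i) !inE update_eq q0.
have -> : [set j | update p i q j != [::]] :\ i = [set j | p j != [::]] :\ i.
  by apply/setP => j; rewrite !inE /update; case: (eqVneq j i).
by case: (p i == [::]); rewrite /= ?addn0 ?add0n // addnC.
Qed.

Lemma linked_pairs_leq p : linked_pairs p <= #|I|.
Proof. exact: max_card. Qed.

Definition optimal p :=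
  partial_linkage p /\ forall q, partial_linkage q ->
    linked_pairs q <= linked_pairs p /\
    (linked_pairs q = linked_pairs p -> total_size p <= total_size q).

Lemma optimal_exists : exists p, optimal p.
Proof.
have ex0 : exists p, partial_linkage p.
  exists (fun _ => [::]); split=> [i | i j _ |]; first by rewrite eqxx.
    by rewrite disjoint_has.
  have [i0 | noI] := pickP (@predT I); last first.
    by case: unlinkable; exists (fun _ => set0); split=> i; have := noI i.
  have lt_d := degX (aX i0).
  have /card_gt0P [v] : 0 < #|nbrs e V (a i0) :\: X| by lia.
  rewrite !inE => /andP [nvX /andP [vV _]] _; apply/set0Pn; exists v.
  by rewrite !inE nvX vV; apply/forallP.
have [p [Pp maxp]] := exists_max ex0 (fun p _ => linked_pairs_leq p).
have [q [[Pq eq_q] minq]] : exists q, (partial_linkage q /\ linked_pairs q = linked_pairs p) /\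
    forall r, partial_linkage r /\ linked_pairs r = linked_pairs p -> total_size q <= total_size r.
  by apply: exists_min; exists p.
exists q; split=> // r Pr; rewrite eq_q; split; first exact: maxp.
by move=> eq_r; apply: minq.
Qed.

Lemma unlinked_pair p : partial_linkage p -> exists i, p i = [::].
Proof.
move=> [pathp disp _]; apply: contrapT => all_linked; apply: unlinkable.
have pathi i : link_path i (p i) by apply: pathp; apply/eqP => pi; apply: all_linked; exists i.
exists (fun i => [set v in p i]); split=> [i | i j ij]; last first.
  rewrite disjoint_subset; apply/subsetP => v; rewrite !inE => vi.
  by have /pred0P /(_ v) /= := disp _ _ ij; rewrite vi /= => ->.
have [sor _ hd lst inq] := pathi i; split=> [| | x xX].
- by apply/subsetP => v; rewrite inE => /inq [].
- have [ai _] := link_path_ends (pathi i).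
  case: (p i) hd lst sor {inq ai} (ai) => // x q /= -> <- sor _.
  by apply: path_joined => // v vq; rewrite inE.
- by rewrite inE => /inq [_]; apply.
Qed.

(** The bypassed vertices become free, so a nonempty [mid] keeps the free set nonempty even if [u]
    was its only element. *)
Lemma partial_linkage_bypass p i q1 c mid c' q2 u :
  partial_linkage p -> p i = q1 ++ c :: mid ++ c' :: q2 -> u \in free p -> e u c -> e u c' ->
  mid != [::] ->
  partial_linkage (update p i (q1 ++ c :: u :: c' :: q2)) /\
  (forall v, v \in mid -> v \in free (update p i (q1 ++ c :: u :: c' :: q2))).
Proof.
move=> Pp def_pi uF euc euc' mid0; have [pathp disp _] := Pp.
have pi0 : p i != [::] by rewrite def_pi; case: (q1).
have [sor uq hd lst inq] := pathp i pi0.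
have [uV nuX up] : [/\ u \in V, u \notin X & forall j, u \notin p j].
  by move: uF; rewrite !inE => /andP [/andP [-> ->] /forallP].
have nui := up i; rewrite def_pi in sor uq hd lst inq nui.
move: sor; rewrite sorted_cat_cons cat_path /= => /and3P [sor1 _ /andP [_ sor2]].
have inr v : v \in q1 ++ c :: u :: c' :: q2 -> v = u \/ v \in q1 ++ c :: mid ++ c' :: q2.
  rewrite !(mem_cat, inE) => /or4P [-> | -> | /eqP -> | /orP [-> | ->]]; rewrite ?orbT; by [left | right].
have pathr : link_path i (q1 ++ c :: u :: c' :: q2).
  split.
  - by rewrite sorted_cat_cons sor1 /= sym_e euc euc'.
  - rewrite -[u :: _]cat1s uniq_move /=; apply/andP; split.
      apply: contra nui; rewrite !(mem_cat, inE) => /or3P [-> | -> | /orP [-> | ->]]; by rewrite ?orbT.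
    apply: subseq_uniq uq; apply: cat_subseq => //=; rewrite eqxx.
    by rewrite -[c' :: q2]cat0s cat_subseq ?sub0seq.
  - by move: hd; case: (q1).
  - by move: lst; rewrite !last_cat /= last_cat.
  - by move=> v /inr [-> | /inq //]; split=> // uX; rewrite uX in nuX.
have newr v : v \in q1 ++ c :: u :: c' :: q2 -> [\/ v \in p i, v \in free p | v = a i \/ v = b i].
  by move=> /inr [-> | vi]; [apply: Or32 | apply: Or31; rewrite def_pi].
have freemid v : v \in mid -> v \in free (update p i (q1 ++ c :: u :: c' :: q2)).
  move=> vmid; have vi : v \in q1 ++ c :: mid ++ c' :: q2 by rewrite !(mem_cat, inE) vmid !orbT.
  have [vV vX] := inq v vi.
  have nvr : v \notin q1 ++ c :: c' :: q2.
    by move: uq; rewrite uniq_move cat_uniq => /and3P [_ /hasPn nmid _]; apply/negP => /nmid /negP.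
  have nvu : v != u by apply: contraTneq vmid => ->; apply: contra nui; rewrite !(mem_cat, inE) => ->; rewrite !orbT.
  rewrite free_update; apply/and3P; split.
  - rewrite inE vV andbT; apply/negP => /vX [] eqv; move: nvr.
      have [] := link_path_ends pathr; rewrite -eqv !(mem_cat, inE) (negbTE nvu) /= => -> //.
    by have [_] := link_path_ends pathr; rewrite -eqv !(mem_cat, inE) (negbTE nvu) /= => ->.
  - by move: nvr; rewrite !(mem_cat, inE) (negbTE nvu).
  - apply/forallP => j; apply/implyP => ji; have /pred0P /(_ v) /= := disp _ _ ji.
    by rewrite def_pi vi andbT => ->.
split=> //; apply: partial_linkage_update => //.
by case: mid mid0 freemid {def_pi uq hd lst inq nui sor2 inr} => // v mid _ /(_ v (mem_head _ _)) vF; apply/set0Pn; exists v.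
Qed.

(* [p'] arises from [p] by letting the free vertex [u] replace the vertex [w] of a path. *)
Definition swap p u p' w :=
  [/\ optimal p', w \notin free p,
      forall v, (v \in free p') = (v == w) || (v \in free p) && (v != u) &
      forall i, (p' i == [::]) = (p i == [::])].

Lemma freeE p v : (v \in free p) = (v \in V :\: X) && [forall i, v \notin p i].
Proof. by rewrite /free in_set. Qed.

Lemma mem_free p u : u \in free p -> [/\ u \in V, u \notin X & forall i, u \notin p i].
Proof. by rewrite !inE => /andP [/andP [-> ->] /forallP]. Qed.

Lemma optimal_update p i q : optimal p -> p i != [::] -> q != [::] ->
  partial_linkage (update p i q) -> size (p i) <= size q /\
  (size q = size (p i) -> optimal (update p i q)).
Proof.
move=> [_ optp] pi0 q0 Pu; have := optp _ Pu.
have := total_size_update p i q; have := linked_pairs_update p i q0.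
rewrite (negbTE pi0) addn0 => eq_l tot [_ /(_ eq_l) le_t]; split.
  by rewrite -(leq_add2l (total_size p)) -tot leq_add2r.
move=> eq_s; have eq_t : total_size (update p i q) = total_size p.
  by apply/eqP; rewrite -(eqn_add2r (size (p i))) tot eq_s.
by split=> // r /optp; rewrite eq_l eq_t.
Qed.

(** [c] and [c'] are the first and last neighbours of [u] on the path. By optimality a bypass
    through [u] does not shorten the path, so at most one vertex lies between them; if there is one,
    the bypass keeps the length and is a swap. *)
Lemma path_nbrs p u i : optimal p -> u \in free p -> p i != [::] ->
  exists c c' w, forall v, v \in p i -> e u v ->
    [\/ v = c, v = c' | v = w /\ exists p', swap p u p' w].
Proof.
move=> optp uF pi0; have [Pp _] := optp.
have [/first_split [q1 [c [q' [defq euc nq1]]]] | /hasPn no] := boolP (has (e u) (p i)); last first.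
  by exists u, u, u => v /no /negP.
have nbr1 v : v \in q1 -> e u v -> False by move=> /(hasPn nq1) /negP.
have [/last_split [mid [c' [q2 [defq' euc' nq2]]]] | /hasPn no] := boolP (has (e u) q'); last first.
  exists c, c, c => v; rewrite defq mem_cat inE => /or3P [/nbr1 // | /eqP -> _ | /no /negP //].
  by apply: Or31.
have nbr2 v : v \in q2 -> e u v -> False by move=> /(hasPn nq2) /negP.
rewrite defq' in defq.
have [mid0 | mid0] := eqVneq mid [::].
  exists c, c', c => v; rewrite defq mid0 /= !(mem_cat, inE).
  move=> /or4P [/nbr1 // | /eqP -> _ | /eqP -> _ | /nbr2 //]; by [apply: Or31 | apply: Or32].
have [Pu midF] := partial_linkage_bypass Pp defq uF euc euc' mid0.
have r0 : q1 ++ c :: u :: c' :: q2 != [::] by case: (q1).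
have [le_s opt_s] := optimal_update optp pi0 r0 Pu.
move: le_s opt_s; rewrite defq !size_cat /= size_cat /= => le_s opt_s.
have [w defm] : exists w, mid = [:: w].
  by case: (mid) mid0 le_s => [|w [|w' m]] //= _ le_s; [exists w | exfalso; lia].
exists c, c', w => v; rewrite defm /= !(mem_cat, inE).
move=> /or4P [/nbr1 // | /eqP -> _ | /eqP -> _ | /orP [/eqP -> _ | /nbr2 //]].
- by apply: Or31.
- apply: Or33; split=> //; exists (update p i (q1 ++ c :: u :: c' :: q2)).
  have wF := midF w; rewrite defm mem_head in wF.
  have wi : w \in p i by rewrite defq defm /= !(mem_cat, inE) eqxx !orbT.
  have [_ _ /(_ i) ui] := mem_free uF.
  split.
  + by apply: opt_s; rewrite defm /= add1n.
  + by apply/negP => /mem_free [_ _ /(_ i)]; rewrite wi.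
  + move=> v'; have [-> | v'w] /= := eqVneq v' w; first exact: wF.
    rewrite free_update freeE -andbA; congr (_ && _); apply/andP/andP.
      move=> [nr /forallP nj]; split; last by apply: contraNneq nr => ->; rewrite !(mem_cat, inE) eqxx !orbT.
      apply/forallP => j; have := nj j; case: eqVneq => // -> _.
      apply: contra nr; rewrite defq defm /= !(mem_cat, inE) (negbTE v'w) /=.
      by case/or4P=> ->; rewrite ?orbT.
    move=> [/forallP nj v'u]; split; last by apply/forallP => j; rewrite nj implybT.
    apply: contra (nj i); rewrite defq defm /= !(mem_cat, inE) (negbTE v'u) /=.
    by case/or4P=> ->; rewrite ?orbT.
  + move=> j; rewrite /update; case: (eqVneq j i) => // ->.
    by rewrite (negbTE pi0); apply/negbTE.
- by apply: Or32.
Qed.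

Lemma card_ends : #|a @: I :|: b @: I| = 2 * #|I|.
Proof.
rewrite cardsU !card_imset // (_ : _ :&: _ = set0) ?cards0 ?subn0 ?addnn ?mul2n //.
apply/setP => v; rewrite !inE; apply/andP => -[/imsetP [i _ ->] /imsetP [j _ /eqP]].
by rewrite (negbTE (ab i j)).
Qed.

Lemma ends_sub : a @: I :|: b @: I \subset X.
Proof. by apply/subsetP => v; rewrite inE => /orP [] /imsetP [i _ ->]. Qed.

Lemma card_pairs : 2 * #|I| <= #|X|.
Proof. by rewrite -card_ends; apply/subset_leq_card/ends_sub. Qed.

(** Neighbours that are ends of pairs are counted in [C] or the [Z i], so of [X] only the remaining
    [#|X| - 2 * #|I|] vertices are charged. *)
Lemma nbrs_count u (C : {set T}) (z : I -> nat) (Z : I -> {set T}) :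
  (forall i, #|Z i| <= z i) ->
  (forall v, v \in nbrs e V u ->
     [\/ v \in C, exists i, v \in Z i | v \in X /\ forall i, v <> a i /\ v <> b i]) ->
  #|nbrs e V u| + 2 * #|I| <= #|nbrs e V u :&: C| + \sum_i z i + #|X|.
Proof.
move=> leZ cov.
have sN : nbrs e V u \subset
    (nbrs e V u :&: C) :|: (\bigcup_i Z i) :|: (X :\: (a @: I :|: b @: I)).
  apply/subsetP => v vN; have := cov v vN; rewrite !(in_setU, in_setI, in_setD) vN /=.
  case=> [-> // | [i vi] | [vX nab]].
    by apply/orP; left; apply/orP; right; apply/bigcupP; exists i.
  rewrite vX andbT negb_or; apply/orP; right; apply/andP; split.
    by apply/imsetP => -[i _ /(proj1 (nab i))].
  by apply/imsetP => -[i _ /(proj2 (nab i))].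
have := subset_leq_card sN; have := cardsD X (a @: I :|: b @: I).
rewrite (setIidPr ends_sub) card_ends => cardD le_N.
have [le1 _] := leq_card_setU (nbrs e V u :&: C :|: \bigcup_i Z i) (X :\: (a @: I :|: b @: I)).
have [le2 _] := leq_card_setU (nbrs e V u :&: C) (\bigcup_i Z i).
have le3 := card_bigcup_leq Z.
have le4 : \sum_i #|Z i| <= \sum_i z i by apply: leq_sum.
have le5 := card_pairs.
rewrite cardD in le1; move: le_N le1 le2 le3 le4 le5.
clear; lia.
Qed.

(** Each pair accounts for at most three neighbours, so at least [d - #|I| - #|X|] are free, where
    [2 * #|I| <= #|X|]; [big_d] makes this at least 2. *)
Lemma free_deg p u : optimal p -> u \in free p -> 1 < #|nbrs e V u :&: free p|.
Proof.
move=> optp uF; have [uV nuX nup] := mem_free uF.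
have /choice [Z ZP] i : exists Z : {set T}, #|Z| <= 3 /\
    forall v, e u v -> v \in p i \/ v = a i \/ v = b i -> v \in Z.
  have small (s : seq T) : size s <= 3 -> #|[set v in s]| <= 3.
    by rewrite cardsE; apply: leq_trans (card_size s).
  have [pi0 | pi0] := eqVneq (p i) [::].
    exists [set v in [:: a i; b i]]; split; first exact: small.
    by move=> v _; rewrite !inE pi0 => -[// | [] ->]; rewrite eqxx ?orbT.
  have [c [c' [w nP]]] := path_nbrs optp uF pi0.
  exists [set v in [:: c; c'; w]]; split; first exact: small.
  have [[pathp _ _] _] := optp; have [ai bi] := link_path_ends (pathp i pi0).
  move=> v euv vi; have {}vi : v \in p i by case: vi => [// | [] ->].
  by rewrite !inE; case: (nP v vi euv) => [-> | -> | [-> _]]; rewrite eqxx ?orbT.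
have := nbrs_count (u := u) (C := free p) (z := fun=> 3) (fun i => proj1 (ZP i)).
rewrite sum_nat_const; have := card_pairs; have := degV (u := u); rewrite inE uV nuX => /(_ isT).
move=> du cI cov; suff : #|nbrs e V u| + 2 * #|I| <= #|nbrs e V u :&: free p| + #|I| * 3 + #|X| by lia.
apply: cov => v; rewrite inE => /andP [vV euv].
have [[i vi] | nvi] := pselect (exists i, v \in p i \/ v = a i \/ v = b i).
  by apply: Or32; exists i; apply: (proj2 (ZP i)).
have [vX | nvX] := boolP (v \in X).
  by apply: Or33; split=> // i; split=> eqv; apply: nvi; exists i; right; [left | right].
apply: Or31; rewrite !inE vV nvX; apply/forallP => i; apply/negP => vi; apply: nvi.
by exists i; left.
Qed.

(** Otherwise [u] alone would link the pair [i], while another free vertex, a neighbour of [u],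
    stays free. *)
Lemma unlinked_nbr p u i : optimal p -> u \in free p -> p i = [::] -> ~ (e u (a i) /\ e u (b i)).
Proof.
move=> optp uF pi0 [eua eub]; have [Pp max_p] := optp.
have [uV nuX nup] := mem_free uF.
have uX x : x \in X -> u != x by apply: contraTneq => <-.
have pathq : link_path i [:: a i; u; b i].
  split=> //=.
  - by rewrite sym_e eua eub.
  - by rewrite !inE negb_or eq_sym uX //= ab uX.
  - move=> v; rewrite !inE => /or3P [] /eqP ->; split=> //; try (by left) || (by right).
    + exact: (subsetP sXV).
    + by move=> ux; rewrite ux in nuX.
    + exact: (subsetP sXV).
have /card_gt0P [v] : 0 < #|nbrs e V u :&: free p| by have := free_deg optp uF; lia.
rewrite inE => /andP [vN vF]; move: vN; rewrite inE => /andP [_ euv].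
have [vV nvX nvp] := mem_free vF.
have Pu : partial_linkage (update p i [:: a i; u; b i]).
  apply: partial_linkage_update => //.
    move=> w; rewrite mem_seq3 => /or3P [] /eqP ->; [by apply: Or33; left | exact: Or32 | by apply: Or33; right].
  have nvx x : x \in X -> v != x by apply: contraTneq => <-.
  apply/set0Pn; exists v; rewrite free_update inE vV nvX mem_seq3 !negb_or (nvx (a i)) // (nvx (b i)) //= andbT.
  apply/andP; split; first by apply: contraTneq euv => ->; rewrite irr_e.
  by apply/forallP => j; rewrite nvp implybT.
by have [+ _] := max_p _ Pu; rewrite linked_pairs_update // pi0 eqxx addn1 ltnn.
Qed.

(* By optimality a vertex of [C] has at most two neighbours on a path of [p] or three consecutive
   ones; the middle one can then be swapped out, hence belongs to [C] as well. *)
Lemma closure_degree i1 (adm : (I -> seq T) -> Prop) (Cs F0 : {set T}) :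
  (forall p, adm p -> optimal p /\ p i1 = [::]) ->
  (forall p, adm p -> Cs :|: F0 \subset free p) ->
  (forall p u p' w, adm p -> u \in free p -> u \notin Cs -> u \notin F0 ->
     swap p u p' w -> adm p') ->
  (forall p u v, adm p -> u \in free p -> u \notin Cs -> v \in Cs -> ~~ e u v) ->
  #|F0| <= 1 ->
  let C := [set u in ~: (Cs :|: F0) | `[< exists p, adm p /\ u \in free p >]] in
  forall u, u \in C -> d <= #|nbrs e C u| + #|X|.
Proof.
move=> opt_adm fr_adm adm_swap sep leF C u.
rewrite !inE negb_or => /andP [/andP [nuC nuF] /asboolP [p [admp uF]]].
have [optp p1] := opt_adm p admp; have [uV nuX nup] := mem_free uF.
have [[pathp _ _] _] := optp.
have inC v p' : adm p' -> v \in free p' -> v \notin Cs -> v \notin F0 -> v \in C.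
  by move=> adm' vF' nvC nvF; rewrite !inE negb_or nvC nvF; apply/asboolP; exists p'.
have /choice [Z ZP] i : exists Z : {set T}, #|Z| <= (if i == i1 then 1 else 2) /\
    forall v, e u v -> v \in p i \/ v = a i \/ v = b i -> v \in Z \/ v \in C.
  have small (s : seq T) n : size s <= n -> #|[set v in s]| <= n.
    by rewrite cardsE; apply: leq_trans (card_size s).
  have [pi0 | pi0] := eqVneq (p i) [::].
    have [euai | neuai] := boolP (e u (a i)).
      exists [set v in [:: a i]]; split; first by apply: small; case: ifP.
      move=> v euv; rewrite pi0 => -[// | [-> | eqv]]; first by left; rewrite !inE.
      by case: (unlinked_nbr optp uF pi0); rewrite -eqv.
    exists [set v in [:: b i]]; split; first by apply: small; case: ifP.
    move=> v euv; rewrite pi0 => -[// | [eqv | ->]]; last by left; rewrite !inE.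
    by rewrite -eqv euv in neuai.
  have [c [c' [w nP]]] := path_nbrs optp uF pi0.
  exists [set v in [:: c; c']]; split.
    by apply: small; case: eqP => // eqi; rewrite eqi p1 in pi0.
  have [ai bi] := link_path_ends (pathp i pi0).
  move=> v euv vi; have {}vi : v \in p i by case: vi => [// | [] ->].
  case: (nP v vi euv) => [-> | -> | [-> [p' sw]]]; [by left; rewrite !inE eqxx | by left; rewrite !inE eqxx orbT | right].
  have [_ nwF fr' _] := sw; have adm' := adm_swap _ _ _ _ admp uF nuC nuF sw.
  apply: (inC _ p') => //; first by rewrite fr' eqxx.
    by apply: contra nwF => wC; apply: (subsetP (fr_adm p admp)); rewrite inE wC.
  by apply: contra nwF => wC; apply: (subsetP (fr_adm p admp)); rewrite inE wC orbT.
have cov v : v \in nbrs e V u ->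
    [\/ v \in C :|: F0, exists i, v \in Z i | v \in X /\ forall i, v <> a i /\ v <> b i].
  rewrite inE => /andP [vV euv].
  have [[i vi] | nvi] := pselect (exists i, v \in p i \/ v = a i \/ v = b i).
    have [vZ | vC] := proj2 (ZP i) v euv vi; first by apply: Or32; exists i.
    by apply: Or31; rewrite in_setU vC.
  have [vX | nvX] := boolP (v \in X).
    by apply: Or33; split=> // i; split=> eqv; apply: nvi; exists i; right; [left | right].
  have vF : v \in free p.
    rewrite freeE inE nvX vV; apply/forallP => i; apply/negP => vi; apply: nvi.
    by exists i; left.
  apply: Or31; rewrite in_setU; have [vF0 | nvF0] := boolP (v \in F0); first by rewrite orbT.
  rewrite orbF; apply: (inC v p) => //.
  by apply: contraTN euv => vC; apply: (sep p).
have cnt := nbrs_count (fun i => proj1 (ZP i)) cov.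
have deg_u : d <= #|nbrs e V u| by apply: degV; rewrite inE nuX.
(* [u] is not adjacent to both ends of the unlinked pair [i1], so that pair is charged one neighbour
   only; the unit saved pays for the possible vertex of [F0]. *)
have sum_z : \sum_i (if i == i1 then 1 else 2) + 1 = 2 * #|I|.
  rewrite (bigD1 i1) //= eqxx (eq_bigr (fun=> 2)); last by move=> i /negbTE ->.
  have I0 : 0 < #|I| by apply/card_gt0P; exists i1.
  by rewrite sum_nat_const cardC1; move: I0; case: #|I| => //= n _; clear; lia.
have le_nbr : #|nbrs e V u :&: (C :|: F0)| <= #|nbrs e C u| + 1.
  apply: leq_trans (_ : #|nbrs e C u :|: F0| <= _).
    apply/subset_leq_card/subsetP => v; rewrite !in_setI !in_setU in_set => /andP [/andP [_ euv] /orP [vC | ->]].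
      by rewrite [v \in nbrs _ _ _]in_set vC euv.
    by rewrite orbT.
  by apply: leq_trans (leq_card_setU _ _) _; rewrite leq_add2l.
rewrite -(leq_add2r (2 * #|I|)) -{2}sum_z.
move: cnt deg_u le_nbr sum_z; clear.
move: (\sum_i _) => n; lia.
Qed.

(* If [a i1] has a free neighbour [x0], the free vertices reachable from [b i1] are kept out of the
   dense set; maximality of this reachable set makes it invariant under swaps. *)
Definition reach i1 p := [set v in free p | [exists w, e (b i1) w && joined e (free p) w v]].

Lemma reach_closed i1 p u v : u \in reach i1 p -> v \in free p -> e u v -> v \in reach i1 p.
Proof.
rewrite !inE => /andP [uF /existsP [w /andP [ebw juw]]] vF euv; rewrite vF.
apply/existsP; exists w; rewrite ebw; apply: joined_trans juw _.
by apply: joined_edge; rewrite ?inE.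
Qed.

(** A shortest free path from [x0] to a neighbour of [b i1] would link the pair [i1]. Being
    shortest, it contains no neighbour of [x0] except its second vertex, so one of the at least two
    free neighbours of [x0] stays free. *)
Lemma unreachable i1 p x0 : optimal p -> p i1 = [::] -> x0 \in free p -> e (a i1) x0 ->
  x0 \notin reach i1 p.
Proof.
move=> optp p1 x0F ea; have [Pp max_p] := optp; apply/negP.
rewrite inE => /andP [_ /existsP [w /andP [ebw /(joined_sym sym_e) /joined_path]]].
move=> [s0 [pth0 lst0 uq0 sF0]].
have [s [[pth uq sF lst] min_s]] : exists s,
   [/\ path e x0 s, uniq (x0 :: s), {subset x0 :: s <= free p} & e (last x0 s) (b i1)] /\
   forall s', [/\ path e x0 s', uniq (x0 :: s'), {subset x0 :: s' <= free p} & e (last x0 s') (b i1)] ->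
   size s <= size s'.
  by apply: exists_min; exists s0; split=> //; rewrite lst0 sym_e.
have inF v : v \in x0 :: s -> [/\ v \in V, v \notin X & forall j, v \notin p j].
  by move=> /sF /mem_free.
have inX x : x \in X -> x \notin x0 :: s by move=> xX; apply/negP => /inF [_ /negP].
have pathq : link_path i1 (a i1 :: x0 :: rcons s (b i1)).
  split=> //=.
  - by rewrite ea rcons_path pth lst.
  - change (uniq (rcons (a i1 :: x0 :: s) (b i1))); rewrite rcons_uniq cons_uniq uq andbT.
    by rewrite inE negb_or eq_sym ab !inX.
  - by rewrite last_rcons.
  - move=> v; rewrite inE -rcons_cons mem_rcons inE => /or3P [/eqP -> | /eqP -> | /inF [vV nvX _]].
    + by split; [apply: (subsetP sXV) | left].
    + by split; [apply: (subsetP sXV) | right].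
    + by split=> // vX; rewrite vX in nvX.
have [v [vF exv nv]] : exists v, [/\ v \in free p, e x0 v & v \notin x0 :: s].
  have [v [vF exv nhd]] : exists v, [/\ v \in free p, e x0 v & v != head x0 s].
    have := free_deg optp x0F; rewrite (cardsD1 (head x0 s)) => lt1.
    have /card_gt0P [v] : 0 < #|(nbrs e V x0 :&: free p) :\ head x0 s|.
      by move: lt1; case: (_ \in _) => //= /ltnW.
    by rewrite in_setD1 in_setI in_set => /and3P [nhd /andP [_ exv] vF]; exists v.
  exists v; split=> //; rewrite inE negb_or; apply/andP; split.
    by apply: contraTneq exv => ->; rewrite irr_e.
  apply/negP => vs; case: s pth uq sF lst min_s nhd vs {inF inX pathq} => // z s.
  move=> /= /andP [_ pth] uq sF lst min_s nhd; rewrite inE (negbTE nhd) /= => vs.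
  case/splitPr: vs pth uq sF lst min_s => s1 s2; rewrite cat_path /= last_cat /=.
  move=> /and3P [_ _ pth2] uq sF lst /(_ (v :: s2)).
  have sub2 : subseq (x0 :: v :: s2) (x0 :: z :: s1 ++ v :: s2).
    exact: (cat_subseq (subseq_refl [:: x0]) (suffix_subseq (z :: s1) (v :: s2))).
  rewrite /= exv pth2 size_cat /= => min_s.
  suff : (size s1 + (size s2).+1).+1 <= (size s2).+1 by rewrite ltnNge leq_addl.
  apply: min_s; split=> //; first exact: subseq_uniq sub2 uq.
  by move=> y /(mem_subseq sub2) /sF.
have [vV nvX nvp] := mem_free vF.
have Pu : partial_linkage (update p i1 (a i1 :: x0 :: rcons s (b i1))).
  apply: partial_linkage_update => //.
    move=> y; rewrite inE -rcons_cons mem_rcons inE => /or3P [/eqP -> | /eqP -> | /sF yF].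
    - by apply: Or33; left.
    - by apply: Or33; right.
    - exact: Or32.
  have nvXx x : x \in X -> v != x by apply: contraTneq => <-.
  apply/set0Pn; exists v; rewrite free_update in_setD vV nvX -rcons_cons in_cons mem_rcons in_cons 2!negb_or.
  rewrite (nvXx (a i1)) // (nvXx (b i1)) // nv /=.
  by apply/forallP => j; rewrite nvp implybT.
by have [+ _] := max_p _ Pu; rewrite linked_pairs_update // p1 eqxx addn1 ltnn.
Qed.

Lemma reach_swap i1 p u p' w : swap p u p' w -> u \notin reach i1 p ->
  reach i1 p \subset reach i1 p'.
Proof.
move=> [_ _ fr _] nuR; have sRF : reach i1 p \subset free p'.
  apply/subsetP => v vR; rewrite fr; have -> : v \in free p by move: vR; rewrite inE => /andP [].
  by rewrite orbC; case: eqVneq vR nuR => // -> ->.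
apply/subsetP => v vR; rewrite inE (subsetP sRF) //=.
move: (vR); rewrite inE => /andP [_ /existsP [x /andP [ebx jx]]].
apply/existsP; exists x; rewrite ebx; apply: joinedS sRF _.
apply: joined_closed (jx) => [y z | ]; first exact: reach_closed.
rewrite inE; have /and3P [-> _ _] := jx; apply/existsP; exists x.
by rewrite ebx joined_refl //; have /and3P [] := jx.
Qed.

(** [C], [X] and the neighbours of [x] outside [X] are disjoint parts of [V], and the last two have
    more than [d] elements together by [degX]. *)
Lemma anchor_size (C : {set T}) x : x \in X -> C \subset V :\: X ->
  (forall u, u \in C -> ~~ e x u) -> #|C| + d < #|V|.
Proof.
move=> xX sCV nC; apply: leq_trans (_ : #|C| + (#|nbrs e V x :\: X| + #|X|) <= _).
  by rewrite -addnS leq_add2l; apply: degX.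
have := cardsU C (nbrs e V x :\: X); rewrite (_ : C :&: _ = set0) ?cards0 ?subn0; last first.
  apply/setP => v; rewrite !inE; apply/negP => /and4P [vC _ _].
  by rewrite (negbTE (nC v vC)).
rewrite addnA => <-; have := cardsU (C :|: nbrs e V x :\: X) X.
rewrite (_ : _ :&: X = set0) ?cards0 ?subn0; last first.
  apply/setP => v; rewrite in_setI in_setU in_setD !in_set0; apply/negP => /andP [/orP [vC | /andP [nvX _]] vX].
    by have := subsetP sCV v vC; rewrite inE vX.
  by rewrite vX in nvX.
move=> <-; apply/subset_leq_card/subsetP => v; rewrite !inE => /orP [/orP [vC | /and3P [_ ->]] // | /(subsetP sXV) //].
by have := subsetP sCV v vC; rewrite inE => /andP [].
Qed.

(** The bound [#|C| + d < #|V|] needs a vertex without neighbours in [C]: [a i1] if it never has a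
    free neighbour, otherwise [b i1] if the reachable set is empty, and any vertex of the reachable
    set if it is not. *)
Theorem dense_of_unlinkable : exists C : {set T},
  [/\ C != set0, C \subset V :\: X, forall u, u \in C -> d <= #|nbrs e C u| + #|X| &
      #|C| + d < #|V|].
Proof.
have [p0 opt0] := optimal_exists; have [Pp0 _] := opt0; have [i1 p01] := unlinked_pair Pp0.
have subVX (Cs F0 : {set T}) (adm : (I -> seq T) -> Prop) :
    [set u in ~: (Cs :|: F0) | `[< exists p, adm p /\ u \in free p >]] \subset V :\: X.
  apply/subsetP => u; rewrite inE => /andP [_ /asboolP [p [_ /mem_free [uV nuX _]]]].
  by rewrite inE nuX.
have [[p1 [x0 [opt1 p11 x0F ex0]]] | none] := pselect (exists p x0,
    [/\ optimal p, p i1 = [::], x0 \in free p & e (a i1) x0]); last first.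
  have C0 : set0 :|: set0 = set0 :> {set T} by rewrite setU0.
  exists [set u in ~: (set0 :|: set0) | `[< exists p, (optimal p /\ p i1 = [::]) /\ u \in free p >]].
  split=> //.
  - have [_ _ /set0Pn [v vF]] := Pp0; apply/set0Pn; exists v.
    by rewrite C0 !inE; apply/asboolP; exists p0.
  - apply: (closure_degree (i1 := i1)) => //; first by move=> p _; rewrite C0 sub0set.
    + by move=> p u p' w [_ p1] _ _ _ [opt' _ _ eq0]; split=> //; apply/eqP; rewrite eq0 p1.
    + by move=> p u v _ _ _; rewrite inE.
    + by rewrite cards0.
  - apply: (anchor_size (aX i1)) => // u; rewrite inE => /andP [_ /asboolP [p [[optp p1] uF]]].
    by apply/negP => eau; apply: none; exists p, u.
have [pm [[optm pm1 x0m] maxm]] : exists p, [/\ optimal p, p i1 = [::] & x0 \in free p] /\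
   forall q, [/\ optimal q, q i1 = [::] & x0 \in free q] -> #|reach i1 q| <= #|reach i1 p|.
  apply: (exists_max (n := #|T|)); first by exists p1.
  by move=> p _; apply: max_card.
set Cs := reach i1 pm.
pose adm p := [/\ optimal p, p i1 = [::], x0 \in free p & reach i1 p = Cs].
have x0Cs : x0 \notin Cs by apply: unreachable.
have admm : adm pm by [].
have nadj p u v : adm p -> u \in free p -> u \notin Cs -> v \in Cs -> ~~ e u v.
  move=> [_ _ _ <-] uF nuC vC; apply/negP => euv; move/negP: nuC; apply.
  by apply: reach_closed vC uF _; rewrite sym_e.
(* [x0] is set aside as [F0]: swaps then keep it free, so the maximality of the reachable set still
   applies after a swap. *)
exists [set u in ~: (Cs :|: [set x0]) | `[< exists p, adm p /\ u \in free p >]]; split=> //.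
- have /card_gt0P [v] : 0 < #|nbrs e V x0 :&: free pm| by apply: ltnW; apply: free_deg.
  rewrite in_setI in_set => /andP [/andP [_ exv] vF]; apply/set0Pn; exists v.
  rewrite in_set in_setC in_setU in_set1 negb_or -andbA; apply/and3P; split; last by apply/asboolP; exists pm.
    by apply: contraTN exv => vC; apply: (nadj pm).
  by apply: contraTneq exv => ->; rewrite irr_e.
- apply: (closure_degree (i1 := i1)) => //; first by move=> p [].
  + move=> p [_ _ x0p <-]; apply/subsetP => v; rewrite inE => /orP [|]; first by rewrite inE => /andP [].
    by rewrite inE => /eqP ->.
  + move=> p u p' w [optp p1' x0p RC] uF nuC; rewrite inE => nux sw.
    have [opt' _ fr eq0] := sw.
    have p'1 : p' i1 = [::] by apply/eqP; rewrite eq0 p1'.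
    have x0p' : x0 \in free p' by rewrite fr x0p [x0 == u]eq_sym nux orbT.
    split=> //; apply/esym/eqP; rewrite eqEcard maxm ?andbT; last by split.
    by rewrite -RC; apply: reach_swap sw _; rewrite RC.
  + by rewrite cards1.
- have [Cs0 | [z zC]] := set_0Vmem Cs.
    apply: (anchor_size (bX i1)) => // u; rewrite in_set => /andP [_ /asboolP [p [[_ _ _ RC] uF]]].
    apply/negP => ebu; have : u \in Cs by rewrite -RC in_set uF; apply/existsP; exists u; rewrite ebu joined_refl.
    by rewrite Cs0 inE.
  have [zV nzX _] : [/\ z \in V, z \notin X & forall i, z \notin pm i].
    by apply: mem_free; move: zC; rewrite inE => /andP [].
  set C := [set u in _ | _]; have nC u : u \in C -> (u != z) && ~~ e u z.
    rewrite in_set in_setC in_setU negb_or => /andP [/andP [nuC _] /asboolP [p [admp uF]]].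
    by rewrite (nadj p) // andbT; apply: contraNneq nuC => ->.
  apply: leq_trans (_ : #|C :|: (z |: nbrs e V z)| <= _); last first.
    apply/subset_leq_card/subsetP => v; rewrite !in_setU => /or3P [/(subsetP (subVX _ _ _)) | | ].
    - by rewrite inE => /andP [].
    - by rewrite inE => /eqP ->.
    - by rewrite inE => /andP [].
  rewrite cardsU (_ : C :&: _ = set0) ?cards0 ?subn0; last first.
    apply/setP => v; rewrite in_setI in_set0; apply/negP => /andP [/nC /andP [nvz nevz]].
    by rewrite !inE (negbTE nvz) sym_e (negbTE nevz) andbF.
  by rewrite cardsU1 inE irr_e andbF /= add1n addnS ltnS leq_add2l; apply: degV; rewrite inE nzX.
Qed.
End Unlinkable.

(** * Massed pairs are linked *)

Definition linked (T : finType) (e : rel T) (V X : {set T}) :=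
  forall (I : finType) (a b : I -> T),
    (forall i, a i \in X) -> (forall i, b i \in X) -> injective a -> injective b ->
    (forall i j, a i != b j) -> linkage e V X a b.

Section Core.
Variables (T : finType) (e : rel T).
Hypotheses (sym_e : symmetric e) (irr_e : irreflexive e).

Lemma linked_subset V (X Y : {set T}) : Y \subset X -> linked e V X -> linked e V Y.
Proof.
move=> sYX lX I a b aY bY inj_a inj_b ab.
have sub i : i \in Y -> i \in X by apply: (subsetP sYX).
have [D [DP dis]] := lX I a b (fun i => sub _ (aY i)) (fun i => sub _ (bY i)) inj_a inj_b ab.
exists D; split=> // i; have [sD jD XD] := DP i; split=> // x xY.
by apply: XD; apply: (subsetP sYX).
Qed.

Lemma linked_widen (V W : {set T}) X : V \subset W -> linked e V X -> linked e W X.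
Proof.
move=> sVW lV I a b aX bX inj_a inj_b ab; have [D [DP dis]] := lV I a b aX bX inj_a inj_b ab.
by exists D; split=> // i; have [sD jD XD] := DP i; split=> //; apply: subset_trans sVW.
Qed.

Lemma deg_lt (C : {set T}) u : u \in C -> #|nbrs e C u| < #|C|.
Proof.
move=> uC; rewrite [X in _ < X](cardsD1 u) uC ltnS; apply/subset_leq_card/subsetP => v.
by rewrite !inE => /andP [-> euv]; rewrite andbT; apply: contraTneq euv => ->; rewrite irr_e.
Qed.

Lemma not_linked (V X : {set T}) : ~ linked e V X ->
  exists (I : finType) (a b : I -> T), [/\ forall i, a i \in X, forall i, b i \in X,
    injective a, injective b & (forall i j, a i != b j) /\ ~ linkage e V X a b].
Proof.
move=> nl; apply: contrapT => none; apply: nl => I a b aX bX inj_a inj_b ab.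
by apply: contrapT => nl; apply: none; exists I, a, b.
Qed.

Lemma card_setU_leq (A B : {set T}) : #|A :|: B| <= #|A :\: B| + #|B|.
Proof.
have -> : A :|: B = A :\: B :|: B.
  by apply/setP => v; rewrite !inE; case: (v \in B); rewrite ?orbT ?orbF.
by apply: leq_trans (leq_card_setU _ _) _.
Qed.

(** If [D] does not serve, it contains a set [C] of at most [d] vertices with degrees at least
    [d - 2 * t]. If [C] does not serve either, it contains a set of fewer than [2 * t] vertices with
    degrees at least [d - 4 * t], which [6 * t <= d] forbids. *)
Lemma linked_core (D X : {set T}) t d :
  1 < t -> 6 * t <= d -> d < #|D| <= 2 * d + 1 ->
  (forall u, u \in D :\: X -> d <= #|nbrs e D u|) ->
  (forall x, x \in D :&: X -> d < #|nbrs e D x :|: D :&: X|) ->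
  exists C : {set T}, [/\ C \subset D, 2 * t < #|C| &
    forall Y : {set T}, Y \subset C -> X :&: C \subset Y -> #|Y| <= 2 * t -> linked e C Y].
Proof.
move=> lt1t le_d /andP [lt_dD le_D] degD degX; apply: contrapT => none.
have [Y [sYD sXY leY nlY]] : exists Y : {set T},
    [/\ Y \subset D, X :&: D \subset Y, #|Y| <= 2 * t & ~ linked e D Y].
  apply: contrapT => noY; apply: none; exists D; split=> //.
    by move: lt_dD le_d; clear; lia.
  by move=> Y sYD sXY leY; apply: contrapT => nl; apply: noY; exists Y.
have [I [a [b [aY bY inj_a inj_b [ab nlnk]]]]] := not_linked nlY.
have [||| C [C0 sCD degC leC]] := dense_of_unlinkable (d := d) sym_e irr_e sYD aY bY inj_a inj_b ab _ _ _ nlnk.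
- move=> u; rewrite inE => /andP [nuY uD]; apply: degD; rewrite inE uD andbT.
  by apply: contra nuY => uX; apply: (subsetP sXY); rewrite inE uX.
- move=> x xY; apply: leq_trans _ (card_setU_leq _ _).
  have xD := subsetP sYD x xY; have [xX | nxX] := boolP (x \in X).
    apply: leq_trans (degX x _) _; first by rewrite inE xD.
    by apply/subset_leq_card/setUS; rewrite setIC.
  apply: leq_trans (_ : #|x |: nbrs e D x| <= _).
    by rewrite cardsU1 inE irr_e andbF /= add1n ltnS; apply: degD; rewrite inE nxX.
  by apply/subset_leq_card/subsetP => v; rewrite !inE => /orP [/eqP -> | ->]; rewrite ?xY ?orbT.
- by move: leY le_d lt1t; clear; lia.
have degC2 u : u \in C -> d - 2 * t <= #|nbrs e C u|.
  by move/degC; move: leY; clear; lia.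
have XC0 : X :&: C = set0.
  apply/setP => v; rewrite !inE; apply/negP => /andP [vX vC].
  have := subsetP sCD v vC; rewrite inE => /andP [nvY vD]; move/negP: nvY; apply.
  by apply: (subsetP sXY); rewrite inE vX.
have leC2 : 2 * t < #|C|.
  have [u uC] := set0Pn _ C0; have := deg_lt uC; have := degC2 u uC.
  by move: le_d lt1t; clear; lia.
have [Z [sZC leZ nlZ]] : exists Z : {set T}, [/\ Z \subset C, #|Z| <= 2 * t & ~ linked e C Z].
  apply: contrapT => noZ; apply: none; exists C; split=> //.
    by apply: subset_trans sCD (subsetDl _ _).
  by move=> Z sZC _ leZ; apply: contrapT => nl; apply: noZ; exists Z.
have [J [a' [b' [aZ bZ inj_a' inj_b' [ab' nlnk']]]]] := not_linked nlZ.
have [||| C' [C'0 sCC degC' leC']] :=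
  dense_of_unlinkable (d := d - 2 * t) sym_e irr_e sZC aZ bZ inj_a' inj_b' ab' _ _ _ nlnk'.
- by move=> u; rewrite inE => /andP [_ /degC2].
- move=> x xZ; apply: leq_trans _ (card_setU_leq _ _).
  apply: leq_trans (_ : #|x |: nbrs e C x| <= _).
    by rewrite cardsU1 inE irr_e andbF /= add1n ltnS degC2 // (subsetP sZC).
  by apply/subset_leq_card/subsetP => v; rewrite !inE => /orP [/eqP -> | ->]; rewrite ?xZ ?orbT.
- by move: leZ le_d lt1t; clear; lia.
have [u uC'] := set0Pn _ C'0; have := deg_lt uC'; have := degC' u uC'.
by move: leZ le_d lt1t lt_dD le_D leC leC'; clear; lia.
Qed.

(* Twice the number of edges of [V] that meet [Y], for symmetric and irreflexive [e]. *)
Definition rho (V Y : {set T}) :=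
  #|[set z : T * T | [&& e z.1 z.2, z.1 \in V, z.2 \in V & (z.1 \in Y) || (z.2 \in Y)]]|.

(** A connector [D y] meets [C] in [f y] only, and a link in [C] avoids all [f y] but its own ends,
    so different pairs stay disjoint. *)
Lemma linked_extend (V Y C : {set T}) (f : T -> T) (D : T -> {set T}) :
  C \subset V ->
  (forall y, y \in Y -> [/\ D y \subset V, joined e (D y) y (f y), f y \in C & D y :&: C = [set f y]]) ->
  (forall y z, y \in Y -> z \in Y -> y != z -> [disjoint D y & D z]) ->
  linked e C (f @: Y) -> linked e V Y.
Proof.
move=> sCV DP dis lC I a b aY bY inj_a inj_b ab.
have dis_eq y z v : y \in Y -> z \in Y -> v \in D y -> v \in D z -> y = z.
  move=> yY zY vy vz; apply/eqP/negPn/negP => /(dis _ _ yY zY) /pred0P /(_ v) /=.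
  by rewrite vy vz.
have inD y : y \in Y -> y \in D y /\ f y \in D y.
  by move=> yY; have [_ /and3P [-> -> _] _ _] := DP y yY.
have inj_f y z : y \in Y -> z \in Y -> f y = f z -> y = z.
  move=> yY zY eqf; apply: (dis_eq y z (f y)) => //; first by have [] := inD y yY.
  by rewrite eqf; have [] := inD z zY.
have [|||||E [EP disE]] := lC I (f \o a) (f \o b).
- by move=> i; apply: imset_f.
- by move=> i; apply: imset_f.
- by move=> i j /inj_f /inj_a; apply.
- by move=> i j /inj_f /inj_b; apply.
- by move=> i j; apply: contra (ab i j) => /eqP /inj_f ->.
have meet y i v : y \in Y -> v \in D y -> v \in E i -> y = a i \/ y = b i.
  move=> yY vD vE; have [/subsetP sE _ EX] := EP i; have [_ _ _ /setP /(_ v)] := DP y yY.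
  rewrite !inE vD (sE v vE) => /esym /eqP eqv; rewrite eqv in vE.
  by case: (EX (f y) _ vE) => [| /inj_f | /inj_f]; [apply: imset_f | left; auto | right; auto].
exists (fun i => D (a i) :|: E i :|: D (b i)); split=> [i | i j ij].
  have [sDa ja _ _] := DP _ (aY i); have [sDb jb _ _] := DP _ (bY i); have [sE jE _] := EP i.
  split.
  - by rewrite !subUset sDa sDb (subset_trans sE).
  - apply: joined_trans (_ : joined _ _ _ (f (a i))) _.
      by apply: joinedS ja; rewrite -setUA subsetUl.
    apply: joined_trans (_ : joined _ _ _ (f (b i))) _.
      by apply: joinedS jE; rewrite setUAC subsetUr.
    by apply: joined_sym => //; apply: joinedS jb; rewrite subsetUr.
  - move=> x xY; rewrite !inE => /orP [/orP [xD | xE] | xD].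
    + by left; apply: (dis_eq _ _ x) => //; have [] := inD x xY.
    + by apply: (meet x i x) => //; have [] := inD x xY.
    + by right; apply: (dis_eq _ _ x) => //; have [] := inD x xY.
rewrite disjoint_subset; apply/subsetP => v; rewrite !inE => vi; apply/negP => vj.
have nij : a i <> a j /\ b i <> b j by split=> [/inj_a | /inj_b] /eqP; rewrite (negbTE ij).
have ab' k l : a k <> b l by apply/eqP/ab.
have ba' k l : b k <> a l by move=> eq; apply: (ab' l k).
case/orP: vi => [/orP [vi | vi] | vi]; case/orP: vj => [/orP [vj | vj] | vj].
- by case: nij => + _; apply; apply: (dis_eq _ _ v).
- by case: (meet _ _ _ (aY i) vi vj) => [|/ab' //]; case: nij.
- by apply: (ab' i j); apply: (dis_eq _ _ v).
- by case: (meet _ _ _ (aY j) vj vi) => [/esym|/ab' //]; case: nij.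
- by have /pred0P /(_ v) /= := disE _ _ ij; rewrite vi vj.
- by case: (meet _ _ _ (bY j) vj vi) => [/ba' // | /esym]; case: nij.
- by apply: (ba' i j); apply: (dis_eq _ _ v).
- by case: (meet _ _ _ (bY i) vi vj) => [/ba' // |]; case: nij.
- by case: nij => _; apply; apply: (dis_eq _ _ v).
Qed.

(** Since all of [Y] is linked, the paths can be indexed by their starting vertices; each is cut at
    its first vertex in [Q]. *)
Lemma menger_paths (V Y Q : {set T}) : Y \subset V -> Q \subset V ->
  (forall A B, separation V e A B -> Y \subset A -> Q \subset B -> #|Y| <= #|A :&: B|) ->
  exists (f : T -> T) (D : T -> {set T}),
    (forall y, y \in Y -> [/\ D y \subset V, joined e (D y) y (f y), f y \in Q & D y :&: Q = [set f y]]) /\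
    (forall y z, y \in Y -> z \in Y -> y != z -> [disjoint D y & D z]).
Proof.
move=> sYV sQV /(menger sym_e sYV sQV) [a [b [D [DP dis]]]].
have [inj_a _] := disjoint_joined_inj DP dis.
have aY i : a i \in Y by have [] := DP i.
have onto := inj_ord_onto inj_a aY erefl.
have /choice [g gP] y : exists i : option 'I_#|Y|, y \in Y -> exists2 j, i = Some j & a j = y.
  have [yY | nyY] := boolP (y \in Y); last by exists None.
  by have [j aj] := onto y yY; exists (Some j) => _; exists j.
have /choice [E EP] y : exists E : {set T} * T, y \in Y -> exists2 j, g y = Some j &
   [/\ a j = y, E.1 \subset D j, joined e E.1 y E.2, E.2 \in Q & E.1 :&: Q = [set E.2]].
  have [yY | nyY] := boolP (y \in Y); last by exists (set0, y).
  have [j gj aj] := gP y yY; have [_ bQ _ jD] := DP j.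
  have [E [w [sE jE wQ EQ]]] := joined_first jD bQ.
  by exists (E, w) => _; exists j => //; rewrite -{2}aj.
exists (fun y => (E y).2), (fun y => (E y).1); split=> [y yY | y z yY zY yz].
  have [j gj [aj sE jE wQ EQ]] := EP y yY; split=> //; apply: subset_trans sE _.
  by have [] := DP j.
have [j gj [aj sEj _ _ _]] := EP y yY; have [l gl [al sEl _ _ _]] := EP z zY.
have jl : j != l by apply: contra_neq yz => jl; rewrite -aj -al jl.
by apply: disjointWl sEj _; apply: disjointWr sEl _; apply: dis.
Qed.

(** [A1] contains the whole old separator, so adding [A] to it creates no crossing edge and changes
    neither the order nor the far side. *)
Lemma separation_refine_right (V A B A1 B1 : {set T}) : separation V e A B -> separation B e A1 B1 ->
  A :&: B \subset A1 ->
  [/\ separation V e (A :|: A1) B1, (A :|: A1) :&: B1 = A1 :&: B1 & B1 :\: (A :|: A1) = B1 :\: A1].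
Proof.
move=> [defV sep] [defB sep1] /subsetP sSA.
have sB1 v : v \in B1 -> v \in B by rewrite -defB inE orbC => ->.
split.
- split=> [|x y]; first by rewrite -setUA defB.
  rewrite !inE negb_or => /andP [nxB1 xA] /andP [/andP [nyA nyA1] yB1].
  have [xA1 | nxA1] := boolP (x \in A1); first by apply: sep1; rewrite inE ?nxB1 ?nyA1.
  rewrite (negbTE nxA1) orbF in xA; apply: sep; last by rewrite inE nyA sB1.
  by rewrite inE xA andbT -defB inE negb_or nxA1.
- apply/setP => v; rewrite !inE; case: (boolP (v \in B1)) => [/sB1 vB |]; rewrite ?andbF ?andbT //.
  case: (boolP (v \in A)) => //= vA; apply/esym/sSA; by rewrite inE vA.
- apply/setP => v; rewrite !inE; case: (boolP (v \in B1)) => [/sB1 vB |]; rewrite ?andbF ?andbT //.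
  by case: (boolP (v \in A)) => //= vA; rewrite sSA // inE vA.
Qed.

Lemma separation_refine_left (V A B A1 B1 : {set T}) : separation V e A B -> separation A e A1 B1 ->
  A :&: B \subset B1 ->
  separation V e A1 (B1 :|: B) /\ A1 :&: (B1 :|: B) = A1 :&: B1.
Proof.
move=> [defV sep] [defA sep1] /subsetP sSB.
have sA1 v : v \in A1 -> v \in A by rewrite -defA inE => ->.
split.
- split=> [|x y]; first by rewrite setUA defA.
  rewrite !inE negb_or => /andP [/andP [nxB1 nxB] xA1] /andP [nyA1 yB].
  have [yB1 | nyB1] := boolP (y \in B1); first by apply: sep1; rewrite inE ?nxB1 ?nyA1.
  rewrite (negbTE nyB1) /= in yB; apply: sep; first by rewrite inE nxB sA1.
  by rewrite inE yB andbT -defA inE negb_or nyA1.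
- apply/setP => v; rewrite !inE; case: (boolP (v \in A1)) => [/sA1 vA |] //=.
  case: (boolP (v \in B)) => [vB | _]; last by rewrite orbF.
  by rewrite orbT; apply/esym/sSB; rewrite inE vA.
Qed.

(** Menger applies inside [B] because a smaller cut there would refine to a separation of [V] that
    contradicts minimality. *)
Lemma min_separation (V X C : {set T}) : X \subset V -> C \subset V ->
  exists A B, [/\ separation V e A B, X \subset A, C \subset B & #|A :&: B| <= #|X|] /\
   [/\ forall A1 B1, separation V e A1 B1 -> X \subset A1 -> C \subset B1 -> #|A :&: B| <= #|A1 :&: B1| &
    exists (f : T -> T) (D : T -> {set T}),
    (forall y, y \in A :&: B -> [/\ D y \subset B, joined e (D y) y (f y), f y \in C & D y :&: C = [set f y]]) /\
    (forall y z, y \in A :&: B -> z \in A :&: B -> y != z -> [disjoint D y & D z])].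
Proof.
move=> sXV sCV.
pose ok (P : {set T} * {set T}) := [/\ separation V e P.1 P.2, X \subset P.1 & C \subset P.2].
have okXV : ok (X, V).
  split=> //; split; first by apply/setUidPr.
  by move=> x y; rewrite !inE /= => /andP [nxV /(subsetP sXV)]; rewrite (negbTE nxV).
have [[A B] [[sepAB sXA sCB] minAB]] := exists_min (fun P : {set T} * {set T} => #|P.1 :&: P.2|) (ex_intro ok _ okXV).
rewrite /= in sepAB sXA sCB minAB; exists A, B; split.
  by split=> //; apply: leq_trans (minAB _ okXV) _; rewrite /= (setIidPl sXV).
split; first by move=> A1 B1 sep1 sX1 sC1; apply: (minAB (A1, B1)).
apply: menger_paths => //; first exact: subsetIr.
move=> A1 B1 sep1 sSA1 sCB1.
have [sep2 <- _] := separation_refine_right sepAB sep1 sSA1.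
apply: (minAB (_, _)); split=> //=; apply: subset_trans sXA _; exact: subsetUl.
Qed.
End Core.

Lemma card_setU_disjoint (T : finType) (A B : {set T}) : A :&: B = set0 -> #|A :|: B| = #|A| + #|B|.
Proof. by move=> AB0; rewrite cardsU AB0 cards0 subn0. Qed.

(** * Massed pairs under cliques and contractions *)

Section Massed.
Variable T : finType.
Implicit Types (e : rel T) (V X Y S A B C D : {set T}).

(* The massed pairs of Bollobas-Thomason and Thomas-Wollan: dense outside [X], with no dense part
   cut off from [X] by fewer than [#|X|] vertices. *)
Definition massed (lam : nat) e V X :=
  [/\ X \subset V, 2 * lam * #|V :\: X| < rho e V (V :\: X) &
    forall A B, separation V e A B -> X \subset A -> #|A :&: B| < #|X| ->
      rho e V (B :\: A) <= 2 * lam * #|B :\: A|].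

Lemma rho_leq e e' V V' Y Y' :
  (forall x y, x \in V -> y \in V -> e x y -> (x \in Y) || (y \in Y) ->
     [&& e' x y, x \in V', y \in V' & (x \in Y') || (y \in Y')]) ->
  rho e V Y <= rho e' V' Y'.
Proof.
move=> H; apply/subset_leq_card/subsetP => -[x y]; rewrite !inE /= => /and4P [exy xV yV Yxy].
exact: H.
Qed.

Definition clique_rel e S : rel T := [rel x y | e x y || [&& x \in S, y \in S & x != y]].

(* The edge [v w] is contracted onto [w]; the relation is only used on sets avoiding [v]. *)
Definition contract_rel e v w : rel T :=
  [rel x y | [|| e x y, [&& x == w, e v y & y != w] | [&& y == w, e v x & x != w]]].

Lemma clique_rel_sym e S : symmetric e -> symmetric (clique_rel e S).
Proof.
move=> sym_e x y; rewrite /clique_rel /= sym_e eq_sym; congr (_ || _).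
by case: (x \in S); case: (y \in S).
Qed.

Lemma clique_rel_irr e S : irreflexive e -> irreflexive (clique_rel e S).
Proof. by move=> irr_e x; rewrite /clique_rel /= irr_e eqxx !andbF. Qed.

Lemma contract_rel_sym e v w : symmetric e -> symmetric (contract_rel e v w).
Proof. by move=> sym_e x y; rewrite /contract_rel /= sym_e; congr (_ || _); rewrite orbC. Qed.

Lemma contract_rel_irr e v w : irreflexive e -> irreflexive (contract_rel e v w).
Proof. by move=> irr_e x; rewrite /contract_rel /= irr_e; case: eqP; rewrite ?andbF. Qed.

(** Only the part before the first and the part after the last clique edge are kept, so that a
    single link between two vertices of [S] repairs the whole path. *)
Lemma joined_clique e S D x y : joined (clique_rel e S) D x y ->
  joined e D x y \/ exists a b, [/\ a \in S, b \in S, joined e D x a & joined e D b y].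
Proof.
case/and3P=> xD _ /connectP [p pth ->].
suff H : forall z, (joined e D x z \/ exists a b, [/\ a \in S, b \in S, joined e D x a & joined e D b z]) ->
    path (induced (clique_rel e S) D) z p ->
    joined e D x (last z p) \/
      exists a b, [/\ a \in S, b \in S, joined e D x a & joined e D b (last z p)].
  by apply: H => //; left; apply: joined_refl.
elim: p {pth} => [|u p IHp] z //= jz /andP [/and3P [ezu zD uD] pth]; apply: IHp pth.
case/orP: ezu => [ezu | /and3P [zS uS _]].
  have jzu : joined e D z u by apply: joined_edge.
  case: jz => [jz | [a [b [aS bS ja jb]]]]; first by left; apply: joined_trans jzu.
  by right; exists a, b; split=> //; apply: joined_trans jzu.
right; case: jz => [jz | [a [b [aS bS ja jb]]]].
  by exists z, u; split=> //; apply: joined_refl.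
by exists a, u; split=> //; apply: joined_refl.
Qed.

(** Each pair that cannot do without clique edges asks for one link in [B]. The requests have
    distinct ends because the paths in [A] are disjoint, and the last clause of [linkage] keeps the
    links off the other paths. *)
Lemma linked_clique e V A B X S : symmetric e ->
  separation V e A B -> A :&: B = S -> X \subset A ->
  linked (clique_rel e S) A X -> linked e B S -> linked e V X.
Proof.
move=> sym_e [defV sep] defS sXA lA lB I a b aX bX inj_a inj_b ab.
have [D [DP disD]] := lA I a b aX bX inj_a inj_b ab.
have disD_eq i j v : v \in D i -> v \in D j -> i = j.
  move=> vi vj; apply/eqP/negPn/negP => /disD /pred0P /(_ v) /=.
  by rewrite vi vj.
pose need i := ~~ joined e (D i) (a i) (b i).
have /choice [s sP] (i : {i | need i}) : exists s : T * T,
   [/\ s.1 \in S, s.2 \in S, joined e (D (val i)) (a (val i)) s.1 & joined e (D (val i)) s.2 (b (val i))].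
  have [_ jD _] := DP (val i); have [jD' | [s [s' ?]]] := joined_clique jD.
    by move: (valP i); rewrite /need jD'.
  by exists (s, s').
have inD i : (s i).1 \in D (val i) /\ (s i).2 \in D (val i).
  by have [_ _ /and3P [_ -> _] /and3P [-> _ _]] := sP i.
have [|||||E [EP disE]] := lB {i | need i} (fun i => (s i).1) (fun i => (s i).2).
- by move=> i; have [] := sP i.
- by move=> i; have [] := sP i.
- by move=> i j eqs; apply: val_inj; apply: (disD_eq _ _ (s i).1); [|rewrite eqs]; case: (inD i); case: (inD j).
- by move=> i j eqs; apply: val_inj; apply: (disD_eq _ _ (s i).2); [|rewrite eqs]; case: (inD i); case: (inD j).
- move=> i j; apply/eqP => eqs; have eij : i = j.
    by apply: val_inj; apply: (disD_eq _ _ (s i).1); [|rewrite eqs]; case: (inD i); case: (inD j).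
  rewrite -eij in eqs; have [_ _ j1 j2] := sP i; rewrite -eqs in j2.
  by move: (valP i); rewrite /need (joined_trans j1 j2).
have meet i (j : {i | need i}) v : v \in D i -> v \in E j -> i = val j.
  move=> vD vE; have [/subsetP sD _ _] := DP i; have [/subsetP sE _ EX] := EP j.
  have vS : v \in S by rewrite -defS inE sD ?sE.
  by have [s1 s2] := inD j; case: (EX v vS vE) => eqv; apply: (disD_eq _ _ v); rewrite // eqv.
pose F i := if insub i is Some j then E j else set0.
have FP i v : v \in F i -> exists2 j, val j = i & v \in E j.
  by rewrite /F; case: insubP => [j _ <- vE | _]; [exists j | rewrite inE].
exists (fun i => D i :|: F i); split=> [i | i j ij].
  have [sD _ DX] := DP i; split.
  - rewrite subUset -defV (subset_trans sD (subsetUl _ _)) /=; apply/subsetP => v /FP [j _ vE].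
    by rewrite inE; have [/subsetP sE _ _] := EP j; rewrite sE ?orbT.
  - have [jD | nj] := boolP (joined e (D i) (a i) (b i)); first by apply: joinedS jD; apply: subsetUl.
    have [j defi jP] : exists2 j : {i | need i}, val j = i & F i = E j.
      by rewrite /F; case: insubP => [j _ defi | ]; [exists j | rewrite /need nj].
    have [_ _ j1 j2] := sP j; have [_ jE _] := EP j; rewrite defi in j1 j2.
    rewrite jP; apply: joined_trans (joinedS (subsetUl _ _) j1) _.
    by apply: joined_trans (joinedS (subsetUr _ _) jE) (joinedS (subsetUl _ _) j2).
  - move=> x xX; rewrite inE => /orP [|/FP [j defi xE]]; first exact: DX.
    apply: DX => //; have [/subsetP sE _ EX] := EP j.
    have xS : x \in S by rewrite -defS inE (subsetP sXA) ?sE.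
    by rewrite -defi; have [s1 s2] := inD j; case: (EX x xS xE) => ->.
rewrite disjoint_subset; apply/subsetP => v; rewrite !inE => vi; apply/negP => vj.
move/eqP: ij; apply.
case/orP: vi => [vi | /FP [i' <- vi]]; case/orP: vj => [vj | /FP [j' <- vj]].
- exact: disD_eq vi vj.
- exact: meet vi vj.
- by rewrite (meet _ _ _ vj vi).
- congr val; apply/eqP/negPn/negP => /disE /pred0P /(_ v) /=.
  by rewrite vi vj.
Qed.

(** A contracted edge at [w] is replaced by a detour through [v], and [v] is given only to the set
    that contains [w]. *)
Lemma linked_contract e v w B Y : symmetric e -> e v w -> v \notin B -> Y \subset B ->
  linked (contract_rel e v w) B Y -> linked e (v |: B) Y.
Proof.
move=> sym_e evw nvB /subsetP sYB lB I a b aY bY inj_a inj_b ab.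
have [D [DP dis]] := lB I a b aY bY inj_a inj_b ab.
pose F i := if w \in D i then v |: D i else D i.
have sF i : D i \subset F i by rewrite /F; case: ifP; rewrite // subsetUr.
have FP i x : x \in F i -> x \in D i \/ x = v /\ w \in D i.
  by rewrite /F; case: ifP => wD; rewrite ?inE => H; [case/predU1P: H; auto | left].
exists F; split=> [i | i j ij].
  have [sD jD DY] := DP i; split.
  - by apply/subsetP => x /FP [/(subsetP sD) xB | [-> _]]; rewrite !inE ?xB ?eqxx ?orbT.
  - apply: joined_homo (sF i) jD => x y xD yD.
    have xF := subsetP (sF i) x xD; have yF := subsetP (sF i) y yD.
    have vF : w \in D i -> v \in F i by rewrite /F => ->; rewrite setU11.
    case/or3P=> [exy | /and3P [/eqP eqx evy _] | /and3P [/eqP eqy evx _]].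
    + exact: joined_edge.
    + rewrite eqx in xD xF *; apply: joined_trans (_ : joined _ _ _ v) _.
        by apply: joined_edge; rewrite ?vF // sym_e.
      by apply: joined_edge; rewrite ?vF.
    + rewrite eqy in yD yF *; apply: joined_trans (_ : joined _ _ _ v) _.
        by apply: joined_edge; rewrite ?vF // sym_e.
      by apply: joined_edge; rewrite ?vF.
  - move=> x xY /FP [|[xv _]]; first exact: DY.
    by rewrite -xv sYB in nvB.
have sD k x : x \in D k -> x \in B by have [/subsetP sD _ _] := DP k; apply: sD.
have dis_eq k l x : x \in D k -> x \in D l -> k = l.
  move=> xk xl; apply/eqP/negPn/negP => /dis /pred0P /(_ x) /=.
  by rewrite xk xl.
rewrite disjoint_subset; apply/subsetP => x; rewrite inE => xi; apply/negP => xj.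
move/eqP: ij; apply; case/FP: xi => [xi | [xv wi]]; case/FP: xj => [xj | [xv' wj]].
- exact: dis_eq xi xj.
- by rewrite xv' in xi; move: nvB; rewrite (sD _ _ xi).
- by rewrite xv in xj; move: nvB; rewrite (sD _ _ xj).
- exact: dis_eq wi wj.
Qed.

Variables (lam t : nat).
Hypotheses (lt1t : 1 < t) (le_lam : 6 * t <= lam).

(** * Rigid separations and the contraction of an edge *)

Section Step.
Variables (e : rel T) (V X : {set T}).
Hypotheses (sym_e : symmetric e) (irr_e : irreflexive e).
Hypothesis IH : forall e' V' X', symmetric e' -> irreflexive e' -> #|V'| < #|V| ->
  #|X'| <= 2 * t -> massed lam e' V' X' -> linked e' V' X'.
Hypotheses (leX : #|X| <= 2 * t) (mX : massed lam e V X).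

(** Call a separation rigid if its order is at most [#|X|], its separator is linked in [B], and
    [B :\: A] is nonempty. If nothing smaller separates [X] from the separator inside [A], Menger
    carries [X] to it; otherwise the smaller separator is carried to the old one and is rigid with a
    smaller [A] side. *)
Lemma rigid_large A B : separation V e A B -> X \subset A -> #|A :&: B| = #|X| ->
  linked e B (A :&: B) -> B :\: A != set0 ->
  (forall A' B', separation V e A' B' -> X \subset A' -> #|A'| < #|A| -> #|A' :&: B'| <= #|X| ->
     linked e B' (A' :&: B') -> B' :\: A' != set0 -> linked e V X) ->
  linked e V X.
Proof.
move=> sepAB sXA card_S lB BA0 IHA; have [defV _] := sepAB.
have sAV : A \subset V by rewrite -defV subsetUl.
have sBV : B \subset V by rewrite -defV subsetUr.
have [A1 [B1 [[sep1 sXA1 sSB1 le1] [min1 [f [D [DP dis]]]]]]] :=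
  min_separation sym_e sXA (subsetIl A B).
have [sep2 defI] := separation_refine_left sepAB sep1 sSB1.
have sB1A : B1 \subset A by have [<- _] := sep1; apply: subsetUr.
have sA1A : A1 \subset A by have [<- _] := sep1; apply: subsetUl.
have meetB (D' : {set T}) y : D' \subset A -> D' :&: (A :&: B) = [set y] -> D' :&: B = [set y].
  by move=> sD <-; rewrite setIA (setIidPl sD).
have lB1 : linked e (B1 :|: B) (A1 :&: B1).
  apply: (linked_extend sym_e (C := B) (f := f) (D := D)) => //; first exact: subsetUr.
    move=> y yS; have [sD jD fC DC] := DP y yS; split=> //.
    - by apply: subset_trans sD (subsetUl _ _).
    - by move: fC; rewrite inE => /andP [].
    - by apply: meetB DC; apply: subset_trans sD sB1A.
  apply: linked_subset lB; apply/subsetP => _ /imsetP [y yS ->].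
  by have [] := DP y yS.
have [eqX | neqX] := eqVneq #|A1 :&: B1| #|X|; last first.
  apply: IHA sep2 sXA1 _ _ _ _.
  - apply: proper_card; rewrite properEneq sA1A andbT; apply: contra neqX => /eqP eqA.
    rewrite eqn_leq le1 -card_S; apply: subset_leq_card; rewrite subsetI sSB1 andbT eqA.
    exact: subsetIl.
  - by rewrite defI.
  - by rewrite defI.
  - case/set0Pn: BA0 => v; rewrite inE => /andP [nvA vB]; apply/set0Pn; exists v.
    by rewrite !inE vB orbT andbT; apply: contra nvA => /(subsetP sA1A).
have [|f' [D' [DP' dis']]] := menger_paths sym_e sXA (subsetIl A B).
  by move=> A2 B2 sep3 sX2 sS2; rewrite -eqX; apply: min1.
apply: (linked_extend sym_e (C := B) (f := f') (D := D')) => //.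
  move=> y yX; have [sD jD fC DC] := DP' y yX; split=> //.
  - exact: subset_trans sD sAV.
  - by move: fC; rewrite inE => /andP [].
  - exact: meetB DC.
apply: linked_subset lB; apply/subsetP => _ /imsetP [y yS ->].
by have [] := DP' y yS.
Qed.

(** Make the separator [S] a clique in [A]. If the result is massed, induction and [linked_clique]
    finish. Otherwise take a cut [(A1, B1)] violating the condition with [B1] smallest. The clique
    [S] lies in [A1] or in [B1]: the first contradicts [mX]; in the second case [B1] is massed by
    minimality, hence linked, and glued to [B] it gives a rigid separation with a smaller [A]
    side. *)
Lemma rigid_small A B : separation V e A B -> X \subset A -> #|A :&: B| < #|X| ->
  linked e B (A :&: B) -> B :\: A != set0 ->
  (forall A' B', separation V e A' B' -> X \subset A' -> #|A'| < #|A| -> #|A' :&: B'| <= #|X| ->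
     linked e B' (A' :&: B') -> B' :\: A' != set0 -> linked e V X) ->
  linked e V X.
Proof.
move=> sepAB sXA lt_S lB BA0 IHA; have [defV sep] := sepAB; have [sXV M1 M2] := mX.
set S := A :&: B in lt_S lB *.
have sAV : A \subset V by rewrite -defV subsetUl.
have ltAV : #|A| < #|V|.
  case/set0Pn: BA0 => v; rewrite inE => /andP [nvA vB]; apply: proper_card.
  by apply/properP; split=> //; exists v; rewrite // -defV inE vB orbT.
pose e1 := clique_rel e S.
have sym1 : symmetric e1 by apply: clique_rel_sym.
have irr1 : irreflexive e1 by apply: clique_rel_irr.
have ee1 x y : e x y -> e1 x y by rewrite /e1 /clique_rel /= => ->.
have [m1 | nm1] := pselect (massed lam e1 A X).
  exact: linked_clique sym_e sepAB erefl sXA (IH sym1 irr1 ltAV leX m1) lB.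
(* [mX] bounds the density of [B :\: A], so what remains on [A] is still dense enough. *)
have M1' : 2 * lam * #|A :\: X| < rho e1 A (A :\: X).
  have split_rho : rho e V (V :\: X) <= rho e1 A (A :\: X) + rho e V (B :\: A).
    apply: leq_trans _ (leq_card_setU _ _); apply/subset_leq_card/subsetP => -[x y].
    rewrite !inE /= => /and4P [exy xV yV meets].
    have BAV v : v \in V -> v \notin A -> v \in B.
      by rewrite -defV inE => /orP [-> |].
    have [xA | nxA] := boolP (x \in A); last by apply/orP; right; rewrite exy xV yV /= BAV.
    have [yA | nyA] := boolP (y \in A); last by apply/orP; right; rewrite exy xV yV /= (BAV y) ?orbT.
    by apply/orP; left; rewrite ee1 //= !andbT; move: meets; rewrite xV yV !andbT.
  have cardV : #|V :\: X| = #|A :\: X| + #|B :\: A|.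
    have -> : V :\: X = (A :\: X) :|: (B :\: A).
      apply/setP => v; rewrite -defV !inE; case: (boolP (v \in A)) => vA /=; first by rewrite andbT orbF.
      by rewrite andbF /=; case: (boolP (v \in X)) => // /(subsetP sXA); rewrite (negbTE vA).
    rewrite cardsU (_ : _ :&: _ = set0) ?cards0 ?subn0 //.
    by apply/setP => v; rewrite !inE; case: (v \in A); rewrite /= ?andbF.
  have := M2 A B sepAB sXA lt_S; move: M1 split_rho; rewrite cardV mulnDr; clear; lia.
have [A1 [B1 [[sep1 sXA1 lt1 big1] min1]]] : exists A1 B1,
  [/\ separation A e1 A1 B1, X \subset A1, #|A1 :&: B1| < #|X| &
     2 * lam * #|B1 :\: A1| < rho e1 A (B1 :\: A1)] /\
  forall A2 B2, [/\ separation A e1 A2 B2, X \subset A2, #|A2 :&: B2| < #|X| &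
     2 * lam * #|B2 :\: A2| < rho e1 A (B2 :\: A2)] -> #|B1| <= #|B2|.
  pose ok (P : {set T} * {set T}) := [/\ separation A e1 P.1 P.2, X \subset P.1, #|P.1 :&: P.2| < #|X| &
     2 * lam * #|P.2 :\: P.1| < rho e1 A (P.2 :\: P.1)].
  have [|[A1 B1] [ok1 min1]] := exists_min (fun P : {set T} * {set T} => #|P.2|) (_ : exists P, ok P).
    apply: contrapT => none; apply: nm1; split=> // A1 B1 sep1 sX1 lt1.
    by rewrite leqNgt; apply/negP => big; apply: none; exists (A1, B1).
  by exists A1, B1; split=> // A2 B2 ok2; apply: (min1 (A2, B2)).
have [defA sepA] := sep1.
have sA1A : A1 \subset A by rewrite -defA subsetUl.
have sB1A : B1 \subset A by rewrite -defA subsetUr.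
have sSA : S \subset A by apply: subsetIl.
have BA1 : B1 :\: A1 != set0.
  apply: contraTneq big1 => ->; rewrite cards0 muln0 -leqNgt leqn0 cards_eq0.
  by apply/eqP/setP => -[x y]; rewrite !inE !andbF.
have [sSA1 | /subsetPn [s sS nsA1]] := boolP (S \subset A1).
  have disB v : v \in B1 -> v \in B -> v \in A1.
    by move=> vB1 vB; apply: (subsetP sSA1); rewrite inE vB (subsetP sB1A).
  have sep2 : separation V e (A1 :|: B) B1.
    split=> [|x y]; first by rewrite setUAC defA.
    rewrite !inE negb_or => /andP [nxB1 xAB] /andP [/andP [nyA1 nyB] yB1].
    have yA := subsetP sB1A y yB1; case/orP: xAB => [xA1 | xB].
      by apply: contra (sepA x y _ _); [apply: ee1 | rewrite inE nxB1 | rewrite inE nyA1].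
    have [xA | nxA] := boolP (x \in A).
      have xA1 : x \in A1 by apply: (subsetP sSA1); rewrite inE xA.
      by apply: contra (sepA x y _ _); [apply: ee1 | rewrite inE nxB1 | rewrite inE nyA1].
    by rewrite sym_e; apply: sep; rewrite inE ?nyB ?nxA.
  have defD : B1 :\: (A1 :|: B) = B1 :\: A1.
    apply/setP => v; rewrite !inE negb_or; case: (boolP (v \in A1)) => //= nvA1.
    by case: (boolP (v \in B1)) => [vB1 | _]; rewrite ?andbF // andbT; apply: contra nvA1; apply: disB.
  have defI : (A1 :|: B) :&: B1 = A1 :&: B1.
    apply/setP => v; rewrite !inE; case: (boolP (v \in A1)) => //= nvA1.
    by apply/andP => -[vB vB1]; rewrite disB in nvA1.
  have := M2 _ _ sep2 (subset_trans sXA1 (subsetUl _ _)); rewrite defI defD => /(_ lt1).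
  move=> le1; have := leq_ltn_trans le1 big1; rewrite ltnNge => /negP; case.
  apply: rho_leq => x y xA yA e1xy xyD; rewrite !(subsetP sAV) // xyD !andbT.
  case/orP: e1xy => // /and3P [xS yS _].
  by case/orP: xyD; rewrite inE => /andP [+ _]; rewrite (subsetP sSA1).
have sSB1 : S \subset B1.
  apply/subsetP => s' s'S; apply: contrapT => /negP ns'B1.
  have inA v : v \in S -> (v \in A1) || (v \in B1) by move/(subsetP sSA); rewrite -defA inE.
  have s'A1 : s' \in A1 by have := inA s' s'S; rewrite (negbTE ns'B1) orbF.
  have sB1 : s \in B1 by have := inA s sS; rewrite (negbTE nsA1).
  have := sepA s' s; rewrite !inE ns'B1 s'A1 nsA1 sB1 => /(_ isT isT).
  by rewrite /e1 /clique_rel /= s'S sS negb_or negb_and /= negbK andbC; case: eqP => // eqs; rewrite eqs (negbTE nsA1) in s'A1.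
have mB1 : massed lam e1 B1 (A1 :&: B1).
  have defB1 : B1 :\: (A1 :&: B1) = B1 :\: A1.
    by apply/setP => v; rewrite !inE; case: (v \in A1); case: (v \in B1).
  split; first exact: subsetIr.
    rewrite defB1; apply: leq_trans big1 _.
    apply: rho_leq => x y xA yA e1xy xyD; rewrite e1xy xyD andbT.
    have inB1 u v : u \in B1 :\: A1 -> v \in A -> e1 u v -> v \in B1.
      move=> uD vA euv; apply: contrapT => /negP nvB1; have vA1 : v \in A1.
        by move: vA; rewrite -defA inE (negbTE nvB1) orbF.
      have := sepA v u; rewrite uD inE nvB1 vA1 => /(_ isT isT).
      by rewrite -/(e1 v u) sym1 euv.
    case/orP: (xyD) => uD; first by rewrite (inB1 x y) // andbT; move: uD; rewrite inE => /andP [].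
    by rewrite (inB1 y x) // 1?sym1 //; move: uD; rewrite inE => /andP [].
  move=> A2 B2 sep2 sIA2 lt2; rewrite leqNgt; apply/negP => big2.
  have [sep3 defI defD] := separation_refine_right sep1 sep2 sIA2.
  have [defB12 _] := sep2; have sB2B1 : B2 \subset B1 by rewrite -defB12 subsetUr.
  have le12 : #|B1| <= #|B2|.
    apply: (min1 (A1 :|: A2) B2); split=> //.
    - exact: subset_trans sXA1 (subsetUl _ _).
    - by rewrite defI; apply: ltn_trans lt2 lt1.
    - rewrite defD; apply: leq_trans big2 _.
      by apply: rho_leq => x y xB yB -> ->; rewrite !(subsetP sB1A).
  have eqB : B2 = B1 by apply/eqP; rewrite eqEcard sB2B1.
  move: lt2; rewrite ltnNge => /negP; apply; apply: subset_leq_card.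
  by rewrite subsetI sIA2 eqB subsetIr.
have ltB1 : #|B1| < #|V| by apply: leq_ltn_trans ltAV; apply: subset_leq_card.
have leI : #|A1 :&: B1| <= 2 * t by apply: leq_trans leX; apply: ltnW.
have lB1 := IH sym1 irr1 ltB1 leI mB1.
have defSB : B1 :&: B = S.
  apply/setP => v; rewrite !inE; case: (boolP (v \in B)) => vB; rewrite ?andbF // !andbT.
  apply/idP/idP => [/(subsetP sB1A) // | vA]; by apply: (subsetP sSB1); rewrite inE vA.
have sepB : separation (B1 :|: B) e B1 B.
  split=> // x y; rewrite !inE => /andP [nxB xB1] /andP [nyB1 yB].
  apply: sep; first by rewrite inE nxB (subsetP sB1A).
  rewrite inE yB andbT; apply: contra nyB1 => yA.
  by apply: (subsetP sSB1); rewrite inE yA.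
have [sep2 defI] := separation_refine_left sepAB (conj defA (fun x y xD yD =>
   contra (@ee1 x y) (sepA x y xD yD)) : separation A e A1 B1) sSB1.
apply: (IHA A1 (B1 :|: B)) => //.
- apply: proper_card; rewrite properEneq sA1A andbT; apply: contraNneq BA1 => eqA.
  by apply/eqP/setP => v; rewrite !inE; case: (boolP (v \in B1)) => [/(subsetP sB1A) vA | _]; rewrite ?andbF // eqA vA.
- by rewrite defI ltnW.
- by rewrite defI; apply: linked_clique sym_e sepB defSB (subsetIr _ _) lB1 lB.
- case/set0Pn: BA1 => v; rewrite inE => /andP [nv vB1]; apply/set0Pn; exists v.
  by rewrite !inE nv vB1.
Qed.

Lemma rigid A B : separation V e A B -> X \subset A -> #|A :&: B| <= #|X| ->
  linked e B (A :&: B) -> B :\: A != set0 -> linked e V X.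
Proof.
have [n] := ubnP #|A|; elim: n A B => // n IHn A B le_n sepAB sXA leS lB BA0.
have IHA A' B' : separation V e A' B' -> X \subset A' -> #|A'| < #|A| -> #|A' :&: B'| <= #|X| ->
    linked e B' (A' :&: B') -> B' :\: A' != set0 -> linked e V X.
  by move=> sep' sX' lt' le' l' BA'; apply: (IHn A' B') => //; apply: leq_trans lt' _; rewrite -ltnS.
move: leS; rewrite leq_eqVlt => /orP [/eqP eqS | ltS].
  exact: (rigid_large sepAB).
exact: (rigid_small sepAB).
Qed.

(* If the contraction of [v w] is not massed because of a separation, a minimal such separation
   is rigid in the graph itself. *)
Lemma contraction_step v w : v \in V :\: X -> w \in V -> e v w ->
  linked e V X \/
  rho (contract_rel e v w) (V :\ v) ((V :\ v) :\: X) <= 2 * lam * #|(V :\ v) :\: X|.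
Proof.
rewrite inE => /andP [nvX vV] wV evw; have [sXV M1 M2] := mX.
have wv : w != v by apply: contraTneq evw => ->; rewrite irr_e.
pose e1 := contract_rel e v w.
have sym1 : symmetric e1 by apply: contract_rel_sym.
have irr1 : irreflexive e1 by apply: contract_rel_irr.
have ee1 x y : e x y -> e1 x y by rewrite /e1 /contract_rel /= => ->.
have e1e x y : x != w -> y != w -> e1 x y -> e x y.
  by move=> xw yw; rewrite /e1 /contract_rel /= (negbTE xw) (negbTE yw) !orbF.
have sXV1 : X \subset V :\ v.
  by apply/subsetP => x xX; rewrite !inE (subsetP sXV) // andbT; apply: contraNneq nvX => <-.
have ltV1 : #|V :\ v| < #|V| by rewrite [X in _ < X](cardsD1 v) vV.
have nvV1 : v \notin V :\ v by rewrite !inE eqxx.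
have [m1 | nm1] := pselect (massed lam e1 (V :\ v) X).
  left; rewrite -(setD1K vV); apply: linked_contract evw nvV1 sXV1 _ => //.
  exact: IH.
have [le1 | gt1] := leqP (rho e1 (V :\ v) ((V :\ v) :\: X)) (2 * lam * #|(V :\ v) :\: X|).
  by right.
left.
have [A [B [[sepAB sXA ltS big] minB]]] : exists A B,
  [/\ separation (V :\ v) e1 A B, X \subset A, #|A :&: B| < #|X| &
     2 * lam * #|B :\: A| < rho e1 (V :\ v) (B :\: A)] /\
  forall A2 B2, [/\ separation (V :\ v) e1 A2 B2, X \subset A2, #|A2 :&: B2| < #|X| &
     2 * lam * #|B2 :\: A2| < rho e1 (V :\ v) (B2 :\: A2)] -> #|B| <= #|B2|.
  pose ok (P : {set T} * {set T}) := [/\ separation (V :\ v) e1 P.1 P.2, X \subset P.1,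
     #|P.1 :&: P.2| < #|X| & 2 * lam * #|P.2 :\: P.1| < rho e1 (V :\ v) (P.2 :\: P.1)].
  have [|[A B] [ok1 min1]] := exists_min (fun P : {set T} * {set T} => #|P.2|) (_ : exists P, ok P).
    apply: contrapT => none; apply: nm1; split=> // A B sepAB sXA ltS.
    by rewrite leqNgt; apply/negP => big; apply: none; exists (A, B).
  by exists A, B; split=> // A2 B2 ok2; apply: (min1 (A2, B2)).
have [defV1 sep] := sepAB.
have sAV1 : A \subset V :\ v by rewrite -defV1 subsetUl.
have sBV1 : B \subset V :\ v by rewrite -defV1 subsetUr.
have nvA : v \notin A by apply: contra nvV1; apply: (subsetP sAV1).
have nvB : v \notin B by apply: contra nvV1; apply: (subsetP sBV1).
have defV : v |: (A :|: B) = V by rewrite defV1 setD1K.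
have BA0 : B :\: A != set0.
  apply: contraTneq big => ->; rewrite cards0 muln0 -leqNgt leqn0 cards_eq0.
  by apply/eqP/setP => -[x y]; rewrite !inE !andbF.
have wAB : (w \in A) || (w \in B) by rewrite -in_setU defV1 !inE wv.
have sV1V : V :\ v \subset V by apply: subsetDl.
have inB x y : x \in B :\: A -> y \in V :\ v -> e1 x y -> y \in B.
  move=> xD yV1 exy; apply: contrapT => /negP nyB; have yA : y \in A.
    by move: yV1; rewrite -defV1 inE (negbTE nyB) orbF.
  by have := sep y x; rewrite xD inE nyB yA sym1 exy => /(_ isT isT).
(* If [w] lies in [A] only, [v] is put there too, and the same cut violates [mX]. *)
have [wB | nwB] := boolP (w \in B); last first.
  have sep2 : separation V e (v |: A) B.
    split=> [|x y]; first by rewrite -setUA defV.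
    rewrite !inE negb_or => /andP [nxB /predU1P [-> | xA]] /andP [/andP [yv nyA] yB].
      apply/negP => evy; have : e1 w y.
        rewrite /e1 /contract_rel /= eqxx evy /=; apply/or3P/Or32.
        by apply: contraNneq nwB => <-.
      move=> ewy; have := sep w y; rewrite !inE nwB nyA yB ewy.
      by move: wAB; rewrite (negbTE nwB) orbF => -> /(_ isT isT).
    by apply: contra (sep x y _ _); [apply: ee1 | rewrite inE nxB | rewrite inE nyA].
  have defD : B :\: (v |: A) = B :\: A.
    apply/setP => x; rewrite !inE negb_or; case: (boolP (x \in B)) => xB; rewrite ?andbF // !andbT.
    by rewrite (contraNneq _ nvB) // => <-.
  have defI : (v |: A) :&: B = A :&: B.
    apply/setP => x; rewrite !inE; case: (boolP (x \in B)) => xB; rewrite ?andbF // !andbT.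
    by rewrite (negbTE (contraNneq _ nvB : x != v)) // => <-.
  have := M2 _ _ sep2 (subset_trans sXA (subsetUr _ _)); rewrite defI defD => /(_ ltS) le2.
  have := leq_ltn_trans le2 big; rewrite ltnNge => /negP; case.
  apply: rho_leq => x y xV1 yV1 exy xyD; rewrite !(subsetP sV1V) // xyD !andbT.
  have xyB : (x \in B) && (y \in B).
    case/orP: (xyD) => uD; have uB := uD; rewrite inE in uB; case/andP: uB => _ ->; rewrite ?andbT /=.
      exact: inB uD yV1 exy.
    by apply: inB uD xV1 _; rewrite sym1.
  case/andP: xyB => xB yB; apply: e1e exy; by apply: contraNneq nwB => <-.
(* If [w] lies in [B] only, the contracted graph is massed on [B], and undoing the contraction gives
   a rigid separation with [v] on the [B] side. *)
have [wA | nwA] := boolP (w \in A); last first.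
  have m1 : massed lam e1 B (A :&: B).
    have defB : B :\: (A :&: B) = B :\: A.
      by apply/setP => x; rewrite !inE; case: (x \in A); case: (x \in B).
    split; first exact: subsetIr.
      rewrite defB; apply: leq_trans big _; apply: rho_leq => x y xV1 yV1 exy xyD; rewrite exy xyD andbT.
      case/orP: (xyD) => uD.
        by rewrite (inB x y) // andbT; move: uD; rewrite inE => /andP [].
      by rewrite (inB y x) // 1?sym1 //; move: uD; rewrite inE => /andP [].
    move=> A2 B2 sep2 sIA2 lt2; rewrite leqNgt; apply/negP => big2.
    have [sep3 defI defD] := separation_refine_right sepAB sep2 sIA2.
    have [defB12 _] := sep2; have sB2B : B2 \subset B by rewrite -defB12 subsetUr.
    have le12 : #|B| <= #|B2|.
      apply: (minB (A :|: A2) B2); split=> //.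
      - exact: subset_trans sXA (subsetUl _ _).
      - by rewrite defI; apply: ltn_trans lt2 ltS.
      - rewrite defD; apply: leq_trans big2 _.
        by apply: rho_leq => x y xB yB -> ->; rewrite !(subsetP sBV1).
    have eqB : B2 = B by apply/eqP; rewrite eqEcard sB2B.
    move: lt2; rewrite ltnNge => /negP; apply; apply: subset_leq_card.
    by rewrite subsetI sIA2 eqB subsetIr.
  have ltB : #|B| < #|V| by apply: leq_ltn_trans ltV1; apply: subset_leq_card.
  have leI : #|A :&: B| <= 2 * t by apply: leq_trans leX; apply: ltnW.
  have lB := IH sym1 irr1 ltB leI m1.
  have lB1 := linked_contract sym_e evw nvB (subsetIr _ _) lB.
  have defI : A :&: (v |: B) = A :&: B.
    apply/setP => x; rewrite !inE; case: (boolP (x \in A)) => //= xA.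
    by rewrite (negbTE (contraNneq _ nvA : x != v)) // => <-.
  have sep2 : separation V e A (v |: B).
    split=> [|x y]; first by rewrite setUCA defV.
    rewrite !inE negb_or => /andP [/andP [xv nxB] xA] /andP [nyA /predU1P [-> | yB]]; last first.
      by apply: contra (sep x y _ _); [apply: ee1 | rewrite inE nxB | rewrite inE nyA].
    apply/negP => exv; have ewx : e1 x w.
      rewrite /e1 /contract_rel /= eqxx [e v x]sym_e exv /=; apply/or3P/Or33.
      by apply: contraNneq nwA => <-.
    by have := sep x w; rewrite !inE nxB xA nwA wB ewx => /(_ isT isT).
  apply: (rigid sep2 sXA); rewrite ?defI //; first exact: ltnW.
  case/set0Pn: BA0 => x; rewrite inE => /andP [nxA xB]; apply/set0Pn; exists x.
  by rewrite !inE nxA xB orbT.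
(* If [w] lies in the separator, [v] joins it: the order grows by one, hence is still at most
   [#|X|], and the far side is massed for [e] itself. *)
have sep2 : separation V e (v |: A) (v |: B).
  split=> [|x y]; first by rewrite -setUUr defV.
  rewrite !inE !negb_or => /andP [/andP [xv nxB]]; rewrite (negbTE xv) /= => xA.
  move=> /andP [/andP [yv nyA]]; rewrite (negbTE yv) /= => yB.
  by apply: contra (sep x y _ _); [apply: ee1 | rewrite inE nxB | rewrite inE nyA].
have defI : (v |: A) :&: (v |: B) = v |: A :&: B by rewrite -setUIr.
have cardI : #|v |: A :&: B| = #|A :&: B|.+1 by rewrite cardsU1 inE (negbTE nvA).
have defD : (v |: B) :\: (v |: A :&: B) = B :\: A.
  apply/setP => x; rewrite !inE negb_or negb_and; have [-> | xv] := eqVneq x v.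
    by rewrite (negbTE nvB) andbF.
  by rewrite /=; case: (x \in B); rewrite ?andbF ?orbF.
have mB : massed lam e (v |: B) (v |: A :&: B).
  split; first by apply: setUS; apply: subsetIr.
    rewrite defD; apply: leq_trans big _.
    (* An edge created by the contraction is sent back to the edge at [v] it comes from, so the
       count for [e] is at least as large. *)
    pose g (z : T * T) := (if (z.1 == w) && ~~ e z.1 z.2 then v else z.1,
                           if (z.2 == w) && ~~ e z.1 z.2 then v else z.2).
    have inE1 z : [&& e1 z.1 z.2, z.1 \in V :\ v, z.2 \in V :\ v & (z.1 \in B :\: A) || (z.2 \in B :\: A)] ->
        [/\ z.1 \in B, z.2 \in B, z.1 != v & z.2 != v].
      case/and4P=> exy xV1 yV1 xyD; have [xB yB] : z.1 \in B /\ z.2 \in B.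
        case/orP: xyD => uD; have uB := uD; rewrite inE in uB; case/andP: uB => _ uB.
          by split=> //; apply: inB uD yV1 exy.
        by split=> //; apply: inB uD xV1 _; rewrite sym1.
      by split=> //; [move: xV1 | move: yV1]; rewrite !inE => /andP [].
    rewrite /rho -(card_in_imset (f := g)); last first.
      move=> [x y] [x' y']; rewrite 2!in_set => /(inE1 (x, y)) /= [_ _ xv yv] /(inE1 (x', y')) /= [_ _ xv' yv'].
      rewrite /g /=; case: (boolP (e x y)) => exy; case: (boolP (e x' y')) => exy'; rewrite ?andbF ?andbT //.
      - case=> E1 E2; move: xv yv exy; rewrite E1 E2; case: (eqVneq x' w) => [_ | _]; rewrite ?eqxx //.
        by case: (eqVneq y' w) => [_ | _]; rewrite ?eqxx // (negbTE exy').
      - case=> E1 E2; move: xv' yv' exy'; rewrite -E1 -E2; case: (eqVneq x w) => [_ | _]; rewrite ?eqxx //.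
        by case: (eqVneq y w) => [_ | _]; rewrite ?eqxx // (negbTE exy).
      - case=> E1 E2; congr (_, _).
          move: E1; case: (eqVneq x w) => [-> | _]; case: (eqVneq x' w) => [-> | _] // eqx.
            by rewrite -eqx eqxx in xv'.
          by rewrite eqx eqxx in xv.
        move: E2; case: (eqVneq y w) => [-> | _]; case: (eqVneq y' w) => [-> | _] // eqy.
          by rewrite -eqy eqxx in yv'.
        by rewrite eqy eqxx in yv.
    apply/subset_leq_card/subsetP => _ /imsetP [[x y] xyP ->]; move: xyP; rewrite in_set => xyP.
    have /= [xB yB xv yv] := inE1 _ xyP; case/and4P: xyP => /= exy _ _ xyD.
    rewrite in_set /g /=; have [exy' | nexy] := boolP (e x y).
      by rewrite !andbF exy' !in_setU xB yB !orbT.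
    rewrite !andbT; move: exy; rewrite /e1 /contract_rel /= (negbTE nexy) /=.
    case/orP=> /and3P [/eqP eqw evu nw].
      rewrite eqw eqxx (negbTE nw) evu !in_setU in_set1 eqxx yB orbT /=.
      by move: xyD; rewrite eqw [w \in _]in_setD wA /= => ->; rewrite orbT.
    rewrite eqw eqxx (negbTE nw) sym_e evu !in_setU !in_set1 eqxx xB orbT /=.
    by move: xyD; rewrite eqw [w \in _]in_setD wA /= orbF => ->.
  move=> A2 B2 sep3 sIA2 lt2; rewrite -defI in sIA2.
  have [sep4 defI2 defD2] := separation_refine_right sep2 sep3 sIA2.
  rewrite -defD2; apply: leq_trans (_ : rho e V (B2 :\: (v |: A :|: A2)) <= _).
    apply: rho_leq => x y xB yB -> ->; rewrite andbT.
    have sBV : v |: B \subset V by rewrite -defV; apply: setUS; apply: subsetUr.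
    by rewrite !(subsetP sBV).
  apply: M2 sep4 _ _; first by apply: subset_trans sXA _; rewrite -setUA setUCA subsetUl.
  by rewrite defI2; apply: leq_trans lt2 _; rewrite cardI.
have ltB : #|v |: B| < #|V|.
  have [x xX nxB] : exists2 x, x \in X & x \notin v |: B.
    apply/subsetPn; apply: contraTN ltS => sXB; rewrite -leqNgt; apply: subset_leq_card.
    rewrite subsetI sXA; apply/subsetP => x xX; have := subsetP sXB x xX; rewrite !inE.
    by case: eqP => // eqx; rewrite -eqx xX in nvX.
  apply: proper_card; apply/properP; split; first by rewrite -defV; apply: setUS; apply: subsetUr.
  by exists x; rewrite // (subsetP sXV).
have leI : #|v |: A :&: B| <= 2 * t by rewrite cardI; apply: leq_trans leX.
have lB := IH sym_e irr_e ltB leI mB.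
apply: (rigid sep2 (subset_trans sXA (subsetUr _ _))); rewrite ?defI ?cardI //.
case/set0Pn: BA0 => x; rewrite inE => /andP [nxA xB]; apply/set0Pn; exists x.
by rewrite !inE negb_or nxA xB orbT !andbT; apply: contraNneq nvB => <-.
Qed.

(** The contraction loses the edge [v w] and one edge for each common neighbour. An edge from [v] to
    [y] is also lost if [w] and [y] both lie in [X], since edges inside [X] do not count. As [rho]
    counts edges twice, the loss is doubled. *)
Lemma rho_contract v w : v \in V :\: X -> w \in V -> e v w ->
  rho e V (V :\: X) <= rho (contract_rel e v w) (V :\ v) ((V :\ v) :\: X) +
    2 * #|[set y in nbrs e V v | (y != w) && (e w y || (w \in X) && (y \in X))]|.+1.
Proof.
rewrite inE => /andP [nvX vV] wV evw.
have wv : w != v by apply: contraTneq evw => ->; rewrite irr_e.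
set c := [set y in nbrs e V v | _].
pose N := nbrs e V v; pose N' := [set y in N | (y != w) && ~~ (e w y || (w \in X) && (y \in X))].
pose R := [set z : T * T | [&& e z.1 z.2, z.1 \in V :\ v, z.2 \in V :\ v & (z.1 \in V :\: X) || (z.2 \in V :\: X)]].
have cardN : #|N| = (#|c| + #|N'|).+1.
  rewrite (cardsD1 w) inE wV evw add1n; congr _.+1.
  have -> : N :\ w = c :|: N'.
    apply/setP => y; rewrite !inE; case: (y != w); rewrite ?andbF //= ?andbT.
    by case: (y \in V); case: (e v y) => //=; rewrite orbN.
  rewrite cardsU (_ : c :&: N' = set0) ?cards0 ?subn0 //.
  apply/setP => y; rewrite !inE; case: (y != w); rewrite ?andbF //=.
  by case: (e w y || _); rewrite ?andbF.
have le_rho : rho e V (V :\: X) <= #|R| + 2 * #|N|.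
  have -> : 2 * #|N| = #|setX [set v] N| + #|setX N [set v]| by rewrite !cardsX cards1; clear; lia.
  rewrite addnA; apply: leq_trans (_ : #|R :|: setX [set v] N :|: setX N [set v]| <= _); last first.
    by apply: leq_trans (leq_card_setU _ _) _; rewrite leq_add2r; apply: leq_card_setU.
  apply/subset_leq_card/subsetP => -[x y]; rewrite !inE /= => /and4P [exy xV yV xyX].
  rewrite exy xV yV; have [eqx | xv] /= := eqVneq x v; first by rewrite -eqx exy ?orbT.
  have [eqy | yv] /= := eqVneq y v; first by rewrite -eqy sym_e exy ?orbT.
  by move: xyX; rewrite xV yV !andbT => ->.
have le_rho' : #|R| + 2 * #|N'| <= rho (contract_rel e v w) (V :\ v) ((V :\ v) :\: X).
  have -> : 2 * #|N'| = #|setX [set w] N'| + #|setX N' [set w]| by rewrite !cardsX cards1; clear; lia.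
  have nwN y : y \in N' -> [/\ y != w, ~~ e w y & ~~ ((w \in X) && (y \in X))].
    by rewrite inE negb_or => /and4P [_ -> -> ->].
  rewrite addnA -card_setU_disjoint; last first.
    apply/setP => -[x y]; rewrite in_set0 in_setI in_setX in_set1 in_set /=; apply/negP.
    move=> /and3P [/andP [exy _] /eqP eqx /nwN [_ newy _]].
    by rewrite eqx (negbTE newy) in exy.
  rewrite -card_setU_disjoint; last first.
    apply/setP => -[x y]; rewrite in_set0 in_setI in_setU !in_setX !in_set1 in_set /=; apply/negP.
    move=> /and3P [+ /nwN [_ newx _] /eqP eqy]; rewrite eqy => /orP [/andP [exw _] | /andP [_ /nwN []]].
      by rewrite sym_e exw in newx.
    by rewrite eqxx.
  have inV' y : y \in N' -> y \in V :\ v.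
    rewrite !inE => /andP [/andP [yV evy] _]; rewrite yV andbT.
    by apply: contraTneq evy => ->; rewrite irr_e.
  have evN y : y \in N' -> e v y by rewrite !inE => /andP [/andP [_ ->]].
  have wV' : w \in V :\ v by rewrite !inE wv.
  have inD y : y \in V :\ v -> (y \in (V :\ v) :\: X) = (y \notin X).
    by move=> yV'; rewrite in_setD yV' andbT.
  apply/subset_leq_card/subsetP => -[x y]; rewrite !in_setU !in_setX !in_set1 !(in_set (_ : pred (T * T))) /=.
  case/orP=> [/orP [/and4P [exy xV' yV' xyX] | /andP [/eqP -> yN']] | /andP [xN' /eqP ->]].
  - have -> : contract_rel e v w x y by rewrite /contract_rel /= exy.
    rewrite xV' yV' /=; move: xV' yV' xyX; rewrite !inE => /andP [-> ->] /andP [-> ->].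
    by rewrite !andbT.
  - have [yw newy nX] := nwN y yN'; have yV' := inV' y yN'.
    have -> : contract_rel e v w w y by rewrite /contract_rel /= eqxx (evN y) // yw orbT.
    rewrite wV' yV' /=.
    by rewrite !inD // -negb_and.
  - have [xw newx nX] := nwN x xN'; have xV' := inV' x xN'.
    have -> : contract_rel e v w x w by rewrite /contract_rel /= eqxx (evN x) // xw !orbT.
    rewrite wV' xV' /=.
    by rewrite !inD // -negb_and andbC.
apply: leq_trans le_rho _; rewrite cardN; move: le_rho'.
move: #|R| #|c| #|N'| (rho _ _ _) => n1 n2 n3 n4; clear; lia.
Qed.

Lemma delete_isolated v : v \in V :\: X -> nbrs e V v = set0 -> linked e V X.
Proof.
rewrite inE => /andP [nvX vV] iso; have [sXV M1 M2] := mX.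
have nev x : x \in V -> e v x = false.
  by move=> xV; apply/negP => evx; have := in_set0 x; rewrite -iso inE xV evx.
have ltV1 : #|V :\ v| < #|V| by rewrite [X in _ < X](cardsD1 v) vV.
have sXV1 : X \subset V :\ v.
  by apply/subsetP => x xX; rewrite !inE (subsetP sXV) // andbT; apply: contraNneq nvX => <-.
apply: (@linked_widen _ e (V :\ v)); first exact: subsetDl.
apply: IH => //; split=> //.
  have le1 : 2 * lam * #|V :\ v :\: X| <= 2 * lam * #|V :\: X|.
    by rewrite leq_mul2l; apply/orP; right; apply: subset_leq_card; apply: setSD; apply: subsetDl.
  apply: leq_ltn_trans le1 (leq_trans M1 _).
  apply: rho_leq => x y xV yV exy; rewrite !inE exy xV yV !andbT.
  have -> : x != v by apply: contraTneq exy => ->; rewrite nev.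
  have -> : y != v by apply: contraTneq exy => ->; rewrite sym_e nev.
  by rewrite /= !andbT.
move=> A B [defV1 sep] sXA ltS.
have nvA : v \notin A by apply/negP => vA; have := setU11 v A; rewrite -[v |: A]setUid; have := in_setU v A B; rewrite defV1 vA !inE eqxx.
have nvB : v \notin B by apply/negP => vB; have := in_setU v A B; rewrite defV1 vB !inE eqxx orbT.
have defV : v |: A :|: B = V by rewrite -setUA defV1 setD1K.
have sep2 : separation V e (v |: A) B.
  split=> // x y; rewrite !inE negb_or => /andP [nxB /predU1P [-> | xA]] /andP [/andP [yv nyA] yB].
    by rewrite nev // -defV !inE yB orbT.
  by apply: sep; rewrite inE ?nxB ?nyA.
have defD : B :\: (v |: A) = B :\: A.
  apply/setP => x; rewrite !inE negb_or; case: (boolP (x \in B)) => xB; rewrite ?andbF // !andbT.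
  by rewrite (contraNneq _ nvB) // => <-.
have defI : (v |: A) :&: B = A :&: B.
  apply/setP => x; rewrite !inE; case: (boolP (x \in B)) => xB; rewrite ?andbF // !andbT.
  by rewrite (negbTE (contraNneq _ nvB : x != v)) // => <-.
have := M2 _ _ sep2 (subset_trans sXA (subsetUr _ _)); rewrite defI defD => /(_ ltS).
apply: leq_trans; apply: rho_leq => x y xV yV -> ->.
by rewrite !(subsetP (subsetDl V [set v])).
Qed.

(** If [X] is not linked, contracting any edge at [v] must destroy density, so each neighbour of [v]
    shares many neighbours with it, pairs inside [X] counting as adjacent. The closed neighbourhood
    of [v] then contains a linked core, and a smallest cut between [X] and the core is rigid. *)
Lemma massed_linked_step : linked e V X.
Proof.
have [sXV M1 M2] := mX.
have N0 : 0 < #|V :\: X|.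
  rewrite lt0n; apply: contraTneq M1 => N0; rewrite N0 muln0 -leqNgt leqn0 cards_eq0.
  have -> : V :\: X = set0 by apply/eqP; rewrite -cards_eq0 N0.
  by apply/eqP/setP => -[x y]; rewrite !inE !andbF.
set N := #|V :\: X| in M1 N0 *.
have [v [vVX minv]] : exists v, v \in V :\: X /\
    forall u, u \in V :\: X -> #|nbrs e V v| <= #|nbrs e V u|.
  by apply: exists_min; apply/set0Pn; rewrite -card_gt0.
have [nvX vV] : v \notin X /\ v \in V by move: vVX; rewrite inE => /andP.
have [iso | ] := eqVneq (nbrs e V v) set0; first exact: delete_isolated vVX iso.
case/set0Pn=> w0 w0N.
have degN : #|nbrs e V v| * N <= rho e V (V :\: X).
  have -> : #|nbrs e V v| * N = \sum_(u in V :\: X) #|nbrs e V v| by rewrite sum_nat_const mulnC.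
  apply: leq_trans (_ : \sum_(u in V :\: X) #|nbrs e V u| <= _); first exact: leq_sum.
  under eq_bigr do rewrite -sum1_card.
  rewrite pair_big_dep /= sum1_card; apply/subset_leq_card/subsetP => -[x y].
  rewrite unfold_in /= !inE => /andP [/andP [nxX xV] /andP [yV exy]].
  by rewrite exy xV yV nxX.
have cN w : w \in nbrs e V v -> ~ linked e V X ->
    rho e V (V :\: X) <= 2 * lam * (N - 1) +
      2 * #|[set y in nbrs e V v | (y != w) && (e w y || (w \in X) && (y \in X))]|.+1.
  rewrite inE => /andP [wV evw] nl; apply: leq_trans (rho_contract vVX wV evw) _.
  rewrite leq_add2r; have [// | ] := contraction_step vVX wV evw.
  have -> : #|(V :\ v) :\: X| = N - 1; last by [].
  rewrite /N (cardsD1 v (V :\: X)) vVX add1n subn1 /=.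
  by apply: eq_card => x; rewrite !inE; case: (x == v); rewrite /= ?andbF.
apply: contrapT => nl; apply: nl; apply: contrapT => nl.
(* A contraction at [v] leaves at most [2 * lam * (N - 1)], so it loses at least the difference; it
   is halved because [rho] counts edges twice. *)
pose d := uphalf (rho e V (V :\: X) - 2 * lam * (N - 1)).
have le_d w : w \in nbrs e V v ->
    d <= #|[set y in nbrs e V v | (y != w) && (e w y || (w \in X) && (y \in X))]|.+1.
  move=> /cN /(_ nl); rewrite /d; move: #|[set y in _ | _]| (rho _ _ _) (2 * lam * (N - 1)) => n1 n2 n3.
  by clear; lia.
have lam_d : lam < d.
  rewrite /d; have : 2 * lam * N = 2 * lam * (N - 1) + 2 * lam by rewrite -{1}(subnK N0) mulnDr muln1.
  by move: M1; move: (rho _ _ _) (2 * lam * (N - 1)) (2 * lam * N) => n1 n2 n3; clear; lia.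
(* The minimum degree is at most the average, which [degN] expresses; this gives the upper bound on
   [#|D|] that [linked_core] requires. *)
have deg_d : #|nbrs e V v| <= 2 * d.
  rewrite leqNgt; apply/negP => lt_deg; move: degN; rewrite leqNgt => /negP; apply.
  apply: leq_trans (_ : (rho e V (V :\: X) - 2 * lam * N + 2 * lam).+1 * N <= _); last first.
    rewrite leq_mul2r; apply/orP; right; apply: leq_trans lt_deg; rewrite ltnS /d.
    have : 2 * lam * N = 2 * lam * (N - 1) + 2 * lam by rewrite -{1}(subnK N0) mulnDr muln1.
    by move: M1; move: (rho _ _ _) (2 * lam * (N - 1)) (2 * lam * N) => n1 n2 n3; clear; lia.
  rewrite mulSn mulnDl addnA; apply: leq_trans (_ : N + (rho e V (V :\: X) - 2 * lam * N) + 2 * lam * N <= _).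
    by move: M1 N0; move: (rho _ _ _) (2 * lam * N) => n1 n2; clear; lia.
  by rewrite leq_add2r leq_add2l leq_pmulr.
set D := v |: nbrs e V v.
have nvN : v \notin nbrs e V v by rewrite inE irr_e andbF.
have cardD : #|D| = #|nbrs e V v|.+1 by rewrite cardsU1 nvN.
have sDV : D \subset V.
  by apply/subsetP => x; rewrite !inE => /predU1P [-> // | /andP []].
have deg_v : d <= #|nbrs e V v|.
  apply: leq_trans (le_d w0 w0N) _; rewrite (cardsD1 w0 (nbrs e V v)) w0N add1n ltnS.
  by apply/subset_leq_card/subsetP => y; rewrite !inE => /andP [-> /andP [->]].
have [||u uDX|x xDX|C [sCD leC lC]] := @linked_core _ e sym_e irr_e D X t d lt1t.
- by apply: leq_trans le_lam _; apply: ltnW.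
- by rewrite cardD ltnS deg_v addn1 ltnS.
- have [nuX uD] : u \notin X /\ u \in D by move: uDX; rewrite inE => /andP.
  have [eqv | uv] := eqVneq u v.
    rewrite eqv; apply: leq_trans deg_v _; apply/subset_leq_card/subsetP => y yN.
    by move: (yN); rewrite !inE => /andP [yV ->]; rewrite yV orbT.
  have uN : u \in nbrs e V v by move: uD; rewrite in_setU1 (negbTE uv).
  apply: leq_trans (le_d u uN) _; rewrite -add1n.
  set c := [set y in _ | _]; have -> : 1 + #|c| = #|v |: c| by rewrite cardsU1 !inE irr_e !andbF.
  apply/subset_leq_card/subsetP => y; rewrite in_setU1 [y \in c]inE (negbTE nuX) /= orbF.
  rewrite [y \in nbrs e D u]inE => /predU1P [-> | /and3P [yN _ ->]]; last by rewrite /D in_setU1 yN orbT.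
  by rewrite setU11 /=; move: uN; rewrite inE sym_e => /andP [].
- have [xD xX] : x \in D /\ x \in X by move: xDX; rewrite inE => /andP.
  have xv : x != v by apply: contraNneq nvX => <-.
  have xN : x \in nbrs e V v by move: xD; rewrite in_setU1 (negbTE xv).
  apply: leq_ltn_trans (le_d x xN) _.
  set c := [set y in _ | _]; have -> : #|c|.+1 = #|v |: c| by rewrite cardsU1 !inE irr_e !andbF.
  apply: leq_trans (_ : #|x |: (v |: c)| <= _).
    by rewrite [X in _ < X]cardsU1 !inE (negbTE xv) eqxx !andbF.
  apply/subset_leq_card/subsetP => y; rewrite !in_setU1 in_setU in_setI.
  case/or3P=> [/eqP -> | /eqP -> | ]; first by rewrite xD xX orbT.
    by rewrite [v \in nbrs _ _ _]inE setU11 /=; move: xN; rewrite inE sym_e => /andP [_ ->].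
  rewrite inE xX /= => /and3P [yN _ /orP [exy | ->]]; last by rewrite /D in_setU1 yN !orbT.
  by rewrite [y \in nbrs e D x]inE /D in_setU1 yN orbT exy.
have [A [B [[sepAB sXA sCB leS] [_ [f [E [EP disE]]]]]]] :=
  min_separation sym_e sXV (subset_trans sCD sDV).
apply: nl; apply: (rigid sepAB sXA leS).
  apply: (linked_extend sym_e sCB EP disE); apply: lC.
  - by apply/subsetP => _ /imsetP [y yS ->]; have [] := EP y yS.
  (* A vertex of [X] in the core lies in the separator and is its own image under [f]. *)
  - apply/subsetP => x; rewrite inE => /andP [xX xC].
    have xS : x \in A :&: B by rewrite inE (subsetP sXA) ?(subsetP sCB).
    apply/imsetP; exists x => //; have [_ /and3P [xE _ _] _ /setP /(_ x)] := EP x xS.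
    by rewrite !inE xE xC => /esym /eqP.
  - by apply: leq_trans (leq_imset_card _ _) (leq_trans leS leX).
(* The core has more than [2 * t] vertices, too many to lie inside the separator. *)
apply: contraTneq leC => BA0; rewrite -leqNgt; apply: leq_trans (leq_trans leS leX).
apply: subset_leq_card; rewrite subsetI sCB andbT; apply: subset_trans sCB _.
by rewrite -setD_eq0 BA0.
Qed.
End Step.

Theorem massed_linked e V X : symmetric e -> irreflexive e -> #|X| <= 2 * t ->
  massed lam e V X -> linked e V X.
Proof.
have [n] := ubnP #|V|; elim: n e V X => // n IHn e V X le_n sym_e irr_e leX mX.
apply: massed_linked_step => // e' V' X' sym' irr' lt' leX' mX'.
by apply: IHn => //; apply: leq_trans lt' _; rewrite -ltnS.
Qed.
End Massed.

(** * A dense bipartite subgraph *)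

Section Degrees.
Variables (T : finType) (e : rel T).
Hypotheses (sym_e : symmetric e) (irr_e : irreflexive e).

Lemma connected_minus_closed (X A : {set T}) a : connected_minus e X -> a \in A -> a \notin X ->
  (forall x y, x \in A -> x \notin X -> y \notin X -> e x y -> y \in A) ->
  forall v, v \notin X -> v \in A.
Proof.
move=> conn aA naX cl v nvX; have /connectP [p pth ->] := conn a v naX nvX.
elim: p a aA naX pth => [|z p IHp] a aA naX //= /andP [/and3P [eaz _ nzX] pth].
by apply: IHp pth => //; apply: cl eaz.
Qed.

Lemma k_connected_degree m v : k_connected e m -> m <= #|nbrs e setT v|.
Proof.
move=> [ltT conn]; rewrite leqNgt; apply/negP => ltN.
have nvN : v \notin nbrs e setT v by rewrite inE irr_e andbF.
have all1 u : u \notin nbrs e setT v -> u \in [set v].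
  apply: (connected_minus_closed (conn _ ltN) (set11 v) nvN) => x y.
  by rewrite !inE => /eqP -> _ /= /negP.
have : #|[set: T]| <= #|v |: nbrs e setT v|.
  apply/subset_leq_card/subsetP => u _; rewrite in_setU1.
  by case: (boolP (u \in nbrs e setT v)) => [|/all1]; rewrite ?orbT // inE => ->.
by rewrite cardsT cardsU1 nvN; move: ltT ltN; clear; lia.
Qed.

Lemma rho_sum (V X : {set T}) : X \subset V -> \sum_(u in X) #|nbrs e V u| <= rho e V X.
Proof.
move=> sXV; under eq_bigr do rewrite -sum1_card.
rewrite pair_big_dep /= sum1_card; apply/subset_leq_card/subsetP => -[x y].
rewrite unfold_in /= !inE => /andP [xX /andP [yV exy]].
by rewrite exy yV xX (subsetP sXV).
Qed.

(** The pair is massed with [lam = 12k]: degrees in [B] are at least [50k - 9k = 41k > 2 * lam], and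
    a separation of order below [4k], together with the at most [9k] vertices outside [B], would
    disconnect the graph with fewer than [50k] vertices. *)
Lemma linked_of_connected k (B X : {set T}) : 0 < k -> k_connected e (50 * k) ->
  #|~: B| <= 9 * k -> X \subset B -> #|X| = 4 * k -> linked e B X.
Proof.
move=> k0 conn leB sXB cardX; have [ltT _] := conn.
apply: (@massed_linked _ (12 * k) (2 * k)) => //; first by lia.
  by rewrite mulnA.
  by rewrite cardX mulnA.
have cardB : #|T| <= #|B| + 9 * k by rewrite -(cardsC B) leq_add2l.
have degB v : 41 * k <= #|nbrs e B v|.
  have := k_connected_degree v conn; have : #|nbrs e setT v| <= #|nbrs e B v| + #|~: B|.
    apply: leq_trans _ (leq_card_setU _ _).
    by apply/subset_leq_card/subsetP => u; rewrite !inE => /= ->; rewrite andbT orbN.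
  by move: leB; clear; lia.
split=> //.
  apply: leq_trans _ (rho_sum (subsetDl _ _)).
  have BX0 : 0 < #|B :\: X|.
    by rewrite cardsD (setIidPr sXB) cardX; move: ltT cardB; clear -k0; lia.
  apply: leq_trans (_ : \sum_(u in B :\: X) 41 * k <= _); last exact: leq_sum.
  rewrite sum_nat_const; move: BX0; move: #|B :\: X| => n n0.
  by rewrite mulnC ltn_mul2l n0 /=; clear -k0; lia.
move=> A C [defB sep] sXA ltS.
have [CA0 | /set0Pn [c cCA]] := eqVneq (C :\: A) set0.
  rewrite CA0 cards0 muln0 leqn0 cards_eq0; apply/eqP/setP => -[x y].
  by rewrite !inE !andbF.
have ltW : #|A :&: C :|: ~: B| < 50 * k.
  apply: leq_ltn_trans (leq_card_setU _ _) _; move: ltS leB; rewrite cardX; clear -k0; lia.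
have [x xX nxC] : exists2 x, x \in X & x \notin C.
  apply/subsetPn; apply: contraTN ltS => sXC; rewrite -leqNgt.
  by apply: subset_leq_card; rewrite subsetI sXA.
have xA := subsetP sXA x xX.
have cA : c \in A :\: C.
  move: cCA; rewrite inE => /andP [ncA cC].
  apply: (connected_minus_closed (a := x) (proj2 conn _ ltW)).
  - by rewrite inE nxC.
  - by rewrite !inE (negbTE nxC) (subsetP sXB) // andbF.
  - move=> y z yAC _; rewrite !inE negb_or negbK => /andP [nzAC zB] eyz; apply: contrapT => nz.
    have : z \in C :\: A.
      rewrite inE; move: zB nzAC nz; rewrite -defB inE.
      by case: (z \in A); case: (z \in C).
    by move/(sep y z yAC); rewrite eyz.
  - by rewrite !inE (negbTE ncA) /= negbK -defB inE cC orbT.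
by move: cA cCA; rewrite !inE => /andP [_ ->].
Qed.
End Degrees.

Definition bip (T : finType) (e : rel T) (col : T -> bool) : rel T :=
  [rel x y | e x y && (col x != col y)].

Section DenseBipartite.
Variables (T : finType) (e : rel T) (V : {set T}) (k : nat).
Hypotheses (sym_e : symmetric e) (irr_e : irreflexive e) (k0 : 0 < k).
Hypothesis degV : forall v, v \in V -> 49 * k <= #|nbrs e V v|.
Hypothesis V0 : V != set0.

Lemma bip_sym col : symmetric (bip e col).
Proof. by move=> x y; rewrite /bip /= sym_e eq_sym. Qed.

Lemma bip_irr col : irreflexive (bip e col).
Proof. by move=> x; rewrite /bip /= irr_e. Qed.

(** In a colouring with the most bichromatic edges, recolouring [v] gains nothing, so at least half
    of its neighbours have the other colour. *)
Lemma max_cut : exists col, forall v, v \in V -> 49 * k <= 2 * #|nbrs (bip e col) V v|.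
Proof.
have [||col [_ maxc]] := @exists_max (T -> bool) (fun=> True) (fun col => rho (bip e col) V V) #|{: T * T}|.
- by exists (fun=> true).
- by move=> col _; rewrite /rho; apply: max_card.
exists col => v vV; set P := nbrs (bip e col) V v.
pose Q := [set u in V | e v u && (col v == col u)].
have PQ : 49 * k <= #|P| + #|Q|.
  apply: leq_trans (degV vV) _; apply: leq_trans _ (leq_card_setU _ _).
  apply/subset_leq_card/subsetP => u; rewrite !inE /bip /= => /andP [-> ->] /=.
  by case: (col v == col u).
suff : #|Q| <= #|P| by move: PQ; clear; lia.
pose col' u := if u == v then ~~ col v else col u.
pose R := [set z : T * T | [&& bip e col z.1 z.2, z.1 \in V, z.2 \in V & (z.1 != v) && (z.2 != v)]].
have leR : rho (bip e col) V V <= #|R| + 2 * #|P|.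
  have -> : 2 * #|P| = #|setX [set v] P| + #|setX P [set v]| by rewrite !cardsX cards1; clear; lia.
  rewrite addnA; apply: leq_trans (_ : #|R :|: setX [set v] P :|: setX P [set v]| <= _); last first.
    by apply: leq_trans (leq_card_setU _ _) _; rewrite leq_add2r; apply: leq_card_setU.
  apply/subset_leq_card/subsetP => -[x y]; rewrite !(in_setU, in_setX, in_set1, in_set) /=.
  move=> /and4P [exy xV yV _]; rewrite exy xV yV; have [eqx | xv] /= := eqVneq x v; first by rewrite -eqx exy ?orbT.
  have [eqy | yv] /= := eqVneq y v; last by [].
  by rewrite -eqy bip_sym exy ?orbT.
have leR' : #|R| + 2 * #|Q| <= rho (bip e col') V V.
  have -> : 2 * #|Q| = #|setX [set v] Q| + #|setX Q [set v]| by rewrite !cardsX cards1; clear; lia.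
  have nvQ y : y \in Q -> [/\ y != v, y \in V, e v y & col v = col y].
    rewrite inE => /andP [yV /andP [evy /eqP cy]]; split=> //.
    by apply: contraTneq evy => ->; rewrite irr_e.
  rewrite addnA -card_setU_disjoint; last first.
    apply/setP => -[x y]; rewrite in_set0 in_setI in_setX in_set1 in_set /=; apply/negP.
    by move=> /and3P [/and4P [_ _ _ /andP [nx _]] /eqP eqx _]; rewrite eqx eqxx in nx.
  rewrite -card_setU_disjoint; last first.
    apply/setP => -[x y]; rewrite in_set0 in_setI in_setU !in_setX !in_set1 in_set /=; apply/negP.
    case/and3P=> H xQ /eqP eqy; rewrite eqy in H; case/orP: H => [/and4P [_ _ _ /andP [_]] | /andP [_ /nvQ []]].
      by rewrite eqxx.
    by rewrite eqxx.
  apply/subset_leq_card/subsetP => -[x y]; rewrite !in_setU !in_setX !in_set1 !(in_set (_ : pred (T * T))) /=.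
  case/orP=> [/orP [/and4P [exy -> -> /andP [nx ny]] | /andP [/eqP -> /nvQ [yv yV evy cy]]] | /andP [/nvQ [xv xV evx cx] /eqP ->]].
  - by move: exy; rewrite /bip /col' /= (negbTE nx) (negbTE ny) => ->.
  - by rewrite yV vV /bip /col' /= eqxx (negbTE yv) evy -cy; case: (col v).
  - by rewrite xV vV /bip /col' /= eqxx (negbTE xv) sym_e evx -cx; case: (col v).
have := maxc col' I; move: leR leR'; move: (rho (bip e col) V V) (rho (bip e col') V V) #|R| => n1 n2 n3.
by clear; lia.
Qed.

(** Mader's argument: a smallest set [U] spanning more than [(49k / 4) * (#|U| + 1 - 4k)] edges has
    large degrees and no proper separation of order below [4k]. *)
Lemma dense_bipartite : exists (col : T -> bool) (K : {set T}),
  [/\ K \subset V, 8 * k < #|K| &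
   forall X : {set T}, X \subset K -> #|X| = 4 * k -> linked (bip e col) K X].
Proof.
have [col degc] := max_cut; exists col; set f := bip e col in degc *.
have sym_f : symmetric f by apply: bip_sym.
have irr_f : irreflexive f by apply: bip_irr.
(* [rho f U U] is twice the number of edges, and [196 k^2 = 49k * 4k]: with this offset, adding the
   failed inequalities for both sides of a separation forces [#|A :&: B| >= 4k]. *)
pose dense (U : {set T}) := [/\ U \subset V, 8 * k <= #|U| & 49 * k * (#|U| + 1) < 2 * rho f U U + 196 * (k * k)].
have denseV : dense V.
  have leV : 8 * k <= #|V|.
    have [v vV] := set0Pn _ V0; have := degV vV; have : #|nbrs e V v| <= #|V|.
      by apply/subset_leq_card/subsetP => u; rewrite inE => /andP [].
    by clear; lia.
  split=> //; have := rho_sum f (subxx V) => le_rho.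
  have : 49 * k * #|V| <= 2 * rho f V V.
    apply: leq_trans (_ : 2 * \sum_(u in V) #|nbrs f V u| <= _); last by rewrite leq_mul2l le_rho orbT.
    rewrite big_distrr /= mulnC -sum_nat_const; apply: leq_sum => u uV; exact: degc.
  by rewrite mulnDr muln1; clear -k0; nia.
have [K [[sKV leK denseK] minK]] := exists_min (fun U : {set T} => #|U|) (ex_intro dense V denseV).
have degK v : v \in K -> 49 * k < 4 * #|nbrs f K v|.
  move=> vK; have leR : rho f K K <= rho f (K :\ v) (K :\ v) + 2 * #|nbrs f K v|.
    have -> : 2 * #|nbrs f K v| = #|setX [set v] (nbrs f K v)| + #|setX (nbrs f K v) [set v]|.
      by rewrite !cardsX cards1; clear; lia.
    apply: leq_trans (_ : #|[set z : T * T | [&& f z.1 z.2, z.1 \in K :\ v, z.2 \in K :\ v & (z.1 \in K :\ v) || (z.2 \in K :\ v)]]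
        :|: setX [set v] (nbrs f K v) :|: setX (nbrs f K v) [set v]| <= _); last first.
      rewrite addnA; apply: leq_trans (leq_card_setU _ _) _; rewrite leq_add2r; exact: leq_card_setU.
    apply/subset_leq_card/subsetP => -[x y]; rewrite !(in_setU, in_setX, in_setD1, in_set1, in_set) /=.
    move=> /and4P [fxy xK yK _]; rewrite fxy xK yK; have [eqx | xv] /= := eqVneq x v; first by rewrite -eqx fxy ?orbT.
    have [eqy | yv] /= := eqVneq y v; last by [].
    by rewrite -eqy sym_f fxy ?orbT.
  have cardK : #|K| = #|K :\ v|.+1 by rewrite (cardsD1 v) vK.
  have [le8 | lt8] := leqP (8 * k) #|K :\ v|.
    have : 2 * rho f (K :\ v) (K :\ v) + 196 * (k * k) <= 49 * k * (#|K :\ v| + 1).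
      rewrite leqNgt; apply/negP => dense'.
      have : #|K| <= #|K :\ v|.
        by apply: minK; split=> //; apply: subset_trans sKV; apply: subsetDl.
      by rewrite cardK ltnn.
    move: denseK leR; rewrite cardK !mulnDr !muln1 mulnS.
    by move: (rho f K K) (rho f (K :\ v) _) #|nbrs f K v| (k * k) #|K :\ v| => n1 n2 n3 n4 n5; clear; lia.
  have le_sq : rho f K K <= #|K| * #|K|.
    rewrite -cardsX; apply/subset_leq_card/subsetP => -[x y].
    by rewrite in_setX in_set /= => /and4P [_ -> ->].
  have eqK : #|K| = 8 * k by move: lt8 leK cardK; clear; lia.
  by move: denseK le_sq; rewrite eqK; clear -k0; nia.
have deg12 v : v \in K -> 12 * k < #|nbrs f K v| by move/degK; clear; lia.
have connK A B : separation K f A B -> A :\: B != set0 -> B :\: A != set0 -> 4 * k <= #|A :&: B|.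
  move=> [defK sep] /set0Pn [x xAB] /set0Pn [y yBA].
  have sAK : A \subset K by rewrite -defK subsetUl.
  have sBK : B \subset K by rewrite -defK subsetUr.
  have [[nxB xA] [nyA yB]] : (x \notin B /\ x \in A) /\ (y \notin A /\ y \in B).
    by move: xAB yBA; rewrite !inE => /andP ? /andP.
  have sNA : nbrs f K x \subset A.
    apply/subsetP => z; rewrite inE => /andP [zK fxz]; apply: contrapT => /negP nzA.
    have zB : z \in B by move: zK; rewrite -defK inE (negbTE nzA).
    by have := sep x z xAB; rewrite inE nzA zB fxz => /(_ isT).
  have sNB : nbrs f K y \subset B.
    apply/subsetP => z; rewrite inE => /andP [zK fyz]; apply: contrapT => /negP nzB.
    have zA : z \in A by move: zK; rewrite -defK inE (negbTE nzB) orbF.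
    by have := sep z y; rewrite inE nzB zA sym_f fyz => /(_ isT yBA).
  have small (C : {set T}) z w : C \subset K -> z \in K -> z \notin C -> w \in K -> nbrs f K w \subset C ->
      2 * rho f C C + 196 * (k * k) <= 49 * k * (#|C| + 1).
    move=> sCK zK nzC wK sNC; rewrite leqNgt; apply/negP => denseC.
    have : #|K| <= #|C|.
      apply: minK; split=> //; first exact: subset_trans sCK sKV.
      by have := deg12 w wK; have := subset_leq_card sNC; clear; lia.
    rewrite leqNgt => /negP; apply; apply: proper_card; apply/properP; split=> //.
    by exists z.
  have dA := small A y x sAK (subsetP sBK y yB) nyA (subsetP sAK x xA) sNA.
  have dB := small B x y sBK (subsetP sAK x xA) nxB (subsetP sBK y yB) sNB.
  have leR : rho f K K <= rho f A A + rho f B B.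
    apply: leq_trans _ (leq_card_setU _ _); apply/subset_leq_card/subsetP => -[u v].
    rewrite !in_setU !in_set /= => /and4P [fuv uK vK _]; rewrite fuv /=.
    move: uK vK (sep u v) (sep v u); rewrite -defK !inE [f v u]sym_f fuv.
    case: (u \in A); case: (u \in B); case: (v \in A); case: (v \in B) => //= _ _ H1 H2;
      by [have := H1 isT isT | have := H2 isT isT].
  have cardK : #|K| + #|A :&: B| = #|A| + #|B| by rewrite -defK cardsUI.
  move: denseK leR dA dB cardK; rewrite !mulnDr !muln1.
  move: (rho f K K) (rho f A A) (rho f B B) #|K| #|A| #|B| #|A :&: B| => n1 n2 n3 n4 n5 n6 n7.
  by clear -k0; nia.
(* Adjacent vertices have disjoint neighbourhoods in a bipartite graph, each with more than
   [49k / 4] elements. *)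
have cardK : 49 * k < 2 * #|K|.
  have [v vK] : exists v, v \in K by apply/set0Pn; rewrite -card_gt0; move: leK; clear -k0; lia.
  have /card_gt0P [u] : 0 < #|nbrs f K v| by have := deg12 v vK; clear; lia.
  rewrite inE => /andP [uK fvu]; have := degK v vK; have := degK u uK.
  have : #|nbrs f K v| + #|nbrs f K u| <= #|K|.
    rewrite -card_setU_disjoint; last first.
      apply/setP => w; rewrite !inE; apply/negP => /andP [/andP [_ fvw] /andP [_ fuw]].
      move: fvu fvw fuw; rewrite /f /bip /= => /andP [_ c1] /andP [_ c2] /andP [_ c3].
      by move: c1 c2 c3; case: (col v); case: (col u); case: (col w).
    by apply/subset_leq_card/subsetP => w; rewrite !inE => /orP [] /andP [].
  by clear; lia.
exists K; split=> //; first by move: cardK; clear -k0; lia.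
move=> X sXK cardX; apply: (@massed_linked _ (12 * k) (2 * k)) => //; first by move: k0; clear; lia.
- by rewrite mulnA.
- by rewrite cardX mulnA.
split=> //; last first.
  move=> A B sepAB sXA ltS; have [BA0 | BA0] := eqVneq (B :\: A) set0.
    rewrite BA0 cards0 muln0 leqn0 cards_eq0; apply/eqP/setP => -[x y].
    by rewrite !inE !andbF.
  have : 4 * k <= #|A :&: B|.
    apply: connK => //; apply: contraTneq ltS => AB0; rewrite -leqNgt; apply: subset_leq_card.
    by rewrite subsetI sXA; apply: subset_trans sXA _; rewrite -setD_eq0 AB0.
  by rewrite leqNgt -cardX ltS.
have leR : rho f K K <= rho f K (K :\: X) + rho f X X.
  apply: leq_trans _ (leq_card_setU _ _); apply/subset_leq_card/subsetP => -[u v].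
  rewrite !in_setU !in_set /= => /and4P [-> uK vK _]; rewrite uK vK !andbT /=.
  by case: (u \in X); case: (v \in X).
(* Being bipartite, [X] spans at most [4k^2] edges; [2 * #|K| > 49 * k] makes up for them. *)
have leX : rho f X X <= 8 * (k * k).
  pose P := [set x in X | col x]; pose Q := [set x in X | ~~ col x].
  have cardPQ : #|P| + #|Q| = 4 * k.
    rewrite -cardX -card_setU_disjoint; first by apply: eq_card => x; rewrite !inE; case: (x \in X); case: (col x).
    by apply/setP => x; rewrite !inE; case: (col x); rewrite ?andbF.
  have : rho f X X <= #|P| * #|Q| + #|Q| * #|P|.
    rewrite -!cardsX; apply: leq_trans _ (leq_card_setU _ _); apply/subset_leq_card/subsetP => -[u v].
    rewrite !in_setU !in_setX !in_set /= => /and4P [fuv -> -> _]; move: fuv; rewrite /f /bip /= => /andP [_].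
    by case: (col u); case: (col v).
  move: cardPQ; move: #|P| #|Q| (rho f X X) => p q r pq le_r.
  have [+ _] := nat_AGM2 p q; rewrite pq expnMn -mulnn => agm; apply: leq_trans le_r _.
  by rewrite [q * p]mulnC -mulnn in agm *; move: agm; move: (p * q) (k * k) => m n; clear; lia.
have -> : #|K :\: X| = #|K| - 4 * k by rewrite cardsD (setIidPr sXK) cardX.
move: denseK leR leX cardK; move: (rho f K K) (rho f K _) (rho f X X) #|K| => n1 n2 n3 n4.
by clear -k0; nia.
Qed.
End DenseBipartite.

(** * The Tutte-Berge formula *)

Section Matching.
Variables (W : finType) (g : rel W).
Hypotheses (sym_g : symmetric g) (irr_g : irreflexive g).
Implicit Types (V U : {set W}) (mu nu : W -> W).

(* A matching is an involution; the unmatched vertices are its fixed points. *)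
Definition matching V mu :=
  involutive mu /\ forall x, mu x != x -> [/\ x \in V, mu x \in V & g x (mu x)].

Definition moved mu := [set x | mu x != x].

Definition maximum_matching V mu :=
  matching V mu /\ forall nu, matching V nu -> #|moved nu| <= #|moved mu|.

Lemma involution_half (S : {set W}) mu :
  (forall x, x \in S -> [/\ mu x \in S, mu x != x & mu (mu x) = x]) ->
  exists L : {set W}, [/\ L \subset S, #|S| = 2 * #|L| & forall x, x \in L -> mu x \notin L].
Proof.
move=> muS; pose L := [set x in S | enum_rank x < enum_rank (mu x)].
have defS : S = L :|: mu @: L.
  apply/setP => x; rewrite !inE; apply/idP/orP => [xS | [/andP [-> //] | /imsetP [y]]]; last first.
    by rewrite inE => /andP [yS _] ->; have [] := muS y yS.
  have [mS mx mmx] := muS x xS; have : enum_rank x != enum_rank (mu x).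
    by rewrite (inj_eq enum_rank_inj) eq_sym.
  rewrite -val_eqE /= neq_ltn => /orP [lt | lt]; [left | right]; first by rewrite xS lt.
  by apply/imsetP; exists (mu x); rewrite ?mmx // inE mS mmx.
have notL x : x \in L -> mu x \notin L.
  by rewrite !inE => /andP [xS lt]; have [_ _ ->] := muS x xS; rewrite [_ < enum_rank x]ltnNge (ltnW lt) andbF.
have disj : L :&: mu @: L = set0.
  apply/setP => x; rewrite in_set0 in_setI; apply/andP => -[xL /imsetP [y yL defx]].
  by have := notL y yL; rewrite -defx xL.
exists L; split=> //; first by apply/subsetP => x; rewrite inE => /andP [].
rewrite defS cardsU disj cards0 subn0 card_in_imset ?addnn ?mul2n //.
move=> x y; rewrite !inE => /andP [xS _] /andP [yS _] eqm.
by have [_ _ <-] := muS x xS; have [_ _ <-] := muS y yS; rewrite eqm.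
Qed.

Lemma even_card_involution (S : {set W}) mu :
  involutive mu -> (forall x, x \in S -> mu x \in S /\ mu x != x) -> ~~ odd #|S|.
Proof.
move=> inv muS; have [|L [_ -> _]] := @involution_half S mu; last by rewrite mul2n odd_double.
by move=> x /muS [].
Qed.

Lemma maximum_matching_exists V : exists mu, maximum_matching V mu.
Proof.
have [||mu [mP mmax]] := @exists_max (W -> W) (matching V) (fun mu => #|moved mu|) #|W|.
- by exists id; split=> // x; rewrite eqxx.
- by move=> mu _; apply: max_card.
- by exists mu.
Qed.

Definition add_edge mu x y := fun z => if z == x then y else if z == y then x else mu z.

Lemma matching_add_edge V mu x y : matching V mu -> x \in V -> y \in V -> g x y ->
  mu x = x -> mu y = y -> matching V (add_edge mu x y) /\ #|moved mu| < #|moved (add_edge mu x y)|.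
Proof.
move=> [inv mP] xV yV gxy mx my; have xy : x != y by apply: contraTneq gxy => ->; rewrite irr_g.
have nx z : z != x -> mu z != x by apply: contra_neq => mz; rewrite -[z]inv mz mx.
have ny z : z != y -> mu z != y by apply: contra_neq => mz; rewrite -[z]inv mz my.
split; first split.
- move=> z; rewrite /add_edge; have [-> | zx] := eqVneq z x; first by rewrite eq_sym (negbTE xy) eqxx.
  have [-> | zy] := eqVneq z y; first by rewrite eqxx.
  by rewrite (negbTE (nx z zx)) (negbTE (ny z zy)) inv.
- move=> z; rewrite /add_edge; have [-> | zx] := eqVneq z x; first by [].
  have [-> | zy] := eqVneq z y; first by rewrite sym_g.
  exact: mP.
apply: proper_card; apply/properP; split.
  apply/subsetP => z; rewrite !inE /add_edge => mz.
  have [zx | zx] := eqVneq z x; first by rewrite zx mx eqxx in mz.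
  by have [zy | //] := eqVneq z y; rewrite zy my eqxx in mz.
by exists x; rewrite !inE /add_edge ?mx eqxx // eq_sym.
Qed.

Lemma maximum_moved V mu nu : maximum_matching V mu -> maximum_matching V nu -> #|moved mu| = #|moved nu|.
Proof. by move=> [mP mmax] [nP nmax]; apply/eqP; rewrite eqn_leq nmax ?mmax. Qed.

(* Gallai's lemma: being missed by no common maximum matching is transitive on vertices. *)
Lemma gallai V u t v : (forall w, w \in V -> exists nu, maximum_matching V nu /\ nu w = w) ->
  u \in V -> t \in V -> v \in V -> u != v -> t != u -> t != v ->
  (forall mu, maximum_matching V mu -> mu u = u -> mu t = t -> False) ->
  (forall mu, maximum_matching V mu -> mu t = t -> mu v = v -> False) ->
  forall mu, maximum_matching V mu -> mu u = u -> mu v = v -> False.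
Proof.
move=> missed uV tV vV uv tu tv nut ntv M maxM Mu Mv.
(* Among the maximum matchings that miss [t], [N] agrees with [M] as often as possible. *)
have [||N [[maxN Nt] bestN]] := @exists_max (W -> W) (fun N => maximum_matching V N /\ N t = t)
  (fun N => #|[set x | M x == N x]|) #|W|; first exact: missed.
  by move=> N _; apply: max_card.
have [[invM MP] maxM2] := maxM; have [[invN NP] maxN2] := maxN.
have Nu : N u != u by apply/eqP => Nu; apply: (nut N).
have Nv : N v != v by apply/eqP => Nv; apply: (ntv N).
(* [M] and [N] miss equally many vertices, but [M] misses [u] and [v], which [N] covers; so besides
   [t], [N] misses a vertex that [M] covers. *)
have [x [xN xM xt]] : exists x, [/\ N x = x, M x != x & x != t].
  apply: contrapT => none; have : [set u; v] :|: ~: moved N :\ t \subset ~: moved M.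
    apply/subsetP => x; rewrite !inE !negbK => /orP [/orP [] /eqP -> | /andP [xt /eqP xN]]; rewrite ?Mu ?Mv //.
    by apply: contrapT => /negP xM; apply: none; exists x.
  move/subset_leq_card; rewrite cardsU (_ : _ :&: _ = set0); last first.
    apply/setP => x; rewrite !inE negbK; apply/andP => -[/orP [] /eqP -> /andP [_ /eqP xN]].
      by rewrite xN eqxx in Nu.
    by rewrite xN eqxx in Nv.
  have := cardsC (moved M); have := cardsC (moved N); have := maximum_moved maxM maxN.
  rewrite cards0 subn0 cards2 uv (cardsD1 t (~: moved N)) !inE negbK Nt eqxx.
  by move: #|_ :\ _| #|~: moved M| #|moved M| #|moved N| => n1 n2 n3 n4; clear; lia.
set y := M x; have Ny : N y != y.
  apply/eqP => Ny; have [xV yV gxy] := MP x xM.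
  by have [addP] := matching_add_edge (conj invN NP) xV yV gxy xN Ny; rewrite ltnNge maxN2.
set z := N y; have Nz : N z = y by rewrite /z invN.
have yx : y != x by [].
have zx : z != x by apply: contra_neq yx => zx; rewrite -Nz zx xN.
have zy : z != y by [].
(* [N'] trades the edge [y z] of [N] for the edge [x y] of [M]: it still misses [t] and agrees with
   [M] more often, against the choice of [N]. *)
pose N' w := if w == x then y else if w == y then x else if w == z then z else N w.
have nxN w : w != x -> N w != x by apply: contra_neq => Nw; rewrite -[w]invN Nw xN.
have nyN w : w != z -> N w != y by apply: contra_neq => Nw; rewrite -[w]invN Nw.
have nzN w : w != y -> N w != z by apply: contra_neq => Nw; rewrite -[w]invN Nw Nz.
have [xV yV gxy] := MP x xM.
have mN' : matching V N'.
  split=> w; rewrite /N'; have [-> | wx] := eqVneq w x.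
  - by rewrite (negbTE yx) eqxx.
  - have [-> | wy] := eqVneq w y; first by rewrite eqxx.
    have [-> | wz] := eqVneq w z; first by rewrite (negbTE zx) (negbTE zy) eqxx.
    by rewrite (negbTE (nxN w wx)) (negbTE (nyN w wz)) (negbTE (nzN w wy)) invN.
  - by [].
  - have [-> | wy] := eqVneq w y; first by rewrite sym_g.
    have [-> | wz] := eqVneq w z; first by rewrite eqxx.
    exact: NP.
have movN' : moved N' = x |: moved N :\ z.
  apply/setP => w; rewrite !inE /N'; have [-> | wx] := eqVneq w x; first by rewrite yx.
  have [-> | wy] := eqVneq w y; first by rewrite eq_sym yx Ny eq_sym zy.
  by have [-> | wz] := eqVneq w z; rewrite ?eqxx.
have cardN' : #|moved N'| = #|moved N|.
  rewrite movN' cardsU1 !inE xN eqxx andbF /= [RHS](cardsD1 z) inE Nz.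
  by rewrite eq_sym zy.
have maxN' : maximum_matching V N' by split=> // nu nP; rewrite cardN'; apply: maxN2.
have ty : t != y by apply: contraNneq Ny => <-; rewrite Nt.
have tz : t != z by apply: contraNneq zy => tz; rewrite -Nz -tz Nt.
have N't : N' t = t by rewrite /N' eq_sym (negbTE xt) (negbTE ty) (negbTE tz) Nt.
have := bestN N' (conj maxN' N't); rewrite leqNgt => /negP; apply.
apply: proper_card; apply/properP; split.
  apply/subsetP => w; rewrite !inE /N'; have [-> | wx] := eqVneq w x; first by [].
  have [-> | wy] := eqVneq w y; first by rewrite /y invM.
  have [-> | //] := eqVneq w z; rewrite Nz => /eqP Mz.
  by move: zx; rewrite -[z]invM Mz /y invM eqxx.
by exists x; rewrite !inE /N' ?eqxx // xN.
Qed.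

(** A vertex covered by every maximum matching goes into [U]. When there is none, Gallai's lemma
    shows that a maximum matching misses at most one vertex of each component; the components are
    encoded as fibres of [r]. *)
Theorem tutte_berge V : exists (U : {set W}) (r : W -> W),
  [/\ U \subset V, forall x y, x \in V :\: U -> y \in V :\: U -> g x y -> r x = r y &
   forall mu, maximum_matching V mu ->
     2 * #|U| + \sum_c 2 * (#|[set x in V :\: U | r x == c]|./2) <= #|moved mu|].
Proof.
have [n] := ubnP #|V|; elim: n V => // n IHn V le_n.
have even_moved mu : matching V mu -> ~~ odd #|moved mu|.
  move=> [inv _]; apply: (even_card_involution inv) => x; rewrite !inE inv => mx; split=> //.
  by rewrite eq_sym.
have [[v [vV cov]] | none] := pselect (exists v, v \in V /\ forall nu, maximum_matching V nu -> nu v != v).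
  have [|U [r [sUV rP bound]]] := IHn (V :\ v).
    by move: le_n; rewrite (cardsD1 v) vV.
  exists (v |: U), r; have defV : V :\: (v |: U) = (V :\ v) :\: U.
    by apply/setP => x; rewrite !inE negb_or; case: (x == v); rewrite ?andbF.
  have sUV' : U \subset V by apply: subset_trans sUV (subsetDl _ _).
  rewrite defV; split=> // [|mu maxm].
    by rewrite subUset sub1set vV.
  have [[inv mP] mmax] := maxm; have mv := cov mu maxm.
  pose mu' w := if (w == v) || (w == mu v) then w else mu w.
  have nv w : w != mu v -> mu w != v by apply: contra_neq => mw; rewrite -[w]inv mw.
  have nmv w : w != v -> mu w != mu v by apply: contra_neq => mw; rewrite -[w]inv mw inv.
  have m'P : matching (V :\ v) mu'.
    split=> w; rewrite /mu'; have [-> | wv] /= := eqVneq w v; rewrite ?eqxx //.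
      have [-> | wmv] := eqVneq w (mu v); first by rewrite eqxx orbT.
      by rewrite (negbTE (nv w wmv)) (negbTE (nmv w wv)) inv.
    have [-> | wmv] := eqVneq w (mu v); first by rewrite eqxx.
    by move=> /mP [wV mwV gw]; rewrite !inE wv wV mwV nv.
  have mov : moved mu = v |: (mu v |: moved mu').
    apply/setP => w; rewrite !inE /mu'; have [-> | wv] /= := eqVneq w v; first by [].
    by have [-> | wmv] := eqVneq w (mu v); rewrite ?inv // eq_sym.
  have card_mov : #|moved mu| = #|moved mu'|.+2.
    have mv' : mu' v = v by rewrite /mu' eqxx.
    have mmv' : mu' (mu v) = mu v by rewrite /mu' eqxx orbT.
    by rewrite mov !cardsU1 !inE mv' mmv' !eqxx eq_sym (negbTE mv).
  have max' : maximum_matching (V :\ v) mu'.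
    split=> // nu [invn nP]; have nP' : matching V nu.
      by split=> // x /nP [/setD1P [_ xV] /setD1P [_ nxV] gx].
    have nuv : nu v = v.
      by apply/eqP/negPn/negP => /nP [/setD1P []]; rewrite eqxx.
    (* A matching of full size missing [v] would be maximum; since both counts are even, [nu] moves
       at least two vertices fewer. *)
    have neq : #|moved nu| != #|moved mu|.
      apply/eqP => eqm; have : nu v != v by apply: cov; split=> // nu' /mmax; rewrite eqm.
      by rewrite nuv eqxx.
    have := mmax nu nP'; have := even_moved nu nP'; have := even_moved mu (conj inv mP).
    by move: neq; rewrite card_mov; move: #|moved nu| #|moved mu'| => a b; clear; lia.
  have := bound mu' max'; rewrite card_mov cardsU1.
  have -> : v \notin U by apply/negP => /(subsetP sUV); rewrite !inE eqxx.
  by move: (\sum_c _) #|moved mu'| #|U| => a b c; clear; lia.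
have missed w : w \in V -> exists nu, maximum_matching V nu /\ nu w = w.
  move=> wV; apply: contrapT => no; apply: none; exists w; split=> // nu maxn.
  by apply/eqP => nw; apply: no; exists nu.
pose ok u v := u = v \/ forall mu, maximum_matching V mu -> mu u = u -> mu v = v -> False.
have ok_edge u v : u \in V -> v \in V -> g u v -> ok u v.
  move=> uV vV guv; right=> mu [mP mmax] mu_u mu_v.
  by have [addP] := matching_add_edge mP uV vV guv mu_u mu_v; rewrite ltnNge mmax.
have ok_trans u t v : u \in V -> t \in V -> v \in V -> ok u t -> ok t v -> ok u v.
  move=> uV tV vV [-> // | nut] [<- | ntv]; first by right.
  have [-> | uv] := eqVneq u v; first by left.
  have [tu | tu] := eqVneq t u; first by right; rewrite -tu.
  have [tv | tv] := eqVneq t v; first by right; rewrite -tv.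
  by right; apply: (gallai missed uV tV vV uv tu tv nut ntv).
pose h := induced g V.
have sym_h : symmetric h.
  by move=> x y; rewrite /h /induced /= sym_g; case: (x \in V); case: (y \in V).
have ok_conn u v : u \in V -> connect h u v -> ok u v.
  move=> uV /connectP [p pth ->]; elim: p u uV pth => [|z p IHp] u uV /=; first by left.
  case/andP=> /and3P [guz _ zV] pth; have okz := IHp z zV pth.
  apply: ok_trans (ok_edge u z uV zV guz) okz => //.
  by elim: p z zV pth {IHp guz} => //= y p IHp z zV /andP [/and3P [_ _ yV] /IHp]; apply.
exists set0, (root h); split; first exact: sub0set.
  move=> x y; rewrite !inE /= => xV yV gxy; apply/eqP; rewrite root_connect; last exact: sym_connect_sym.
  by apply: connect1; rewrite /h /induced /= gxy xV.
move=> mu maxm; have [[inv mP] _] := maxm; rewrite cards0 setD0 muln0 add0n.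
apply: leq_trans (_ : \sum_c #|[set x in moved mu | root h x == c]| <= _); last first.
  rewrite -[leqRHS]sum1_card [leqRHS](partition_big (root h) predT) //=; apply: leq_sum => c _.
  by rewrite sum1_card; apply: subset_leq_card; apply/subsetP => x; rewrite !inE unfold_in /= !inE.
apply: leq_sum => c _; set S := [set x in V | root h x == c]; set M := [set x in moved mu | root h x == c].
have evM : ~~ odd #|M|.
  apply: (even_card_involution inv) => x; rewrite !inE inv => /andP [mx /eqP rx].
  rewrite eq_sym mx; split=> //; rewrite /= -rx root_connect; last exact: sym_connect_sym.
  have [xV mxV gx] := mP x mx.
  by apply: connect1; rewrite /h /induced /= sym_g gx xV mxV.
have le1 : #|S :\: M| <= 1.
  apply/card_le1_eqP => x y; rewrite !inE !negb_and !negbK.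
  move=> /andP [nx /andP [xV /eqP rx]] /andP [ny /andP [yV /eqP ry]].
  have mx : mu x = x by case/orP: nx => [/eqP // | ]; rewrite rx eqxx.
  have my : mu y = y by case/orP: ny => [/eqP // | ]; rewrite ry eqxx.
  have : ok x y.
    apply: ok_conn => //; have := root_connect (sym_connect_sym sym_h) x y.
    by rewrite /eqfun rx ry eqxx => <-.
  by case=> // /(_ mu maxm mx my).
have leS : #|S| <= #|M| + 1.
  rewrite -(cardsID M S); apply: leq_add le1; apply: subset_leq_card; exact: subsetIr.
by move: leS evM; clear; lia.
Qed.
End Matching.

(** * Parity-breaking paths *)

(* A path [a :: rcons q b] with exactly its two ends in [K]. *)
Definition kpath (T : finType) (e : rel T) (K : {set T}) (a : T) (q : seq T) (b : T) :=
  [/\ a \in K, b \in K, forall x, x \in q -> x \notin K,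
      uniq (a :: rcons q b) & path e a (rcons q b)].

Lemma iter_fixed_dvd (W : finType) (f : W -> W) w t :
  injective f -> iter t f w = w -> order f w %| t.
Proof.
move=> injf fix_t; have n0 := order_gt0 f w; set n := order f w in n0 *.
have fixn j : iter (j * n) f w = w.
  by elim: j => //= j IHj; rewrite mulSn iterD IHj iter_order.
have eqw : iter (t %% n) f w = w.
  by rewrite -[RHS]fix_t [in RHS](divn_eq t n) addnC iterD fixn.
have := findex_iter (ltn_pmod t n0 : t %% n < order f w); rewrite eqw findex0 /dvdn => <-.
by [].
Qed.

Lemma card_sum (W : finType) (A : {set W}) : #|A| = \sum_w (w \in A).
Proof. by rewrite -sum1_card big_mkcond. Qed.

Lemma card_copies (W : finType) (A : {set W * bool}) : #|A| = \sum_w (((w, true) \in A) + ((w, false) \in A)).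
Proof.
rewrite card_sum; have -> : \sum_p (p \in A) = \sum_p nat_of_bool ((p.1, p.2) \in A).
  by apply: eq_bigr => -[].
rewrite -(pair_bigA _ (fun x b => nat_of_bool ((x, b) \in A))) /=.
by apply: eq_bigr => w _; rewrite big_bool.
Qed.

Section OddPaths.
Variables (T : finType) (e : rel T) (V K : {set T}) (col : T -> bool).
Hypotheses (sym_e : symmetric e) (irr_e : irreflexive e) (sKV : K \subset V).

(* The vertices outside K are doubled, so that odd and even walks reach different copies. *)
Definition lift_set : {set T * bool} :=
  [set w | (w.1 \in V) && ((w.1 \notin K) || (w.2 == col w.1))].

(** The rungs joining the two copies of a vertex outside [K] form a matching with [#|V :\: K|]
    edges. Its augmenting paths project to walks between vertices of [K] that break the colouring,
    so [m] further matching edges stand for [m] such paths. *)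
Definition lift_rel : rel (T * bool) :=
  [rel w w' | ((w.2 == w'.2) && e w.1 w'.1) || [&& w.1 == w'.1, w.2 != w'.2 & w.1 \notin K]].

Definition flip (w : T * bool) : T * bool :=
  if w.1 \in V :\: K then (w.1, ~~ w.2) else w.

Lemma lift_sym : symmetric lift_rel.
Proof.
move=> [x b] [y c]; rewrite /lift_rel /= sym_e eq_sym [x == y]eq_sym [c == b]eq_sym; congr (_ || _).
by case: eqVneq => //= ->.
Qed.

Lemma lift_irr : irreflexive lift_rel.
Proof. by move=> [x b]; rewrite /lift_rel /= irr_e andbF /= !eqxx. Qed.

Lemma flipK : involutive flip.
Proof.
by move=> [x b]; rewrite /flip /=; case xVK: (x \in V :\: K); rewrite /= xVK ?negbK.
Qed.

Lemma flip_fst w : (flip w).1 = w.1.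
Proof. by rewrite /flip; case: ifP. Qed.

Lemma flip_neq w : (flip w != w) = (w.1 \in V :\: K).
Proof. by case: w => x b; rewrite /flip /=; case: ifP => //=; rewrite ?eqxx // xpair_eqE eqxx; case: b. Qed.

Lemma flip_lift w : (flip w \in lift_set) = (w \in lift_set).
Proof.
by case: w => x b; rewrite /flip; case: ifP => //=; rewrite !inE /= => /andP [-> ->].
Qed.

Lemma lift_same_fst w w' : w \in lift_set -> w' \in lift_set -> w.1 = w'.1 -> w' = w \/ w' = flip w.
Proof.
case: w w' => [x b] [y c]; rewrite !inE /flip /= => /andP [xV xb] /andP [_ yc] eqxy.
rewrite -eqxy in yc *; rewrite inE xV andbT; case: (boolP (x \in K)) xb yc => xK /=.
  by move=> /eqP -> /eqP ->; left.
by move=> _ _; case: b c => -[]; by [left | right].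
Qed.

Lemma flip_pair x b : x \in V -> x \notin K -> flip (x, b) = (x, ~~ b).
Proof. by move=> xV xK; rewrite /flip inE /= xK xV. Qed.

Lemma flip_edge w : flip w != w -> lift_rel w (flip w).
Proof.
case: w => x b; rewrite flip_neq inE /= => /andP [xK xV].
by rewrite /flip /lift_rel /= inE xK xV /= eqxx; case: b; rewrite orbT.
Qed.

(* Composing a matching of the doubled graph with the exchange of copies gives an injection whose
   orbits of even order are closed walks traversed back and forth between two vertices of [K];
   half such an orbit is a [K]-path, and the copies record the parity of its length. *)
Section Orbits.
Variable mu : T * bool -> T * bool.
Hypothesis muP : matching lift_rel lift_set mu.
Let f w := flip (mu w).

Let inv_mu : involutive mu. Proof. by case: muP. Qed.
Let inj_f : injective f. Proof. exact: inj_comp (can_inj flipK) (can_inj inv_mu). Qed.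

Let inj_iter i : injective (iter i f).
Proof. by elim: i => //= i IHi x y /inj_f /IHi. Qed.

Let mu_lift w : w \in lift_set -> mu w \in lift_set.
Proof.
move=> wW; have [-> // | mw] := eqVneq (mu w) w.
by have [_ /(_ w mw) []] := muP.
Qed.

Let iter_lift i w : w \in lift_set -> iter i f w \in lift_set.
Proof. by move=> wW; elim: i => //= i IHi; rewrite /f flip_lift mu_lift. Qed.

(** [flip] conjugates [f] into its inverse, so it reverses every orbit through a point that it
    fixes. *)
Let reflect_iter i w : iter i f (flip (iter i f w)) = flip w.
Proof.
elim: i w => //= i IHi w; rewrite -iterS iterSr /f -/f.
by rewrite [flip (f _)]flipK inv_mu IHi.
Qed.

Let flip_iter i j w : flip w = w -> flip (iter i f w) = iter j f w -> order f w %| i + j.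
Proof.
move=> fw eqij; apply: iter_fixed_dvd inj_f _; rewrite iterD -eqij reflect_iter //.
Qed.

Let mu_iter i w : flip w = w -> mu (iter i f w) = iter i f w -> order f w %| i + i.+1.
Proof. by move=> fw eqi; apply: flip_iter (fw) _; rewrite iterS {2}/f eqi. Qed.

Let fixed_K w : w \in lift_set -> flip w = w -> w.2 = col w.1 /\ w.1 \in K.
Proof.
move=> wW fw; have : ~~ (flip w != w) by rewrite fw eqxx.
case: w wW {fw} => x b; rewrite flip_neq !inE /= => /andP [-> xb].
by rewrite andbT negbK => xK; move: xb; rewrite xK /= => /eqP ->.
Qed.

Let K_fixed x : x \in K -> flip (x, col x) = (x, col x).
Proof. by move=> xK; rewrite /flip inE /= xK. Qed.

Let K_lift x : x \in K -> (x, col x) \in lift_set.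
Proof. by move=> xK; rewrite inE /= (subsetP sKV) // eqxx orbT. Qed.

Let even_orbits := [set w in lift_set | (flip w == w) && ~~ odd (order f w)].
Let mate w := iter (order f w)./2 f w.

Let order_half w : order f (iter (order f w)./2 f w) = order f w.
Proof.
apply: (eq_order_cycle (cycle_orbit inj_f w)); first exact: in_orbit.
by rewrite -fconnect_orbit fconnect_iter.
Qed.

Let mateP w : w \in even_orbits -> [/\ mate w \in even_orbits, mate w != w & mate (mate w) = w].
Proof.
rewrite in_set => /and3P [wW /eqP fw ev]; have n0 := order_gt0 f w.
have mm : mate (mate w) = w.
  rewrite {1}/mate order_half /mate -iterD addnn -[RHS](iter_order inj_f).
  by rewrite -{2}[order f w]odd_double_half (negbTE ev).
split=> //.
  rewrite in_set iter_lift //= order_half ev andbT; apply/eqP.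
  by apply: (@inj_iter (order f w)./2); rewrite reflect_iter fw -{1}mm {1}/mate order_half.
apply/eqP => eqm; have : order f w %| (order f w)./2 by apply: iter_fixed_dvd.
by move/dvdn_leq; move: ev n0; move: (order f w) => n; clear; lia.
Qed.

(** An orbit of odd order through a vertex of [K] has, half way, a point that [mu] does not move. So
    there are at least as many unmatched points as odd orbits, and a large matching forces even
    ones. *)
Let card_even m : 2 * #|V :\: K| + 2 * m <= #|moved mu| -> 2 * m <= #|even_orbits|.
Proof.
move=> big; pose odd_orbits := [set w in lift_set | (flip w == w) && odd (order f w)].
have cardK : #|odd_orbits| + #|even_orbits| = #|K|.
  have -> : #|K| = #|[set (x, col x) | x in K]| by rewrite card_imset // => x y [].
  rewrite -card_setU_disjoint; last first.
    by apply/setP => w; rewrite in_set0 !in_set; case: (odd _); rewrite /= ?andbF.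
  congr #|pred_of_set _|; apply/setP => w; rewrite in_setU [w \in odd_orbits]in_set [w \in even_orbits]in_set; apply/idP/imsetP => [wO | [x xK ->]].
    have /andP [wW /eqP fw] : (w \in lift_set) && (flip w == w).
    by move: wO; case: (_ \in lift_set); case: (flip w == w); rewrite /= ?andbF.
    have [w2 wK] := fixed_K wW fw; exists w.1; rewrite // -w2.
    by case: (w).
  by rewrite K_lift // K_fixed // eqxx /=; case: odd.
have card_lift : #|lift_set| = 2 * #|V :\: K| + #|K|.
  rewrite card_copies mul2n -addnn !card_sum -!big_split; apply: eq_bigr => v _; rewrite !inE /=.
  have [vK | vK] := boolP (v \in K); last by case: (v \in V).
  by rewrite (subsetP sKV) //=; case: (col v).
have card_fix : #|lift_set :\: moved mu| + #|moved mu| = #|lift_set|.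
  rewrite -[RHS](cardsID (moved mu)) addnC; congr (_ + _); apply: eq_card => w; rewrite !inE.
  by rewrite andbC; case: eqVneq => //= mw; have [_ /(_ w mw) []] := muP; rewrite inE => ->.
suff : #|odd_orbits| <= #|lift_set :\: moved mu|.
  by move: big cardK card_lift card_fix; clear; lia.
pose mid w := iter (order f w)./2 f w.
rewrite -(@card_in_imset _ _ mid odd_orbits); last first.
  move=> w w' _ _ eqm; apply: (@inj_iter (order f w)./2); rewrite -/(mid w) eqm /mid.
  by rewrite -(order_half w) -/(mid w) eqm order_half.
apply: subset_leq_card; apply/subsetP => _ /imsetP [w wO ->].
move: wO; rewrite inE => /and3P [wW /eqP fw odd_n].
rewrite in_setD iter_lift // andbT inE negbK; apply/eqP; apply: (@inj_iter (order f w)./2.+1).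
rewrite -[mu _]flipK -/(f _) -iterS reflect_iter fw /mid -iterD addSn addnn.
by rewrite -[LHS](iter_order inj_f) -{1}[order f w]odd_double_half odd_n.
Qed.

(** A vertex repeated up to the antipode [mate w], or a vertex of [K] strictly in between, would
    make the order of the orbit divide a smaller positive number. Every step but the last changes
    the copy, which gives the parity. *)
Let half_orbit (w : T * bool) (h := (order f w)./2) (F := fun i => (iter i f w).1) (q := mkseq (F \o succn) h.-1) :
  w \in even_orbits ->
  [/\ kpath e K w.1 q (mate w).1, {subset q <= V}, odd (size q) = col w.1 (+) col (mate w).1 &
     forall x, x \in w.1 :: rcons q (mate w).1 -> exists i, x = F i].
Proof.
move=> wE; have [mE mw _] := mateP wE.
have wD : w.1 :: rcons q (mate w).1 = mkseq F h.+1.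
  have h0 : 0 < h by rewrite lt0n; apply: contra_neq mw => h0; rewrite /mate -/h h0.
  rewrite [RHS]/mkseq /= -[1]addn0 iotaDl -map_comp; congr (_ :: _).
  by rewrite /q -{2}(prednK h0) -[RHS]/(mkseq (F \o succn) h.-1.+1) mkseqS /= prednK.
have := wE; rewrite in_set => /and3P [wW /eqP fw ev].
have := mE; rewrite in_set => /and3P [mW /eqP fm _].
have n0 := order_gt0 f w; have hn : order f w = h + h.
  by rewrite addnn -[LHS]odd_double_half (negbTE ev).
have h0 : 0 < h by move: n0 hn; clear; lia.
have dvd_big t : 0 < t -> t < h + h -> order f w %| t = false.
  by move=> t0 th; apply/negP => /(dvdn_leq t0); rewrite hn leqNgt th.
have F_neq i j : i < j -> j <= h -> F i != F j.
  move=> ij jh; apply/eqP => /(lift_same_fst (iter_lift i wW) (iter_lift j wW)) [] eqij.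
    suff : order f w %| j - i by rewrite dvd_big //; move: ij jh; clear; lia.
    apply: (iter_fixed_dvd inj_f); apply: (@inj_iter i); rewrite -iterD -eqij.
    by rewrite subnKC // ltnW.
  have := flip_iter fw (esym eqij); rewrite dvd_big //; move: ij jh; clear; lia.
have FK i : 0 < i -> i < h -> F i \notin K.
  move=> i0 ih; apply/negP => iK; have : flip (iter i f w) = iter i f w.
    by apply/eqP; rewrite -[_ == _]negbK flip_neq inE iK.
  by move/(flip_iter fw); rewrite dvd_big //; move: i0 ih; clear; lia.
have FV i : F i \in V by have := iter_lift i wW; rewrite inE => /andP [].
have [w2 w1K] := fixed_K wW fw; have [m2 m1K] := fixed_K mW fm.
have step i : i < h -> lift_rel (iter i f w) (mu (iter i f w)) /\ F i != (mu (iter i f w)).1.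
  move=> ih; split; last by have := F_neq i i.+1 (ltnSn i) ih; rewrite {2}/F iterS flip_fst.
  have [_ ] := muP; move/(_ (iter i f w)) => mu_i; suff : mu (iter i f w) != iter i f w by case/mu_i.
  have d2 : 2 %| order f w by rewrite dvdn2.
  by apply/eqP => /(mu_iter fw) /(dvdn_trans d2); rewrite dvdn2 addnS addnn /= odd_double.
have edge i : i < h -> e (F i) (F i.+1) /\ (iter i.+1 f w).2 = (iter i f w).2 (+) (i.+1 < h).
  move=> ih; have [] := step i ih; rewrite /F iterS flip_fst => /orP [/andP [/eqP -> ei] _ | /and3P [-> //]].
  split=> //; rewrite /f /flip inE; have := FV i.+1; rewrite /F iterS flip_fst => ->; rewrite andbT.
  have [ih' | hi] := ltnP i.+1 h.
    by have := FK i.+1 isT ih'; rewrite /F iterS flip_fst => -> /=; rewrite addbT.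
  have m1E : (mate w).1 = F i.+1 by congr (iter _ f w).1; apply/eqP; rewrite eqn_leq hi ih.
  by have := m1K; rewrite m1E /F iterS flip_fst => -> /=; rewrite addbF.
have parity i : i < h -> (iter i f w).2 = col w.1 (+) odd i.
  elim: i => [|i IHi] ih; first by rewrite /= addbF w2.
  by have [_ ->] := edge i (ltnW ih); rewrite IHi ?(ltnW ih) // ih addbT /= addbN.
split.
- split=> //.
  + by move=> x /mapP [i]; rewrite mem_iota add0n => /andP [_ ih] ->; apply: FK => //=; move: ih; clear; lia.
  + rewrite wD; apply/mkseq_uniqP => i j; rewrite !inE => ih jh eqF; apply/eqP.
    case: (ltngtP i j) => // lt; have := F_neq _ _ lt; rewrite eqF eqxx => /(_ _) abs.
      by move: (abs jh).
    by move: (abs ih).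
  + have sz : size (rcons q (mate w).1) = h.
      by have := congr1 size wD; rewrite size_mkseq => -[].
    apply/(pathP w.1) => i; rewrite sz => ih.
    have -> : nth w.1 (rcons q (mate w).1) i = nth w.1 (w.1 :: rcons q (mate w).1) i.+1 by [].
    by rewrite wD !nth_mkseq ?ltnS // 1?ltnW //; have [] := edge i ih.
- by move=> x /mapP [i _ ->]; apply: FV.
- have ih : h.-1 < h by rewrite prednK.
  have [_] := edge _ ih; rewrite prednK // ltnn addbF -/(mate w) m2 => ->.
  by rewrite parity // size_mkseq addKb.
- by move=> x; rewrite wD => /mapP [i _ ->]; exists i.
Qed.

Lemma paths_of_matching m : 2 * #|V :\: K| + 2 * m <= #|moved mu| ->
  exists (a b : 'I_m -> T) (q : 'I_m -> seq T),
    (forall i, [/\ kpath e K (a i) (q i) (b i), {subset q i <= V} & odd (size (q i)) = col (a i) (+) col (b i)]) /\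
    forall i j x, i != j -> x \in a i :: rcons (q i) (b i) -> x \notin a j :: rcons (q j) (b j).
Proof.
move/card_even => le_m; have [L [sL cardL notL]] := involution_half mateP.
have mL : m <= #|L| by rewrite -(leq_pmul2l (ltn0Sn 1)) -cardL.
pose w (i : 'I_m) := enum_val (widen_ord mL i).
have wE i : w i \in even_orbits by rewrite (subsetP sL) // enum_valP.
exists (fun i => (w i).1), (fun i => (mate (w i)).1),
  (fun i => mkseq (fun t => (iter t.+1 f (w i)).1) (order f (w i))./2.-1).
split=> [i | i j x ij xi]; first by have [] := half_orbit (wE i).
apply/negP => xj; have [_ _ _ /(_ x xi) [s defx]] := half_orbit (wE i).
have [_ _ _ /(_ x xj) [t defx']] := half_orbit (wE j).
have := wE i; have := wE j; rewrite [w j \in _]in_set [w i \in _]in_set.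
move=> /and3P [wjW /eqP fj _] /and3P [wiW /eqP fi _].
(* Paths that meet lie on one orbit, where [w j] is then [w i] or its antipode; [L] contains only
   one of the two. *)
have conn : fconnect f (w i) (w j).
  have := lift_same_fst (iter_lift s wiW) (iter_lift t wjW) (etrans (esym defx) defx').
  case=> eqst; rewrite (fconnect_sym inj_f).
    by apply: connect_trans (fconnect_iter f t _) _; rewrite eqst (fconnect_sym inj_f) fconnect_iter.
  apply: connect_trans (fconnect_iter f t _) _; rewrite eqst.
  by have := fconnect_iter f s (flip (iter s f (w i))); rewrite reflect_iter fi.
have := findex_max conn; have := iter_findex conn; set u := findex _ _ _ => eqj ltu.
have : order f (w i) %| u + u by apply: flip_iter; rewrite // eqj.
have [u0 | u0 dvd_u] := posnP u.
  move: eqj; rewrite u0 /= => /enum_val_inj /(congr1 val) /= eqij.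
  by move: ij; rewrite -val_eqE /= eqij eqxx.
have eq2u : u + u = order f (w i).
  by case/dvdnP: dvd_u => c; move: ltu u0; case: c => [|[|c]]; nia.
have : w j = mate (w i) by rewrite /mate -eq2u addnn doubleK.
by move=> eqm; have := notL _ (enum_valP (widen_ord mL i)); rewrite -/(w i) -eqm enum_valP.
Qed.

End Orbits.

(* [Z] consists of the vertices lost in the Tutte-Berge set and of all but one boundary vertex of
   each class. A doubled vertex inside a class would be cut off from [K] by few vertices, so one
   copy of every other vertex survives, and the surviving copies form an independent set. *)
Lemma bipartite_of_deficient m mu : 0 < m -> maximum_matching lift_rel lift_set mu ->
  #|moved mu| < 2 * #|V :\: K| + 2 * m ->
  (forall X : {set T}, #|X| < #|~: V| + 2 * m -> connected_minus e X) -> 2 * m <= #|K| ->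
  exists (Z : {set T}) (c : T -> bool), [/\ Z \subset V, #|Z| <= 2 * m - 2 &
    forall x y, x \in V :\: Z -> y \in V :\: Z -> e x y -> c x != c y].
Proof.
move=> m0 maxmu few conn bigK.
have [U [r [sU rP bound]]] := tutte_berge lift_sym lift_irr lift_set.
have {bound} bound := bound mu maxmu.
set D := lift_set :\: U in rP bound.
(* Inside [D], [B] consists of the copies whose twin survives too. Twins share a class, so the
   parity of a class depends only on its boundary copies [Bd]: vertices of [K] and copies with a
   lost twin. *)
pose B := [set w | (flip w \in D) && (flip w != w)].
have DU w : (w \in D) = (w \in lift_set) && (w \notin U) by rewrite in_setD andbC.
have BE w : (w \in B) = (flip w \in D) && (flip w != w) by rewrite in_set.
pose Bd := D :\: B; have BdE w : (w \in Bd) = (w \notin B) && (w \in D) by rewrite in_setD.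
pose cls (A : {set T * bool}) c := [set w in A | r w == c].
have clsE A c w : (w \in cls A c) = (w \in A) && (r w == c) by rewrite in_set.
pose Z0 := [set v in V | ((v, true) \notin D) && ((v, false) \notin D)].
have card_class c : 2 * (#|cls D c|./2) = #|cls (D :&: B) c| + 2 * (#|cls Bd c|./2).
  have ev : ~~ odd #|cls (D :&: B) c|.
    apply: (even_card_involution flipK) => w; rewrite !clsE !in_setI !BE flipK.
    move=> /andP [/andP [wD /andP [fD fw]] /eqP rw]; rewrite fw wD fD eq_sym fw /=; split=> //.
    by rewrite -rw; apply/eqP; apply: rP; rewrite // lift_sym flip_edge.
  rewrite -(cardsID B (cls D c)).
  have -> : cls D c :&: B = cls (D :&: B) c by apply/setP => w; rewrite in_setI !clsE in_setI andbAC.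
  have -> : cls D c :\: B = cls Bd c by apply/setP => w; rewrite in_setD !clsE BdE andbA.
  rewrite halfD (negbTE ev) /= add0n mulnDr -[in RHS](odd_double_half #|cls (_ :&: B) _|).
  by rewrite (negbTE ev) mul2n add0n.
have sum_cls A : \sum_c #|cls A c| = #|A|.
  rewrite -[RHS]sum1_card [RHS](partition_big r predT) //=; apply: eq_bigr => c _.
  by rewrite -sum1_card; apply: eq_bigl => w; rewrite clsE.
have coverU : 2 * #|V :\: K| + 2 * #|Z0| <= 2 * #|U| + #|D :&: B|.
  rewrite !card_copies !card_sum !big_distrr -!big_split; apply: leq_sum => v _ /=.
  rewrite !in_setI !BE !DU !inE !flip_neq !in_setD /flip !inE /=.
  have U_lift b : (v, b) \in U -> (v \in V) && ((v \notin K) || (b == col v)).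
    by move/(subsetP sU); rewrite inE.
  have := subsetP sKV v; move: (U_lift true) (U_lift false).
  case vV: (v \in V); case vK: (v \in K) => /= h1 h2 h3; rewrite ?vV ?vK /= ?DU ?inE /= ?vV ?vK /=;
    move: (_ \in U) (_ \in U) (col v) h1 h2 h3 => -[] [] [] h1 h2 h3;
    by [|have := h1 isT | have := h2 isT | have := h3 isT].
have cardZ0 : 2 * #|Z0| + 2 * (\sum_c #|cls Bd c|./2) <= 2 * m - 2.
  have : 2 * #|U| + \sum_c 2 * (#|cls D c|./2) <= #|moved mu| := bound.
  under eq_bigr => c _ do rewrite card_class; rewrite big_split /= sum_cls -big_distrr /=.
  move: coverU few; move: (\sum_c _) #|D :&: B| #|moved mu| #|V :\: K| #|Z0| #|U| => s1 s2 s3 s4 s5 s6. clear. lia.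
(* One boundary copy per class is kept; the others number at most [2 * (#|cls Bd c|./2)]. *)
pose rep c := [pick w in cls Bd c].
pose Bd' := [set w in Bd | rep (r w) != Some w].
have Bd'E w : (w \in Bd') = (w \in Bd) && (rep (r w) != Some w) by rewrite in_set.
have cardBd' : #|Bd'| <= 2 * (\sum_c #|cls Bd c|./2).
  rewrite -sum_cls big_distrr /=; apply: leq_sum => c _.
  have [-> | [w0]] := set_0Vmem (cls Bd' c); first by rewrite cards0.
  rewrite clsE Bd'E => /andP [/andP [w0B _] rw0].
  have [w1 [rep1 w1S]] : exists w1, rep c = Some w1 /\ w1 \in cls Bd c.
    by rewrite /rep; case: pickP => [w1 w1S | /(_ w0)]; [exists w1 | rewrite clsE w0B rw0].
  suff : #|cls Bd' c| < #|cls Bd c| by move: #|_| #|_| => a b; clear; lia.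
  rewrite (cardsD1 w1 (cls Bd c)) w1S ltnS; apply: subset_leq_card; apply/subsetP => w.
  rewrite in_setD1 !clsE Bd'E => /andP [/andP [wB nrep] rw]; rewrite wB rw !andbT.
  by apply: contra nrep => /eqP ->; move: w1S; rewrite clsE => /andP [_ /eqP ->]; rewrite rep1.
pose Z := Z0 :|: fst @: Bd'.
have DV w : w \in D -> w.1 \in V by rewrite DU inE => /andP [/andP []].
have sZV : Z \subset V.
  apply/subsetP => v; rewrite in_setU => /orP [|/imsetP [w]]; first by rewrite inE => /andP [].
  by rewrite Bd'E BdE => /andP [/andP [_ /DV wV] _] ->.
have cardZ : #|Z| <= 2 * m - 2.
  apply: leq_trans (leq_card_setU _ _) _; have := leq_imset_card fst Bd'.
  by move: cardZ0 cardBd'; move: (\sum_c _) #|_ @: _| #|Bd'| => s1 s2 s3; clear; lia.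
have copy v : v \in V :\: Z -> exists b, (v, b) \in D.
  rewrite in_setD !in_setU negb_or => /andP [/andP [vZ0 _] vV]; move: vZ0; rewrite inE vV /=.
  by rewrite negb_and !negbK => /orP [] vD; [exists true | exists false].
have uniq_rep w w' : w \in Bd -> w' \in Bd -> w.1 \notin Z -> w'.1 \notin Z -> r w = r w' -> w = w'.
  have one u : u \in Bd -> u.1 \notin Z -> rep (r u) = Some u.
    move=> uB uZ; apply/eqP; apply: contraNT uZ => nrep.
    by rewrite in_setU; apply/orP; right; apply: imset_f; rewrite Bd'E uB.
  by move=> wB wB' wZ wZ' eqr; apply: Some_inj; rewrite -(one w) // -(one w') // eqr.
have no_interior v b : v \notin Z -> (v, b) \in D -> (v, b) \in Bd.
  move=> vZ vD; apply: contrapT => /negP vB; set c := r (v, b).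
  pose A := [set x in V :\: Z | [&& (x, true) \in D, (x, false) \in D, r (x, true) == c & x \notin K]].
  pose Y := [set x in V :\: Z | [exists b', ((x, b') \in Bd) && (r (x, b') == c)]].
  have Y1 : #|Y| <= 1.
    apply/card_le1_eqP => x y; rewrite [x \in Y]in_set [y \in Y]in_set ![_ \in V :\: Z]in_setD.
    move=> /andP [/andP [xZ _] /existsP [b1 /andP [x1 /eqP rx]]] /andP [/andP [yZ _] /existsP [b2 /andP [y2 /eqP ry]]].
    by have /(congr1 fst) := uniq_rep _ _ x1 y2 xZ yZ (etrans rx (esym ry)).
  (* At most [2 * m - 2] vertices, the complement of [V], and the at most one kept boundary vertex
     of the class: too few to disconnect the graph. *)
  pose X := Z :|: (~: V :|: Y).
  have cardX : #|X| < #|~: V| + 2 * m.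
    apply: leq_ltn_trans (leq_card_setU _ _) _; have := (leq_card_setU (~: V) Y).1.
    by move: cardZ Y1 m0; move: #|_ :|: _| #|Z| #|Y| #|~: V| => a1 a2 a3 a4; clear; lia.
  have XE x : (x \notin X) = [&& x \notin Z, x \in V & x \notin Y].
    by rewrite (in_setU x Z) (in_setU x (~: V)) (in_setC x V) 2!negb_or negbK.
  have joint x b1 b2 : x \notin K -> (x, b1) \in D -> (x, b2) \in D -> r (x, b1) = r (x, b2).
    by move=> xK xD1 xD2; have [-> // | b12] := eqVneq b1 b2; apply: rP; rewrite // /lift_rel /= eqxx b12 xK orbT.
  have inA x b' : x \in V :\: Z -> (x, b') \in D -> (x, b') \notin Bd -> r (x, b') = c -> x \in A.
    move=> xVZ xD; rewrite BdE xD andbT negbK BE flip_neq [_ \in V :\: K]in_setD /= => /andP [fxD /andP [xK xV]] rx.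
    have {}fxD : (x, ~~ b') \in D by move: fxD; rewrite flip_pair.
    have both b1 : (x, b1) \in D by case: b' b1 xD fxD {rx} => -[].
    by rewrite in_set xVZ !both xK (joint x true b') // rx eqxx.
  have vV : v \in V by apply: (DV _ vD).
  have vA : v \in A by apply: inA vD vB _ => //; rewrite in_setD vZ.
  have A_D x b' : x \in A -> (x, b') \in D /\ r (x, b') = c.
    rewrite in_set => /and5P [_ xt xf /eqP rx xK].
    have xD : (x, b') \in D by case: b'.
    by split=> //; rewrite -rx; apply: joint.
  have A_Y x : x \in A -> x \notin Y.
    move=> xA; apply/negP; rewrite in_set => /andP [_ /existsP [b' /andP [xB _]]].
    have : (x, b') \in B; last by move: xB; rewrite BdE => /andP [/negbTE ->].
    have [xV xK] : x \in V /\ x \notin K.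
      by move: xA; rewrite in_set in_setD => /and5P [/andP [_ ->] _ _ _ ->].
    rewrite BE flip_neq [_ \in V :\: K]in_setD /= xK xV andTb andbT flip_pair //.
    by have [] := A_D x (~~ b') xA.
  have vX : v \notin X by rewrite XE vZ vV A_Y.
  have [x xK xX] : exists2 x, x \in K & x \notin X.
    apply/subsetPn/negP => sKX; have : K \subset Z :|: Y.
      apply/subsetP => x xK; have : x \in Z :|: (~: V :|: Y) := subsetP sKX x xK.
      by rewrite (in_setU x Z) (in_setU x (~: V)) (in_setC x V) (subsetP sKV x xK) orFb in_setU.
    move/subset_leq_card; rewrite leqNgt => /negP; apply; apply: leq_ltn_trans (leq_card_setU _ _) _.
    by move: cardZ Y1 m0 bigK; move: #|K| #|Z| #|Y| => a1 a2 a3; clear; lia.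
  have : x \in A; last by rewrite in_set xK !andbF.
  apply: (connected_minus_closed (conn X cardX) vA vX _ xX) => {x xK xX} x y xA xX yX exy.
  have /and3P [yZ yV yY] : [&& y \notin Z, y \in V & y \notin Y] by rewrite -XE.
  have yVZ : y \in V :\: Z by rewrite in_setD yZ.
  have [b' yD] := copy y yVZ; have [xD rx] := A_D x b' xA.
  have ry : r (y, b') = c by rewrite -rx; apply: esym; apply: rP; rewrite // /lift_rel /= eqxx exy.
  apply: (inA y b') => //; apply: contra yY => yB.
  by rewrite in_set yVZ /=; apply/existsP; exists b'; rewrite yB ry eqxx.
(* Neighbours of equal colour would have adjacent surviving copies, hence in one class, and both
   would be its kept representative. *)
exists Z, (fun v => (v, true) \in D); split=> // x y xVZ yVZ exy.
have colD v : v \in V :\: Z -> (v, (v, true) \in D) \in Bd.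
  move=> vVZ; apply: no_interior; first by move: vVZ; rewrite in_setD => /andP [].
  by have [b] := copy v vVZ; case vD: ((v, true) \in D) => //; case: b; rewrite ?vD.
have := colD x xVZ; have := colD y yVZ; rewrite in_setD in xVZ; rewrite in_setD in yVZ.
have /andP [xZ _] := xVZ; have /andP [yZ _] := yVZ; move=> yB xB; apply/eqP => eqc.
have eqr : r (x, (x, true) \in D) = r (y, (y, true) \in D).
  by move: xB yB; rewrite !BdE => /andP [_ xD] /andP [_ yD]; apply: rP; rewrite // /lift_rel /= eqc eqxx exy.
by have /(congr1 fst) /= := uniq_rep _ _ xB yB xZ yZ eqr; move=> eqxy; move: exy; rewrite eqxy irr_e.
Qed.

Lemma odd_paths_or_bipartite m : 0 < m ->
  (forall X : {set T}, #|X| < #|~: V| + 2 * m -> connected_minus e X) -> 2 * m <= #|K| ->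
  (exists (a b : 'I_m -> T) (q : 'I_m -> seq T),
    (forall i, [/\ kpath e K (a i) (q i) (b i), {subset q i <= V} & odd (size (q i)) = col (a i) (+) col (b i)]) /\
    forall i j x, i != j -> x \in a i :: rcons (q i) (b i) -> x \notin a j :: rcons (q j) (b j)) \/
  exists (Z : {set T}) (c : T -> bool), [/\ Z \subset V, #|Z| <= 2 * m - 2 &
    forall x y, x \in V :\: Z -> y \in V :\: Z -> e x y -> c x != c y].
Proof.
move=> m0 conn bigK; have [mu maxmu] := maximum_matching_exists lift_rel lift_set.
have [/(paths_of_matching (proj1 maxmu)) | few] := leqP (2 * #|V :\: K| + 2 * m) #|moved mu|; first by left.
by right; apply: bipartite_of_deficient maxmu few conn bigK.
Qed.

End OddPaths.

(** * Avoiding the breaking paths *)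

Section Reroute.
Variables (T : finType) (e : rel T) (V K : {set T}) (m : nat).
Variables (a b : 'I_m -> T) (q : 'I_m -> seq T).
Let P j := a j :: rcons (q j) (b j).
Hypotheses (sym_e : symmetric e) (sKV : K \subset V).
Hypotheses (kP : forall j, kpath e K (a j) (q j) (b j)) (qV : forall j, {subset q j <= V}).
Hypothesis (disjP : forall i j x, i != j -> x \in P i -> x \notin P j).
Variable X : {set T}.

Definition to_core y p :=
  [/\ path e y p, uniq (y :: p), {subset y :: p <= V}, last y p \in K &
      forall x, x \in belast y p -> x \notin K].

Definition core_linkage (l : T -> seq T) :=
  (forall y, y \in X -> to_core y (l y)) /\
  forall y z x, y \in X -> z \in X -> y != z -> x \in y :: l y -> x \notin z :: l z.

Definition same_path x y := [exists j, (x \in P j) && (y \in P j)].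

(** The potential minimised in [reroute]: a step between vertices of one [P j] is free, every other
    step costs one. *)
Fixpoint changes x l := if l is z :: l' then ~~ same_path x z + changes z l' else 0.

Lemma changes_cat x l1 l2 : changes x (l1 ++ l2) = changes x l1 + changes (last x l1) l2.
Proof. by elim: l1 x => //= z l1 IH x; rewrite IH addnA. Qed.

Lemma changes_stay x l j : x \in P j -> changes x l = 0 -> last x l \in P j.
Proof.
elim: l x => //= z l IH x xj /eqP; rewrite addn_eq0 eqb0 negbK => /andP [/existsP [i /andP [xi zi]] /eqP].
apply: IH; have [<- // | ij] := eqVneq i j.
by have := disjP ij xi; rewrite xj.
Qed.

Lemma changes_in x l j : {subset x :: l <= P j} -> changes x l = 0.
Proof.
elim: l x => //= z l IH x sub; rewrite IH => [|y yl]; last by apply: sub; rewrite in_cons yl orbT.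
suff -> : same_path x z by [].
by apply/existsP; exists j; rewrite !sub // !in_cons eqxx ?orbT.
Qed.

Lemma core_linkage_exists :
  X \subset V -> (forall A B : {set T}, separation V e A B -> X \subset A -> K \subset B -> #|X| <= #|A :&: B|) ->
  exists l, core_linkage l.
Proof.
move=> sXV sep; have [f [D [DP disj]]] := menger_paths sym_e sXV sKV sep.
have ex y : exists p, y \in X -> [/\ path e y p, uniq (y :: p), last y p = f y & {subset y :: p <= D y}].
  have [yX | _] := boolP (y \in X); last by exists [::].
  by have [_ /joined_path [p []] *] := DP y yX; exists p.
have [l lP] := choice ex; exists l; split=> [y yX | y z x yX zX yz xy].
  have [pth un lst sub] := lP y yX; have [sDV _ fQ DQ] := DP y yX.
  split=> //; [by move=> x /sub /(subsetP sDV) | by rewrite lst | ].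
  move=> x xb; apply/negP => xK; have : x \in D y :&: K by rewrite in_setI xK sub ?mem_belast.
  by rewrite DQ in_set1 => /eqP eqx; move: un xb; rewrite lastI rcons_uniq lst eqx => /andP [/negbTE ->].
have [_ _ _ suby] := lP y yX; have [_ _ _ subz] := lP z zX.
by apply/negP => /subz; rewrite (disjointFr (disj y z yX zX yz) (suby x xy)).
Qed.

(* If P j were hit by some path but contained no last vertex, then the path through the first
   hit vertex of P j could be rerouted along P j to K, with fewer changes. *)
Lemma hit_contains_last l : core_linkage l ->
  (forall l', core_linkage l' -> \sum_(y in X) changes y (l y) <= \sum_(y in X) changes y (l' y)) ->
  forall j, (exists y x, [/\ y \in X, x \in y :: l y & x \in P j]) ->
  exists2 y, y \in X & last y (l y) \in P j.
Proof.
move=> [lP disjl] minl j hit; apply: contrapT => nolast.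
have notlast y : y \in X -> last y (l y) \notin P j by move=> yX; apply/negP => h; apply: nolast; exists y.
pose hitb x := [exists y in X, x \in y :: l y].
have [|p1 [x [p2 [defP /existsP [y /andP [yX xy]] np1]]]] := @first_split _ hitb (P j).
  by have [y [x [yX xy xP]]] := hit; apply/hasP; exists x => //; apply/existsP; exists y; rewrite yX.
have xP : x \in P j by rewrite defP mem_cat mem_head orbT.
have p1P z : z \in p1 -> z \in P j by move=> zp; rewrite defP mem_cat zp.
have [aK bK qK Pun Ppth] := kP j; have [lpth lun lV lK lb] := lP y yX.
have PV z : z \in P j -> z \in V.
  rewrite in_cons mem_rcons in_cons => /or3P [/eqP -> | /eqP -> | /qV //]; exact: (subsetP sKV).
have free1 z w : z \in p1 -> w \in X -> z \notin w :: l w.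
  move=> zp wX; apply: contra (hasPn np1 z zp) => zw; apply/existsP; exists w; exact/andP.
have xK : x \notin K.
  have := xy; rewrite lastI mem_rcons in_cons => /orP [/eqP eqx | /lb //].
  by have := notlast y yX; rewrite -eqx xP.
have [c [p1' defp1]] : exists c p1', p1 = c :: p1'.
  case: p1 defP {p1P free1 np1} => [[ax] | c p1' _]; last by exists c, p1'.
  by move: xK; rewrite -ax aK.
have ca : c = a j by move: defP; rewrite defp1 => -[].
have [m1 [m2 [defl lastm1]]] : exists m1 m2, l y = m1 ++ m2 /\ last y m1 = x.
  by case/splitPl: xy => m1 m2 lm; exists m1, m2.
have defq : q j = p1' ++ belast x p2.
  move: defP; rewrite defp1 /= => -[_]; rewrite [x :: p2]lastI -rcons_cat => /rcons_inj [].
  by [].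
have defr : rev p1 = rcons (rev p1') c by rewrite defp1 rev_cons.
pose l1 := m1 ++ rev p1.
have m1l z : z \in y :: m1 -> z \in y :: l y by rewrite defl -cat_cons mem_cat => ->.
have coreP : to_core y l1.
  split.
  - rewrite cat_path lastm1; move: lpth; rewrite defl cat_path => /andP [-> _] /=.
    have : path e c (rcons p1' x).
      move: Ppth; rewrite -ca; have -> : rcons (q j) (b j) = rcons p1' x ++ p2.
        by move: defP; rewrite defp1 /= cat_rcons => -[].
      by rewrite cat_path => /andP [].
    rewrite -(eq_path (e := fun u v => e v u)); last by move=> u v; rewrite sym_e.
    by rewrite -rev_path last_rcons belast_rcons -defp1.
  - rewrite -cat_cons cat_uniq rev_uniq.
    have : uniq (P j) by []; rewrite defP cat_uniq => /andP [-> _]; rewrite andbT.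
    move: lun; rewrite defl -cat_cons cat_uniq => /andP [-> _] /=.
    by apply/hasPn => z; rewrite mem_rev => zp; apply: contra (free1 z y zp yX) => /m1l.
  - move=> z; rewrite -cat_cons mem_cat mem_rev => /orP [/m1l /lV // | /p1P /PV //].
  - by rewrite last_cat defr last_rcons ca.
  move=> z; rewrite /l1 defr -rcons_cat belast_rcons -cat_cons mem_cat mem_rev => /orP [|zp].
    rewrite lastI lastm1 mem_rcons in_cons => /orP [/eqP -> // | zb].
    by apply: lb; rewrite defl belast_cat mem_cat zb.
  by apply: qK; rewrite defq mem_cat zp.
pose l' z := if z == y then l1 else l z.
have sub1 z : z \in y :: l1 -> z \in y :: l y \/ z \in p1.
  by rewrite -cat_cons mem_cat mem_rev => /orP [/m1l | ]; [left | right].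
have linkl' : core_linkage l'.
  split=> [z zX | z w u zX wX zw]; first by rewrite /l'; have [-> // | _] := eqVneq z y; apply: lP.
  rewrite /l'; have [zy | zy] := eqVneq z y; have [wy | wy] := eqVneq w y.
  - by rewrite zy wy eqxx in zw.
  - by rewrite zy in zw * => /sub1 [|] h; [apply: disjl h | apply: free1].
  - rewrite wy in zw * => h; apply/negP => /sub1 [|] h'; first by have := disjl z y u zX yX zw h; rewrite h'.
    by have := free1 u z h' zX; rewrite h.
  - exact: disjl.
have := minl l' linkl'; rewrite leqNgt => /negP; apply.
rewrite (bigD1 y) // [ltnRHS](bigD1 y) //= {1}/l' eqxx.
rewrite (eq_bigr (fun z => changes z (l z))) => [|z /andP [_ /negbTE zy]]; last by rewrite /l' zy.
rewrite ltn_add2r /l1 defl !changes_cat lastm1 ltn_add2l (@changes_in _ _ j); last first.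
  by move=> z; rewrite in_cons mem_rev => /orP [/eqP -> // | /p1P].
(* The discarded tail starts on [P j] and ends off it, so it had at least one change. *)
rewrite lt0n; apply/eqP => /(changes_stay xP); rewrite -lastm1 -last_cat -defl.
by apply/negP/notlast.
Qed.

(** At minimum potential every breaking path that is hit contains the last vertex of a connecting
    path. The breaking paths are disjoint, so at most [#|X|] of them are hit. *)
Lemma reroute : X \subset V ->
  (forall A B : {set T}, separation V e A B -> X \subset A -> K \subset B -> #|X| <= #|A :&: B|) ->
  exists (l : T -> seq T) (J : {set 'I_m}), [/\ core_linkage l, m <= #|J| + #|X| &
    forall j y x, j \in J -> y \in X -> x \in y :: l y -> x \notin P j].
Proof.
move=> sXV sep; have := core_linkage_exists sXV sep.
move/(exists_min (fun l => \sum_(y in X) changes y (l y))) => [l [linkl minl]].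
pose J := [set j | [forall y in X, all (fun x => x \notin P j) (y :: l y)]].
exists l, J; split=> //; last first.
  by move=> j y x; rewrite inE => /forall_inP /(_ y) h /h /allP; apply.
have ex j : exists y, j \notin J -> y \in X /\ last y (l y) \in P j.
  have [jJ | jJ] := boolP (j \in J); first by exists (a j).
  have [|y yX h] := hit_contains_last linkl minl (j := j); last by exists y.
  move: jJ; rewrite inE negb_forall_in => /exists_inP [y yX /allPn [x xy]].
  by rewrite negbK => xP; exists y, x.
have [y yP] := choice ex.
have inj_y : {in ~: J &, injective y}.
  move=> i j; rewrite !in_setC => /yP [_ iP] /yP [_ jP] eqy; apply: contrapT => /eqP ij.
  by have := disjP ij iP; rewrite eqy jP.
have : y @: (~: J) \subset X by apply/subsetP => _ /imsetP [j jJ ->]; have [] := yP j _; rewrite -?in_setC.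
move/subset_leq_card; rewrite card_in_imset //; have := cardsC J; rewrite card_ord.
by move: #|J| #|~: J| #|X| => n1 n2 n3; clear; lia.
Qed.
End Reroute.

Lemma bip_path_col (T : finType) (e : rel T) col x p :
  path (bip e col) x p -> odd (size p) = col x (+) col (last x p).
Proof.
elim: p x => [|z p IH] x /=; first by rewrite addbb.
by case/andP => /andP [_ xz] /IH ->; move: xz; case: (col x); case: (col z); case: (col _).
Qed.

(** * Closing up odd cycles *)

Section Assembly.
Variables (T : finType) (e : rel T) (K S : {set T}) (col : T -> bool) (k : nat).
(* [(i, false)] indexes the path through [S], [(i, true)] the breaking path of the [i]-th cycle;
   the latter is a mere pair of ends when the former is already breaking. *)
Variables (a b : 'I_k * bool -> T) (q : 'I_k * bool -> seq T).
Let F u := a u :: rcons (q u) (b u).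
Let breaking u := odd (size (q u)) == col (a u) (+) col (b u).
Hypothesis endsK : forall u, [/\ a u \in K, b u \in K & forall x, x \in q u -> x \notin K].
Hypothesis uniqF : forall u, uniq (F u).
Hypothesis disjF : forall u v x, u != v -> x \in F u -> x \notin F v.
Hypothesis pathR : forall i, path e (a (i, false)) (rcons (q (i, false)) (b (i, false))).
Hypothesis sizeR : forall i, 0 < size (q (i, false)).
Hypothesis hasR : forall i, has (mem S) (F (i, false)).
Hypothesis pathP : forall i, ~~ breaking (i, false) ->
  breaking (i, true) /\ path e (a (i, true)) (rcons (q (i, true)) (b (i, true))).
Hypothesis linkK : forall X : {set T}, X \subset K -> #|X| = 4 * k -> linked (bip e col) K X.

(** All [4k] ends are linked in one application of [linkK]. Links respect the colouring, so a closed
    chain is odd exactly when it contains an odd number of breaking pieces; here it contains one. *)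
Lemma assemble_cycles : exists cs : seq (seq T),
  [/\ size cs = k, all (odd_S_cycle e S) cs & pairwise (fun c d : seq T => [disjoint c & d]) cs].
Proof.
pose E (w : 'I_k * bool * bool) := if w.2 then b w.1 else a w.1.
have EF w : E w \in F w.1 by rewrite /E; case: w.2; rewrite in_cons ?mem_rcons ?mem_head ?eqxx ?orbT.
have ab u : a u != b u.
  by have := uniqF u; rewrite /F /= mem_rcons in_cons negb_or => /andP [/andP [->]].
have injE : injective E.
  move=> [u c] [v d] eqE; have uv : u = v.
    apply: contrapT => /eqP uv; have := disjF uv (EF (u, c)); rewrite eqE.
    by have := EF (v, d) => /= ->.
  move: eqE; rewrite uv /E /=; case: c d => -[] // eqab; first by have := ab v; rewrite eqab eqxx.
  by have := ab v; rewrite eqab eqxx.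
pose X := [set E w | w : 'I_k * bool * bool].
have sXK : X \subset K by apply/subsetP => _ /imsetP [w _ ->]; rewrite /E; case: w.2; have [] := endsK w.1.
have cardX : #|X| = 4 * k by rewrite card_imset // !card_prod card_ord card_bool -mulnA mulnC.
pose next u := (u.1, u.2 (+) ~~ breaking (u.1, false)).
have injn : injective next by move=> [i c] [j d] [<- /addIb ->].
have EX w : E w \in X by apply: imset_f.
have [||||u v|D [DP disjD]] := linkK sXK cardX (a := fun u => E (u, true)) (b := fun u => E (next u, false)).
- by move=> u; apply: EX.
- by move=> u; apply: EX.
- by move=> u v /injE [].
- by move=> u v /injE /(congr1 fst) /injn.
- by apply/eqP => /injE [].
have ex u : exists l, [/\ path (bip e col) (b u) l, last (b u) l = a (next u), uniq (b u :: l) & {subset b u :: l <= D u}].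
  by have [_ /joined_path [l lP] _] := DP u; exists l.
have [l lP] := choice ex.
have DK u x : x \in D u -> x \in K by have [sDK _ _] := DP u; apply: (subsetP sDK).
have D_eq u v x : x \in D u -> x \in D v -> u = v.
  by move=> xu xv; apply: contrapT => /eqP uv; rewrite (disjointFr (disjD u v uv) xu) in xv.
have pl u : path e (b u) (l u) by have [h _ _ _] := lP u; apply: sub_path h => x y /andP [].
have lD u x : x \in l u -> x \in D u by have [_ _ _ sub] := lP u => xl; apply: sub; rewrite in_cons xl orbT.
have bD u : b u \in D u by have [_ _ _ sub] := lP u; apply/sub/mem_head.
have odd_l u : odd (size (l u)) = col (b u) (+) col (a (next u)).
  by have [h last_l _ _] := lP u; rewrite (bip_path_col h) last_l.
pose block u := rcons (q u) (b u) ++ l u.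
pose c i := block (i, false) ++ (if breaking (i, false) then [::] else block (i, true)).
have block_uniq u : uniq (block u).
  have [_ _ /= /andP [bl ul] _] := lP u; have [_ _ qK] := endsK u.
  have := uniqF u => /= /andP [_]; rewrite /block cat_uniq ul andbT => -> /=.
  apply/hasPn => x xl; rewrite mem_rcons in_cons negb_or; apply/andP; split.
    by apply: contraNneq bl => <-.
  by apply/negP => /qK; rewrite (DK u) // lD.
have block_sub u x : x \in block u -> x \in D u \/ x \in q u /\ x \notin K.
  have [_ _ qK] := endsK u; rewrite mem_cat mem_rcons in_cons => /orP [/orP [/eqP -> | xq] | /lD]; [left | right | left] => //.
  by split=> //; apply: qK.
have block_disj u v x : u != v -> x \in block u -> x \notin block v.
  move=> uv /block_sub [xu | [xu xK]]; apply/negP => /block_sub [xv | [xv xK']].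
  - by move: uv; rewrite (D_eq _ _ _ xu xv) eqxx.
  - by rewrite (DK u) in xK'.
  - by rewrite (DK v) in xK.
  by have := disjF uv (x := x); rewrite !in_cons !mem_rcons !in_cons xu xv !orbT => /(_ isT).
have c_sub i x : x \in c i -> exists d, x \in block (i, d).
  by rewrite mem_cat => /orP [xb | ]; [exists false | case: ifP => // _ xb; exists true].
have blockP u : path e (a u) (rcons (q u) (b u)) -> path e (a u) (block u) /\ last (a u) (block u) = a (next u).
  move=> pu; have [_ last_l _ _] := lP u.
  by rewrite /block cat_path last_cat last_rcons pu pl last_l.
have c_path i : path e (a (i, false)) (c i) /\ last (a (i, false)) (c i) = a (i, false).
  have [p1 l1] := blockP _ (pathR i); rewrite /c cat_path last_cat p1 l1 /next /=.
  have [//|br] := boolP (breaking (i, false)).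
  by have [_ /blockP [p2 l2]] := pathP br; rewrite p2 l2 /next /= br.
have odd_block u : odd (size (block u)) = ~~ odd (size (q u)) (+) col (b u) (+) col (a (next u)).
  by rewrite size_cat size_rcons oddD odd_l /= addbA.
have c_odd i : odd (size (c i)).
  rewrite /c size_cat oddD odd_block /next /=.
  have [/eqP -> | br] := boolP (breaking (i, false)).
    by rewrite addbF; case: (col _); case: (col _).
  have [/eqP br' _] := pathP br; rewrite odd_block /next /= br br' /=.
  move: br; rewrite /breaking.
  by case: (odd _); case: (col (a (i, false))); case: (col (b (i, false))); case: (col _); case: (col _).
have c_cycle i : odd_S_cycle e S (c i).
  rewrite /odd_S_cycle /is_cycle c_odd /=; have [cp cl] := c_path i.
  have sz : 1 < size (c i).
    by rewrite /c size_cat size_cat size_rcons; have := sizeR i; move: (size _) => n; clear; lia.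
  apply/andP; split.
    apply/and3P; split.
    - rewrite /c cat_uniq block_uniq /=; case: ifP => //= _; rewrite block_uniq andbT.
      by apply/hasPn => x; apply: block_disj; rewrite xpair_eqE andbF.
    - by move: (c_odd i) sz; move: (size (c i)) => n; clear; lia.
    by rewrite (cycle_path (a (i, false))) cl.
  have /hasP [x xF xS] := hasR i; apply/hasP; exists x => //.
  move: xF; rewrite in_cons => /orP [/eqP -> | xF]; last by rewrite mem_cat mem_cat xF.
  have : last (a (i, false)) (c i) \in c i; last by rewrite cl.
  by case: (c i) sz => [|z p] // _; rewrite /= mem_last.
exists [seq c i | i <- enum 'I_k]; split.
- by rewrite size_map size_enum_ord.
- by apply/allP => _ /mapP [i _ ->].
rewrite pairwise_map; have := enum_uniq 'I_k; rewrite uniq_pairwise; apply: sub_pairwise => i j /= ij.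
rewrite disjoint_has; apply/hasPn => x /c_sub [d xi]; apply/negP => /c_sub [d' xj].
have uv : (i, d) != (j, d') by rewrite xpair_eqE (negbTE ij).
by have := block_disj _ _ x uv xi; rewrite xj.
Qed.
End Assembly.

(** * Representatives, matchings and covers *)

Lemma extend_representatives (I T : finType) (N : I -> {set T}) (A : {set I}) (g : I -> T) :
  (forall i, #|I| <= #|N i|) -> (forall i, i \in A -> g i \in N i) -> {in A &, injective g} ->
  exists f : I -> T, [/\ injective f, forall i, f i \in N i & forall i, i \in A -> f i = g i].
Proof.
move=> big; have [n] := ubnP #|~: A|; elim: n A g => // n IHn A g le_n gN inj_g.
have [A0 | [i iA]] := set_0Vmem (~: A).
  have inA i : i \in A by rewrite -[A]setCK A0 setC0 inE.
  by exists g; split=> // [i j | i]; [apply: inj_g | apply: gN].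
rewrite in_setC in iA.
(* Greedy choice: fewer than [#|I|] values are used so far, so they do not exhaust [N i]. *)
have [x xN xA] : exists2 x, x \in N i & x \notin g @: A.
  apply/subsetPn/negP => /subset_leq_card; rewrite card_in_imset // => le_A.
  have := leq_trans (big i) le_A; rewrite leqNgt -(cardsC A) -[X in X < _]addn0 ltn_add2l => /negP; apply.
  by apply/card_gt0P; exists i; rewrite in_setC.
pose h j := if j == i then x else g j.
have hA j : j \in A -> h j = g j by rewrite /h => jA; case: eqVneq iA => // <-; rewrite jA.
have hi : h i = x by rewrite /h eqxx.
have neq j : j \in A -> g j != x by move=> jA; apply: contraNneq xA => <-; apply: imset_f.
have [||| f [inj_f fN fh]] := IHn (i |: A) h.
- have -> : ~: (i |: A) = ~: A :\ i by apply/setP => j; rewrite !inE negb_or.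
  by move: le_n; rewrite (cardsD1 i (~: A)) in_setC iA.
- by move=> j; rewrite in_setU1 => /orP [/eqP -> | jA]; rewrite ?hi // hA // gN.
- move=> j l; rewrite !in_setU1 => /orP [/eqP -> | jA] /orP [/eqP -> | lA] //; rewrite ?hi ?hA //.
  + by move=> eqx; have := neq l lA; rewrite -eqx eqxx.
  + by move=> eqx; have := neq j jA; rewrite eqx eqxx.
  exact: inj_g.
by exists f; split=> // j jA; rewrite fh ?hA // in_setU1 jA orbT.
Qed.

(** Greedy: if fewer than [n] edges are matched and no further one fits, their at most [2 * n - 2]
    ends form a cover. *)
Lemma matching_or_cover (T : finType) (g : rel T) n : irreflexive g ->
  (exists E : 'I_n * bool -> T, injective E /\ forall i, g (E (i, false)) (E (i, true))) \/
  exists2 Y : {set T}, #|Y| <= 2 * n - 2 & forall x y, g x y -> (x \in Y) || (y \in Y).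
Proof.
move=> irr_g; suff : (exists E : nat * bool -> T, {in [pred w | w.1 < n] &, injective E} /\
    forall i, i < n -> g (E (i, false)) (E (i, true))) \/
  exists2 Y : {set T}, #|Y| <= 2 * n - 2 & forall x y, g x y -> (x \in Y) || (y \in Y).
  case=> [[E [inj_E gE]] | cov]; [left | by right].
  exists (fun w => E (val w.1, w.2)); split=> [[i c] [j d] eqE | i]; last exact: (gE (val i) (ltn_ord i)).
  by have [/val_inj -> ->] := inj_E (val i, c) (val j, d) (ltn_ord i) (ltn_ord j) eqE.
elim: n => [|n [[E [inj_E gE]] | [Y cardY covY]]].
- have [[x _] | none] := pselect (exists x : T, True).
    by left; exists (fun _ => x); split.
  by right; exists set0 => [|x]; [rewrite cards0 | case: none; exists x].
- pose Y := [set E (val w.1, w.2) | w : 'I_n * bool].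
  have cardY : #|Y| <= 2 * n.+1 - 2.
    apply: leq_trans (leq_imset_card _ _) _; rewrite card_prod card_ord card_bool.
    by clear; lia.
  have [cov | ] := pselect (forall x y, g x y -> (x \in Y) || (y \in Y)); first by right; exists Y.
  move/existsNP => [x /existsNP [y /not_implyP [gxy /negP]]]; rewrite negb_or => /andP [xY yY].
  have inY i c : i < n -> E (i, c) \in Y by move=> ltin; apply/imsetP; exists (Ordinal ltin, c).
  pose E' w := if w.1 == n then (if w.2 then y else x) else E w.
  have new c : E' (n, c) \notin Y by rewrite /E' /= eqxx; case: c.
  have old i c : i < n -> E' (i, c) = E (i, c) by move=> ltin; rewrite /E' /= ltn_eqF.
  left; exists E'; split.
    move=> [i c] [j d]; rewrite !inE /= !ltnS [i <= n]leq_eqVlt [j <= n]leq_eqVlt.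
    case/orP=> [/eqP -> | lti] /orP [/eqP -> | ltj].
    - rewrite /E' /= eqxx; case: c d => -[] // eqxy; by move: gxy; rewrite eqxy irr_g.
    - by move=> eqE; have := new c; rewrite eqE old // inY.
    - by move=> eqE; have := new d; rewrite -eqE old // inY.
    by rewrite !old //; apply: inj_E.
  move=> i; rewrite ltnS leq_eqVlt => /orP [/eqP -> | ltin]; last by rewrite !old // gE.
  by rewrite /E' /= eqxx.
by right; exists Y => //; apply: leq_trans cardY _; clear; lia.
Qed.

Lemma tau_ind_cover (T : finType) (e : rel T) (A : {set T}) :
  exists2 C : {set T}, #|C| = tau_ind e A & vcover e A C.
Proof.
rewrite /tau_ind; case: arg_minnP => [|C covC _]; last by exists C.
by rewrite /vcover subxx /=; apply/forall_inP => x xA; apply/forall_inP => y _; rewrite xA implybT.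
Qed.

Lemma linked_proper (T : finType) (e e' : rel T) (V X : {set T}) :
  (forall x y, x \in V -> y \in V -> e x y -> e' x y) -> linked e V X -> linked e' V X.
Proof.
move=> sub lk I a b aX bX inj_a inj_b ab; have [D [DP disjD]] := lk I a b aX bX inj_a inj_b ab.
exists D; split=> // i; have [sDV jD DX] := DP i; split=> //.
apply: joined_homo jD => // u v uD vD euv; apply: joined_edge => //.
by apply: sub; rewrite // (subsetP sDV).
Qed.

(** * The two cases *)

Section Cases.
Variables (T : finType) (e : rel T) (k : nat) (S S' : {set T}).
Hypotheses (sym_e : symmetric e) (irr_e : irreflexive e) (k0 : 0 < k).
Hypotheses (conn : k_connected e (50 * k)) (sS : S' \subset S) (cardS' : #|S'| = k).

Let odd_cycles := exists cs : seq (seq T),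
  [/\ size cs = k, all (odd_S_cycle e S) cs & pairwise (fun c d : seq T => [disjoint c & d]) cs].

Lemma nearly_bipartite (Z : {set T}) (c : T -> bool) :
  S' \subset Z -> #|Z| <= 7 * k - 2 -> (forall x y, x \notin Z -> y \notin Z -> e x y -> c x != c y) ->
  odd_cycles \/ exists X : {set T}, bipartite_minus e X /\ #|X| <= 2 * k - 2 + tau_ind e S'.
Proof.
move=> sSZ cardZ cP.
pose side v (b : bool) := [set u in nbrs e setT v :\: Z | c u == b].
have cardN v : 43 * k <= #|nbrs e setT v :\: Z|.
  have := k_connected_degree irr_e v conn; have := cardsID Z (nbrs e setT v).
  have := subset_leq_card (subsetIr (nbrs e setT v) Z); move: cardZ.
  by move: #|_ :&: _| #|_ :\: _| #|nbrs _ _ _| #|Z| => a1 a2 a3 a4; clear; lia.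
have card_side v : #|side v true| + #|side v false| = #|nbrs e setT v :\: Z|.
  rewrite -(cardsID [set u | c u] (nbrs e setT v :\: Z)); congr (_ + _); apply: eq_card => u; rewrite !inE.
    by rewrite eqb_id.
  by rewrite andbC eqbF_neg.
(* A vertex of [Z] gets the colour that is not more frequent among its neighbours outside [Z]; at
   least half of these, of which there are at least [50k - 7k], then have the other colour. *)
pose col v := if v \in Z then #|side v true| < #|side v false| else c v.
have colZ v : v \notin Z -> col v = c v by rewrite /col => /negbTE ->.
pose opp v := [set u in nbrs e setT v :\: Z | col u != col v].
have oppE v u : (u \in opp v) = [&& u \notin Z, e v u & col u != col v].
  by rewrite !inE /= -andbA.
have opp_big v : 21 * k <= #|opp v|.
  have := cardN v; have [vZ | vZ] := boolP (v \in Z); last first.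
    have -> : opp v = nbrs e setT v :\: Z; last by move: #|_| => a1; clear; lia.
    apply/setP => u; rewrite oppE !inE /=; case: (boolP (u \in Z)) => //= uZ.
    by case evu: (e v u) => //=; rewrite !colZ // eq_sym cP.
  have -> : opp v = side v (~~ col v).
    apply/setP => u; rewrite oppE !inE /=; case: (boolP (u \in Z)) => //= uZ.
    by rewrite (colZ u) //; case: (e v u); case: (c u); case: (col v).
  rewrite -card_side /col vZ.
  by case: ltnP; move: #|side v true| #|side v false| => a1 a2; clear; lia.
pose bad := [rel x y | [&& e x y, col x == col y & ~~ ((x \in S') && (y \in S'))]].
have irr_bad : irreflexive bad by move=> x; rewrite /bad /= irr_e.
have [[E [inj_E badE]] | [Y cardY covY]] := matching_or_cover k irr_bad; last first.
  right; have [C cardC /andP [_ covC]] := tau_ind_cover e S'; exists (Y :|: C); split.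
    exists col => x y; rewrite !in_setU !negb_or => /andP [xY xC] /andP [yY yC] exy.
    apply/negP => /eqP eqc; have [/andP [xS yS] | nS] := boolP ((x \in S') && (y \in S')).
      by move/forall_inP/(_ x xS)/forall_inP/(_ y yS): covC; rewrite exy (negbTE xC) (negbTE yC).
    have := covY x y; rewrite (negbTE xY) (negbTE yY) => /(_ _) h.
    by suff : false by []; apply: h; rewrite /bad /= exy eqc eqxx.
  apply: leq_trans (leq_card_setU _ _) _; rewrite cardC; exact: leq_add.
left; have eE i : e (E (i, false)) (E (i, true)) by have /and3P [] := badE i.
have colE i : col (E (i, false)) = col (E (i, true)) by have /and3P [_ /eqP] := badE i.
(* Distinct vertices of S' are attributed to the edges so that an edge meets S' in at most
   the vertex attributed to it. *)
pose end_in i := if E (i, false) \in S' then E (i, false) else E (i, true).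
pose A := [set i | end_in i \in S'].
have end_inE i : exists d, end_in i = E (i, d) by rewrite /end_in; case: ifP; [exists false | exists true].
have [||| s [inj_s sS' s_end]] := @extend_representatives _ _ (fun=> S') A end_in.
- by move=> _; rewrite card_ord cardS'.
- by move=> i; rewrite inE.
- by move=> i j _ _; have [d ->] := end_inE i; have [d' ->] := end_inE j => /inj_E [].
have s_edge i j d : s i = E (j, d) -> i = j.
  move=> eqs; apply: inj_s; rewrite eqs; have ES : E (j, d) \in S' by rewrite -eqs.
  have endj : end_in j = E (j, d).
    rewrite /end_in; case: d ES {eqs} => ES; last by rewrite ES.
    by case: ifP => // ES'; have /and3P [_ _] := badE j; rewrite ES ES'.
  by rewrite s_end ?endj // inE endj.
pose W := Z :|: [set E w | w : 'I_k * bool].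
have WE w : E w \in W by rewrite in_setU imset_f ?orbT.
have Ws i : s i \in W by rewrite in_setU (subsetP sSZ).
have cardE : #|[set E w | w : 'I_k * bool]| = 2 * k by rewrite card_imset // card_prod card_ord card_bool mulnC.
have cardW : #|~: ~: W| <= 9 * k.
  rewrite setCK; apply: leq_trans (leq_card_setU _ _) _; rewrite cardE.
  by move: cardZ; clear; lia.
have WZ x : x \in ~: W -> x \notin Z by rewrite in_setC in_setU negb_or => /andP [].
(* Exits into the bipartite part: one from each end of a matching edge and two from each [s i]. The
   [4k] exits can be chosen distinct because [21k - 2k >= 4k]. *)
pose N (w : 'I_k * bool * bool) := opp (if w.2 then s w.1.1 else E w.1) :\: W.
have bigN w : #|{: 'I_k * bool * bool}| <= #|N w|.
  rewrite !card_prod card_ord card_bool /N; set v := if _ then _ else _.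
  have := cardsID [set E w | w : 'I_k * bool] (opp v); have := opp_big v.
  have -> : opp v :\: [set E w | w : 'I_k * bool] = opp v :\: W.
    by apply/setP => x; rewrite !in_setD in_setU oppE; case: (x \in Z); rewrite ?andbF.
  have := subset_leq_card (subsetIr (opp v) [set E w | w : 'I_k * bool]); rewrite cardE.
  by move: #|_ :&: _| #|opp v| #|_ :\: _| => a1 a2 a3; clear; lia.
have [|| f [inj_f fN _]] := @extend_representatives _ _ N set0 (fun=> s (Ordinal k0)) bigN.
- by move=> w; rewrite inE.
- by move=> w w'; rewrite inE.
have fW w : f w \in ~: W by have := fN w; rewrite in_setD in_setC => /andP [].
have fe i d : e (E (i, d)) (f (i, d, false)) /\ col (f (i, d, false)) != col (E (i, d)).
  by have := fN (i, d, false); rewrite in_setD oppE => /and4P [].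
have fs i d : e (s i) (f (i, d, true)) /\ col (f (i, d, true)) != col (s i).
  by have := fN (i, d, true); rewrite in_setD oppE => /and4P [].
(* If [s i] is an end of edge [i], the path over that edge is a breaking path through [S], and the
   second piece is a pair of ends with nothing between. Otherwise the path through [s i] comes first
   and the edge supplies the breaking piece. *)
pose hit i := (s i == E (i, false)) || (s i == E (i, true)).
pose flag (u : 'I_k * bool) := u.2 (+) ~~ hit u.1.
pose a u := f (u.1, false, flag u); pose b u := f (u.1, true, flag u).
pose q u := if flag u then (if hit u.1 then [::] else [:: s u.1]) else [:: E (u.1, false); E (u.1, true)].
have qE u x : x \in q u -> if flag u then ~~ hit u.1 /\ x = s u.1 else exists d, x = E (u.1, d).
  rewrite /q; case: (flag u).
    by case: (hit u.1) => //=; rewrite inE => /eqP.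
  by rewrite !inE => /orP [] /eqP ->; [exists false | exists true].
have qW u x : x \in q u -> x \in W.
  by move/qE; case: (flag u) => [[_ ->] | [d ->]].
have abE u x : x \in a u :: rcons (q u) (b u) -> (exists d, x = f (u.1, d, flag u)) \/ x \in q u.
  rewrite in_cons mem_rcons in_cons => /or3P [/eqP -> | /eqP -> | ->]; last by right.
    by left; exists false.
  by left; exists true.
have edge_path i : path e (f (i, false, false)) (rcons [:: E (i, false); E (i, true)] (f (i, true, false))).
  by have [e0 _] := fe i false; have [e1 _] := fe i true; rewrite /= sym_e e0 eE e1.
have s_path i : path e (f (i, false, true)) (rcons [:: s i] (f (i, true, true))).
  by have [e0 _] := fs i false; have [e1 _] := fs i true; rewrite /= sym_e e0 e1.
have edge_breaking i : col (f (i, false, false)) = col (f (i, true, false)).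
  have [_] := fe i false; have [_] := fe i true; rewrite colE.
  by case: (col _); case: (col _); case: (col _).
apply: (@assemble_cycles T e (~: W) S col k a b q).
- by move=> u; split; [apply: fW | apply: fW | move=> x /qW xW; rewrite in_setC xW].
- move=> u; have nfq d : f (u.1, d, flag u) \notin q u.
    by apply/negP => /qW; have := fW (u.1, d, flag u); rewrite in_setC => /negbTE ->.
  rewrite /= mem_rcons in_cons negb_or rcons_uniq !nfq /= andbT; apply/andP; split.
    by apply/negP => /eqP /inj_f [].
  rewrite /q; case: (flag u); first by case: (hit _).
  by rewrite /= inE andbT; apply/negP => /eqP /inj_E [].
- move=> u v x uv /abE xu; apply/negP => /abE xv.
  case: xu xv => [[d ->] | xu] [[d' eqx] | xv].
  + move: eqx uv => /inj_f []; case: u v => [i c1] [j c2] /= -> _; rewrite /flag /= => /addIb ->.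
    by rewrite eqxx.
  + by have := qW _ _ xv; have := fW (u.1, d, flag u); rewrite in_setC => /negbTE ->.
  + by have := qW _ _ xu; rewrite eqx; have := fW (v.1, d', flag v); rewrite in_setC => /negbTE ->.
  have := qE _ _ xu; have := qE _ _ xv.
  case flu: (flag u); case flv: (flag v).
  + move=> [_ ->] [_ /inj_s eq1]; move: uv flu flv; case: u v eq1 {xu xv} => [i c1] [j c2] /= ->.
    by rewrite /flag /= => uv <- /addIb eqc; rewrite eqc eqxx in uv.
  + move=> [d ->] [nhit /esym eqs]; have eq1 := s_edge _ _ _ eqs.
    by move: nhit; rewrite /hit eqs eq1; case: (d); rewrite eqxx ?orbT.
  + move=> [nhit ->] [d eqs]; have eq1 := s_edge _ _ _ eqs.
    by move: nhit; rewrite /hit eqs eq1; case: (d); rewrite eqxx ?orbT.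
  + move=> [d ->] [d' /inj_E [eq1 _]]; move: uv flu flv; case: u v eq1 {xu xv} => [i c1] [j c2] /= ->.
    by rewrite /flag /= => uv <- /addIb eqc; rewrite eqc eqxx in uv.
- by move=> i; rewrite /a /b /q /flag /=; case: (hit i).
- by move=> i; rewrite /q /flag /=; case: (hit i).
- move=> i; apply/hasP; exists (s i); last by apply: (subsetP sS).
  rewrite in_cons mem_rcons in_cons; apply/orP; right; apply/orP; right; rewrite /q /flag /=.
  by case hi: (hit i); rewrite /= !inE // orbC.
- move=> i; rewrite /a /b /q /flag /=; case: (hit i) => /=; first by rewrite edge_breaking addbb eqxx.
  by move=> _; rewrite edge_breaking addbb eqxx; split=> //; apply: (edge_path i).
move=> X sX cardX; apply: (linked_proper (e := e)); last exact: (linked_of_connected sym_e irr_e k0 conn cardW sX cardX).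
by move=> x y /WZ xZ /WZ yZ exy; rewrite /bip /= exy !colZ // cP.
Qed.
(** With [m = 3k], [odd_paths_or_bipartite] asks for [6k <= #|K|] and for connectivity [k + 6k]; its
    second outcome deletes at most [6k - 2] vertices, which with [S'] gives [7k - 2]. *)
Lemma odd_cycles_or_nearly_bipartite : odd_cycles \/ exists (Z : {set T}) (c : T -> bool),
  [/\ S' \subset Z, #|Z| <= 7 * k - 2 & forall x y, x \notin Z -> y \notin Z -> e x y -> c x != c y].
Proof.
have [bigT connT] := conn; pose V := ~: S'.
have VE x : (x \in V) = (x \notin S') by rewrite in_setC.
have cVS : ~: V = S' by rewrite setCK.
have degV v : 49 * k <= #|nbrs e V v|.
  have := k_connected_degree irr_e v conn; have := cardsID S' (nbrs e setT v).
  have -> : nbrs e setT v :\: S' = nbrs e V v by apply/setP => u; rewrite !inE.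
  have := subset_leq_card (subsetIr (nbrs e setT v) S'); rewrite cardS'.
  by move: #|_ :&: _| #|nbrs e V v| #|nbrs _ _ _| => a1 a2 a3; clear; lia.
have V0 : V != set0.
  rewrite -card_gt0; have := cardsC S'; rewrite cardS' -/V; move: bigT k0; move: #|V| #|T| => a1 a2.
  by clear; lia.
have [col [K [sKV bigK linkK]]] := dense_bipartite sym_e irr_e k0 (fun v _ => degV v) V0.
have KS x : x \in K -> x \notin S' by move/(subsetP sKV); rewrite VE.
have k3 : 0 < 3 * k by rewrite muln_gt0.
have [||[a [b [q [qP disjP]]]] | [Z [c [sZV cardZ cP]]]] := odd_paths_or_bipartite col sym_e irr_e sKV k3.
- by move=> X ltX; apply: connT; move: ltX; rewrite cVS cardS'; move: #|X| => a1; clear; lia.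
- by move: bigK; move: #|K| => a1; clear; lia.
- left.
  have ltS (i : 'I_k) : i < #|S'| by rewrite cardS'.
  pose s (i : 'I_k) := enum_val (Ordinal (ltS i)).
  have sS' i : s i \in S' by apply: enum_valP.
  have inj_s : injective s by move=> i j /enum_val_inj [] /val_inj.
  (* Each vertex of [S'] gets two private neighbours, from which the [2k] connecting paths start. *)
  have [||| x [inj_x xN _]] := @extend_representatives _ _ (fun w : 'I_k * bool => nbrs e V (s w.1)) set0 (fun w => s w.1).
  - move=> w; rewrite card_prod card_ord card_bool; have := degV (s w.1); move: #|_| => a1.
    by clear; lia.
  - by move=> w; rewrite inE.
  - by move=> w w'; rewrite inE.
  pose X := [set x w | w : 'I_k * bool].
  have cardX : #|X| = 2 * k by rewrite card_imset // card_prod card_ord card_bool mulnC.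
  have xX w : x w \in X by apply: imset_f.
  have sXV : X \subset V by apply/subsetP => _ /imsetP [w _ ->]; have := xN w; rewrite !inE => /andP [].
  have sx w : e (s w.1) (x w) by have := xN w; rewrite !inE => /andP [].
  have [|l [J [[linkP link_disj] bigJ freeJ]]] := reroute sym_e sKV (fun j => let: And3 h _ _ := qP j in h)
    (fun j => let: And3 _ h _ := qP j in h) disjP sXV.
    (* A cut of fewer than [2k] vertices together with [S'] has fewer than [3k], too few to
       disconnect the graph. *)
    move=> A B [defV noE] sXA sKB; rewrite leqNgt; apply/negP => small.
    pose W := (A :&: B) :|: S'.
    have WE y : (y \notin W) = (y \notin A :&: B) && (y \in V) by rewrite (in_setU y (A :&: B)) negb_or VE.
    have [y yX yAB] : exists2 y, y \in X & y \notin A :&: B.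
      by apply/subsetPn/negP => /subset_leq_card; rewrite leqNgt small.
    have [z zK zAB] : exists2 z, z \in K & z \notin A :&: B.
      apply/subsetPn/negP => /subset_leq_card; move: small bigK; rewrite cardX.
      by move: #|K| #|A :&: B| => a1 a2; clear; lia.
    have yA := subsetP sXA y yX; have zB := subsetP sKB z zK.
    have yW : y \notin W by rewrite WE yAB (subsetP sXV).
    have zW : z \notin W by rewrite WE zAB (subsetP sKV).
    have : z \in A :\: B; last by rewrite in_setD zB.
    have ltW : #|W| < 50 * k.
      apply: leq_ltn_trans (leq_card_setU _ _) _; rewrite cardS'; move: small; rewrite cardX.
      by move: k0; move: #|_| => a1; clear; lia.
    apply: (connected_minus_closed (connT W ltW) (a := y)) zW => //.
      by move: yAB; rewrite in_setI in_setD yA /= => ->.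
    move=> u v uAB _; rewrite WE => /andP [vAB vV] euv.
    have : v \in A :|: B by rewrite defV.
    move: vAB; rewrite in_setI negb_and in_setU in_setD.
    have [vA | vA] := boolP (v \in A); first by rewrite orFb andbT => ->.
    move=> _ /= vB; have := noE u v uAB; rewrite in_setD vA vB euv => /(_ isT).
    by [].
  have kJ : k <= #|J| by move: bigJ; rewrite cardX; move: #|J| => a1; clear; lia.
  pose g (i : 'I_k) := enum_val (widen_ord kJ i).
  have gJ i : g i \in J by apply: enum_valP.
  have inj_g : injective g by move=> i j /enum_val_inj /(congr1 val) /= /val_inj.
  pose a' u := if u.2 then a (g u.1) else last (x (u.1, false)) (l (x (u.1, false))).
  pose b' u := if u.2 then b (g u.1) else last (x (u.1, true)) (l (x (u.1, true))).
  (* Backwards along one connecting path, through [s i], and out along the other. *)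
  pose q' (u : 'I_k * bool) := if u.2 then q (g u.1) else
    rev (belast (x (u.1, false)) (l (x (u.1, false)))) ++ s u.1 :: belast (x (u.1, true)) (l (x (u.1, true))).
  have tailR i : rcons (q' (i, false)) (b' (i, false)) =
      rev (belast (x (i, false)) (l (x (i, false)))) ++ s i :: x (i, true) :: l (x (i, true)).
    by rewrite /q' /b' /= rcons_cat rcons_cons -lastI.
  have FR i : a' (i, false) :: rcons (q' (i, false)) (b' (i, false)) =
      rev (x (i, false) :: l (x (i, false))) ++ s i :: x (i, true) :: l (x (i, true)).
    by rewrite tailR /a' /= -cat_cons -rev_rcons -lastI.
  have memR i z : z \in a' (i, false) :: rcons (q' (i, false)) (b' (i, false)) ->
      z = s i \/ exists d, z \in x (i, d) :: l (x (i, d)).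
    rewrite FR mem_cat mem_rev in_cons => /or3P [zy | /eqP -> | zy]; [right | by left | right].
      by exists false.
    by exists true.
  have linkV w z : z \in x w :: l (x w) -> z \notin S'.
    by have [_ _ sub _ _] := linkP _ (xX w) => /sub; rewrite VE.
  have memP j z : z \in a j :: rcons (q j) (b j) -> z \notin S'.
    have [[aK bK _ _ _] sqV _] := qP j; rewrite in_cons mem_rcons in_cons.
    by case/or3P=> [/eqP -> | /eqP -> | /sqV]; rewrite ?VE // KS.
  have link_eq w w' z : z \in x w :: l (x w) -> z \in x w' :: l (x w') -> w = w'.
    move=> zw zw'; apply: inj_x; apply: contrapT => /eqP ne.
    by have := link_disj _ _ z (xX w) (xX w') ne zw; rewrite zw'.
  apply: (@assemble_cycles T e K S col k a' b' q').
  - move=> [i []]; first by have [[]] := qP (g i).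
    have [_ _ _ l0 m0] := linkP _ (xX (i, false)); have [_ _ _ l1 m1] := linkP _ (xX (i, true)).
    split=> // z; rewrite mem_cat mem_rev in_cons => /or3P [/m0 // | /eqP -> | /m1 //].
    by apply/negP => /KS; rewrite sS'.
  - move=> [i []]; first by have [[]] := qP (g i).
    have [_ u0 _ _ _] := linkP _ (xX (i, false)); have [_ u1 _ _ _] := linkP _ (xX (i, true)).
    rewrite FR cat_uniq rev_uniq u0 andTb cons_uniq u1 andbT; apply/andP; split.
      apply/hasPn => z; rewrite mem_rev in_cons => /orP [/eqP -> | z1]; apply/negP => z0.
        by have := linkV _ _ z0; rewrite sS'.
      by have := link_eq _ _ _ z0 z1; case.
    by apply/negP => /linkV; rewrite sS'.
  - move=> [i []] [j []] z uv.
    + by apply: disjP; apply: contra_neq uv => /= /inj_g ->.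
    + move=> zi; apply/negP => /memR [eqz | [d zl]]; first by have := memP _ _ zi; rewrite eqz sS'.
      by have := freeJ _ _ z (gJ i) (xX (j, d)) zl; rewrite zi.
    + move=> /memR zi; apply/negP => zj; case: zi => [eqz | [d zl]].
        by have := memP _ _ zj; rewrite eqz sS'.
      by have := freeJ _ _ z (gJ j) (xX (i, d)) zl; rewrite zj.
    have ij : i != j by apply: contra_neq uv => ->.
    move=> /memR zi; apply/negP => /memR zj; case: zi zj => [-> | [d zi]] [eqz | [d' zj]].
    + by rewrite (inj_s _ _ eqz) eqxx in ij.
    + by have := linkV _ _ zj; rewrite sS'.
    + by have := linkV _ _ zi; rewrite eqz sS'.
    by have := link_eq _ _ _ zi zj => -[eqij]; rewrite eqij eqxx in ij.
  - move=> i; rewrite tailR cat_path /a' /=.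
    have [p0 _ _ _ _] := linkP _ (xX (i, false)); have [p1 _ _ _ _] := linkP _ (xX (i, true)).
    set y := x (i, false) in p0 *.
    have -> : last (last y (l y)) (rev (belast y (l y))) = y.
      have := congr1 (last y) (rev_rcons (belast y (l y)) (last y (l y))).
      by rewrite -lastI rev_cons last_rcons.
    rewrite p1 (sx (i, true)) sym_e (sx (i, false)) /= !andbT rev_path.
    by rewrite -(eq_path (e := e)) // => u v; rewrite sym_e.
  - by move=> i; rewrite /q' /= size_cat addnS.
  - move=> i; apply/hasP; exists (s i); last by apply: (subsetP sS); apply: sS'.
    by rewrite FR mem_cat mem_head orbT.
  - move=> i _; have [[_ _ _ _ pth] _ ->] := qP (g i); split=> //; exact: eqxx.
  exact: linkK.
right; exists (Z :|: S'), c; split.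
- exact: subsetUr.
- by apply: leq_trans (leq_card_setU _ _) _; rewrite cardS'; move: cardZ k0; move: #|Z| => a1; clear; lia.
move=> x y; rewrite !in_setU !negb_or => /andP [xZ xS] /andP [yZ yS]; apply: cP.
  by rewrite in_setD xZ VE.
by rewrite in_setD yZ VE.
Qed.
End Cases.

Theorem theorem12 (T : finType) (e : rel T) (k : nat) (S : {set T}) :
  simple_graph e ->
  0 < k ->
  k_connected e (50 * k) ->
  k <= #|S| ->
  (exists cs : seq (seq T),
      [/\ size cs = k,
          all (odd_S_cycle e S) cs &
          pairwise (fun c d : seq T => [disjoint c & d]) cs])
  \/
  (exists X : {set T},
      bipartite_minus e X /\
      forall S' : {set T}, S' \subset S -> #|S'| = k ->
        #|X| <= 2 * k - 2 + tau_ind e S').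
Proof.
move=> [sym_e irr_e] k0 conn leS.
have : exists S' : {set T}, S' \subset S /\ #|S'| = k.
  have /card_geqP [s [us szs sub]] := leS; exists [set x in s]; split.
    by apply/subsetP => x; rewrite inE => /sub.
  by rewrite cardsE (card_uniqP us).
case/(exists_min (tau_ind e)) => S1 [[sS1 cardS1] minS1].
have [| [Z [c [sSZ cardZ cP]]]] := odd_cycles_or_nearly_bipartite sym_e irr_e k0 conn sS1 cardS1; first by left.
have [| [X [bipX cardX]]] := nearly_bipartite sym_e irr_e k0 conn sS1 cardS1 sSZ cardZ cP; first by left.
right; exists X; split=> // S2 sS2 cardS2; apply: leq_trans cardX _.
by rewrite leq_add2l minS1.
Qed.
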